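(* For every integer $t$ there exists an integer $\tau$ (depending only on $t$) such that the following holds. Let $G\in\mathcal{C}_{tt}$, let $S$ be a minimal separator of $G$, and let $Y\subseteq S\setminus\operatorname{Hub}(G)$ be a stable set. Then $|Y|\leq\tau$.
   Context: Graphs are finite and simple; a path is an induced path and $P^*$ its interior. A hole is an induced cycle on at least four vertices; a theta is three internally vertex-disjoint paths between two vertices, each of length at least 2, with pairwise anticomplete interiors; a prism consists of three vertex-disjoint paths $a_i\text{-}\dots\text{-}b_i$, each of length at least 1, with $a_1a_2a_3$, $b_1b_2b_3$ triangles and no other edges between them; a wheel $(H,x)$ is a hole $H$ and a vertex $x$ with at least three neighbors in $H$, even if that number is even. $\mathcal{C}$: graphs with no induced $C_4$, theta, prism or even wheel; $\mathcal{C}_t$: those with no clique of size $t$; $\mathcal{C}_{tt}$: those in $\mathcal{C}_t$ with no induced generalized $t$-pyramid, where a generalized $k$-pyramid is a graph whose vertex set is the disjoint union of paths $P,Q,R_1,\dots,R_k$ such that $P\cup Q$ is a hole; $R_i$ has ends $a_i,b_i$; $a_i$ has exactly two neighbors $x_i,y_i$ in $P$, both in $P^*$ and adjacent; $b_i$ has exactly one neighbor $z_i$ in $Q$; $R_i\setminus\{a_i,b_i\}$ is anticomplete to $P\cup Q$; distinct $R_i$ are pairwise anticomplete; $P$ traverses $x_1,y_1,\dots,x_k,y_k$ in order; $Q$ traverses $z_1,\dots,z_k$ in order (some may coincide); $y_i\neq x_{i+1}$. A wheel $(H,x)$ is a twin wheel if $N(x)\cap H$ induces a path of length two, a short pyramid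 if $|N(x)\cap H|=3$ and $x$ has exactly two adjacent neighbors in $H$, proper otherwise; $\operatorname{Hub}(G)$ is the set of $x$ with $(H,x)$ a proper wheel for some hole $H$. A set $X\subseteq V(G)$ is a minimal separator if there exist $u,v$ in different components of $G\setminus X$ that lie in the same component of $G\setminus Y$ for every $Y\subsetneq X$. *)

(* Defs.v *)
From mathcomp Require Import all_boot.

Set Implicit Arguments.
Unset Strict Implicit.
Unset Printing Implicit Defensive.

Structure sgraph := SGraph {
  svertex :> finType;
  adj : rel svertex;
  adj_sym : symmetric adj;
  adj_irrefl : irreflexive adj }.

Section Graph.

Variable G : sgraph.
Implicit Types (x y z a b u v : G) (p q c : seq G) (A B H X Y : {set G}).

Definition anticomplete A B : Prop :=
  forall u v, u \in A -> v \in B -> ~~ adj u v.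

Definition stable A : Prop := anticomplete A A.

Definition clique A : Prop :=
  forall u v, u \in A -> v \in A -> u != v -> adj u v.

(* A path is given by the sequence of its vertices, listed from one end to the
   other; it is nonempty, possibly with one vertex, and its length is
   (size p).-1. All paths are induced in G. *)
Definition is_path p : Prop :=
  [/\ 0 < size p, uniq p &
      forall x0 i j, i < size p -> j < size p ->
        adj (nth x0 p i) (nth x0 p j) = (j == i.+1) || (i == j.+1)].

(* The defaults of head and last are irrelevant, since p is nonempty. *)
Definition path_between a b p : Prop :=
  [/\ is_path p, head b p = a & last a p = b].

Definition verts p : {set G} := [set v in p].

Definition interior p : {set G} :=
  [set v in p | (v != head v p) && (v != last v p)].

Definition is_hole_cycle c : Prop :=
  [/\ 4 <= size c, uniq c &
      forall x0 i j, i < size c -> j < size c ->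
        adj (nth x0 c i) (nth x0 c j) =
          (j == i.+1 %[mod size c]) || (i == j.+1 %[mod size c])].

Definition is_hole H : Prop := exists2 c, is_hole_cycle c & H = verts c.

Definition has_C4 : Prop := exists2 H, is_hole H & #|H| = 4.

Definition has_theta : Prop :=
  exists a b (p : 'I_3 -> seq G),
    (forall i, path_between a b (p i) /\ 2 <= (size (p i)).-1) /\
    (forall i j, i != j ->
       [disjoint interior (p i) & interior (p j)] /\
       anticomplete (interior (p i)) (interior (p j))).

Definition has_prism : Prop :=
  exists (a b : 'I_3 -> G) (p : 'I_3 -> seq G),
    (forall i, path_between (a i) (b i) (p i) /\ 1 <= (size (p i)).-1) /\
    (forall i j, i != j ->
       [disjoint p i & p j] /\
       forall u v, u \in p i -> v \in p j ->
         adj u v = ((u == a i) && (v == a j)) || ((u == b i) && (v == b j))).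

Definition nbrs_in H x : {set G} := [set v in H | adj x v].

Definition is_wheel H x : Prop := is_hole H /\ 3 <= #|nbrs_in H x|.

Definition has_even_wheel : Prop :=
  exists H x, is_wheel H x /\ ~~ odd #|nbrs_in H x|.

Definition twin_wheel H x : Prop :=
  is_wheel H x /\
  exists p, [/\ is_path p, (size p).-1 = 2 & nbrs_in H x = verts p].

(* Exactly one pair of the neighbors of x in H is adjacent. *)
Definition short_pyramid H x : Prop :=
  [/\ is_wheel H x, #|nbrs_in H x| = 3 &
      exists u v, [/\ u \in nbrs_in H x, v \in nbrs_in H x, adj u v &
        forall u' v', u' \in nbrs_in H x -> v' \in nbrs_in H x -> adj u' v' ->
          [set u'; v'] = [set u; v]]].

Definition proper_wheel H x : Prop :=
  [/\ is_wheel H x, ~ twin_wheel H x & ~ short_pyramid H x].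

Definition Hub x : Prop := exists H, proper_wheel H x.

(* The paths R i may consist of a single vertex a i = b i, and the orders in
   which P and Q are traversed are those of the sequences p and q. *)
Definition has_generalized_pyramid (k : nat) : Prop :=
  exists (p q : seq G) (r : 'I_k -> seq G) (a b x y z : 'I_k -> G),
    [/\ [/\ is_path p, is_path q & forall i, path_between (a i) (b i) (r i)],
        [/\ [disjoint p & q],
            forall i, [disjoint r i & p] /\ [disjoint r i & q] &
            forall i j, i != j -> [disjoint r i & r j]],
        is_hole (verts p :|: verts q),
        [/\ forall i, nbrs_in (verts p) (a i) = [set x i; y i],
            forall i, [/\ x i \in interior p, y i \in interior p &
                          adj (x i) (y i)],
            forall i, nbrs_in (verts q) (b i) = [set z i],
            forall i, anticomplete (verts (r i) :\: [set a i; b i])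
                                   (verts p :|: verts q) &
            forall i j, i != j -> anticomplete (verts (r i)) (verts (r j))] &
        [/\ forall i, index (x i) p <= index (y i) p,
            forall i j : 'I_k, i < j -> index (y i) p <= index (x j) p,
            forall i j : 'I_k, j = i.+1 :> nat -> y i != x j &
            forall i j : 'I_k, i <= j -> index (z i) q <= index (z j) q]].

(* Meaningful for u and v outside X. *)
Definition same_component X u v : bool :=
  connect [rel a b | [&& a \notin X, b \notin X & adj a b]] u v.

Definition minimal_separator X : Prop :=
  exists u v, [/\ u \notin X, v \notin X, ~~ same_component X u v &
    forall Y, Y \proper X -> same_component Y u v].

End Graph.

Definition class_C (G : sgraph) : Prop :=
  [/\ ~ has_C4 G, ~ has_theta G, ~ has_prism G & ~ has_even_wheel G].

Definition class_Ct (t : nat) (G : sgraph) : Prop :=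
  class_C G /\ ~ (exists2 A : {set G}, clique A & #|A| = t).

Definition class_Ctt (t : nat) (G : sgraph) : Prop :=
  class_Ct t G /\ ~ has_generalized_pyramid G t.

(* Main.v *)
Require Import Defs.
From mathcomp Require Import all_boot.
From mathcomp Require Import zify.
From Stdlib Require Import Classical.

(** A minimal separator [S] has two full components [D1] and [D2].  For three vertices
    of [Y], a minimal connector inside [Di] is either an induced subdivided claw or a
    triangle with three legs ("tri").  A claw on both sides gives a theta and a triangle
    on both sides a prism; in the degenerate cases, where the branching happens at a
    vertex of [Y], that vertex would be a hub.  Hence, by Ramsey, if [Y] is large then on
    a large subset one side has only claws and the other only triangles.

    On each side, grow an induced path from a private terminal, always keeping a part of
    the component that still reaches many terminals; excluding [K_t] bounds how often
    the path has to branch.  On the triangle side this yields a comb whose legs are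
    attached along edges of the path.  On the claw side it yields either a comb whose legs
    are attached at single vertices, or a path on which many terminals have exactly three
    neighbours, two of them consecutive; such a path can be rerouted so as to be threaded
    through these terminals.  By Ramsey again both combs meet the terminals in the
    same order, and gluing them along the terminals gives a generalized t-pyramid. *)

Set Implicit Arguments.
Unset Strict Implicit.
Unset Printing Implicit Defensive.

(** The non-hub hypothesis enters through holes made of one link on each side of the separator: a
    terminal with at least three neighbours in such a hole has exactly three, two of them adjacent.
    Vertices on opposite sides are never adjacent, so a terminal cannot see two nonadjacent vertices
    of one link and also a vertex of the other. While a path grows, the walked part together with
    its first terminal is kept as a connected set [B] behind the current root. With this spare leg,
    any two neighbours of the root complete a claw or a triangle: they are pairwise nonadjacent
    where triangles are excluded, and pairwise adjacent where claws are excluded. The growth is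
    obstructed only by an induced path that sees many terminals; a shortest such path ends at two
    private terminals and is treated on its own. In the final pyramid the two extreme teeth are
    spent to close the hole. In the threaded case two more are spent, to show that the remaining
    terminals are not themselves triangle corners. *)

(** * Finite sets and Ramsey's theorem *)

Lemma minimal_subset (T : finType) (P : {set T} -> Prop) A :
  P A -> exists X : {set T},
    [/\ X \subset A, P X & forall X' : {set T}, X' \proper X -> ~ P X'].
Proof.
have [n] := ubnP #|A|; elim: n A => // n IHn A ltA PA.
case: (classic (exists X' : {set T}, X' \proper A /\ P X')) => [[X' [sX' PX']]|noX].
  have [|X [sX PX minX]] := IHn X' _ PX'.
    by have := proper_card sX'; lia.
  by exists X; split=> //; apply: subset_trans sX (proper_sub sX').
by exists A; split=> // X' sX' PX'; apply: noX; exists X'.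
Qed.

Lemma cards3_ord (T : finType) (A : {set T}) :
  #|A| = 3 -> exists2 y : 'I_3 -> T, injective y & forall i, y i \in A.
Proof.
move=> A3; exists (fun i => enum_val (cast_ord (esym A3) i)) => [i j|i].
  by move/enum_val_inj/cast_ord_inj.
exact: enum_valP.
Qed.

Lemma subset_of_card (T : finType) (A : {set T}) n :
  n <= #|A| -> exists2 B : {set T}, B \subset A & #|B| = n.
Proof.
move=> /card_geqP [s [us <- sA]]; exists [set x in s].
  by apply/subsetP=> x; rewrite inE => /sA.
by rewrite cardsE (card_uniqP us).
Qed.

(** A vertex [x] is fixed and each [r]-set of the others gets the colour of its union with [x]. In a
    set homogeneous for this colouring the inner induction on [a + b] applies, and [x] can be added
    when the smaller target was met in its own colour. [P] is an arbitrary proposition, so colours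
    are decided classically. *)
Lemma ramsey r a b : exists N, forall (T : finType) (Y : {set T})
    (P : {set T} -> Prop), N <= #|Y| -> exists2 Z : {set T}, Z \subset Y &
  (#|Z| = a /\ forall S : {set T}, S \subset Z -> #|S| = r -> P S) \/
  (#|Z| = b /\ forall S : {set T}, S \subset Z -> #|S| = r -> ~ P S).
Proof.
elim: r a b => [|r IHr] a b.
  exists (maxn a b) => T Y P; rewrite geq_max => /andP[aY bY].
  case: (classic (P set0)) => P0.
    have [Z sZ cZ] := subset_of_card aY; exists Z => //; left; split=> // S _.
    by move/eqP; rewrite cards_eq0 => /eqP->.
  have [Z sZ cZ] := subset_of_card bY; exists Z => //; right; split=> // S _.
  by move/eqP; rewrite cards_eq0 => /eqP->.
(* When a target is [0] the empty set reaches it, having no subset of size [r.+1]. *)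
have triv (T : finType) (S : {set T}) : S \subset set0 -> #|S| = r.+1 -> False.
  by rewrite subset0 => /eqP->; rewrite cards0.
have [n] := ubnP (a + b); elim: n a b => // n IHn [|a] [|b] lt_n.
- by exists 0 => T Y P _; exists set0; rewrite ?sub0set //; left; rewrite cards0; split=> // S /triv.
- by exists 0 => T Y P _; exists set0; rewrite ?sub0set //; left; rewrite cards0; split=> // S /triv.
- by exists 0 => T Y P _; exists set0; rewrite ?sub0set //; right; rewrite cards0; split=> // S /triv.
have [|N1 HN1] := IHn a b.+1; first by lia.
have [|N2 HN2] := IHn a.+1 b; first by lia.
have [N HN] := IHr N1 N2.
exists N.+1 => T Y P ltN.
have [x xY] : exists x, x \in Y by apply/set0Pn; rewrite -card_gt0; lia.
have cYx : #|Y| = #|Y :\ x|.+1 by rewrite (cardsD1 x) xY.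
have [|Z sZ HZ] := HN T (Y :\ x) (fun S => P (x |: S)); first by lia.
have xZ : x \notin Z by apply/negP => /(subsetP sZ); rewrite !inE eqxx.
have sZY : Z \subset Y by apply: subset_trans sZ (subsetDl _ _).
have ext (Z' : {set T}) (Q : {set T} -> Prop) : Z' \subset Z ->
    (forall S : {set T}, S \subset Z -> #|S| = r -> Q (x |: S)) ->
    (forall S : {set T}, S \subset Z' -> #|S| = r.+1 -> Q S) ->
    forall S : {set T}, S \subset x |: Z' -> #|S| = r.+1 -> Q S.
  move=> sZ' Q1 Q2 S sS cS; have [xS|xS] := boolP (x \in S).
    rewrite -(setD1K xS); apply: Q1.
      apply: subset_trans sZ'; apply/subsetP => y; rewrite !inE => /andP[yx /(subsetP sS)].
      by rewrite !inE (negPf yx).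
    by move: cS; rewrite (cardsD1 x) xS; lia.
  apply: Q2 => //; apply/subsetP => y yS; move/(subsetP sS): (yS).
  by rewrite !inE => /orP[/eqP yx|//]; rewrite -yx yS in xS.
have cx (Z' : {set T}) : Z' \subset Z -> #|x |: Z'| = #|Z'|.+1.
  by move=> sZ'; rewrite cardsU1 (contra (subsetP sZ' x) xZ).
have sx (Z' : {set T}) : Z' \subset Z -> x |: Z' \subset Y.
  by move=> sZ'; rewrite subUset sub1set xY (subset_trans sZ').
case: HZ => [] [cZ PZ].
  have [|Z' sZ' [] [cZ' PZ']] := HN1 T Z P; first by rewrite cZ.
    exists (x |: Z'); first exact: sx.
    left; rewrite cx // cZ'; split=> //; exact: (ext Z' P).
  by exists Z'; [apply: subset_trans sZY | right].
have [|Z' sZ' [] [cZ' PZ']] := HN2 T Z P; first by rewrite cZ.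
  by exists Z'; [apply: subset_trans sZY | left].
exists (x |: Z'); first exact: sx.
right; rewrite cx // cZ'; split=> //; exact: (ext Z' (fun S => ~ P S)).
Qed.

(** * Connected sets and induced paths *)

Section Graphs.

Variable G : sgraph.
Implicit Types (u v w x y z c : G) (s p q : seq G) (A B C N X : {set G}).

Lemma adjC u v : adj u v = adj v u.
Proof. exact: adj_sym. Qed.

Lemma adjxx u : adj u u = false.
Proof. exact: adj_irrefl. Qed.

Lemma adj_neq u v : adj u v -> u != v.
Proof. by apply: contraTneq => ->; rewrite adjxx. Qed.

Definition closed_in A B := forall u v, u \in B -> v \in A -> adj u v -> v \in B.

(** Connectedness is stated by closed parts instead of walks, which suits unions and deletions of
    sets. The empty set counts as connected. *)
Definition conn A :=
  forall B, B \subset A -> B != set0 -> closed_in A B -> B = A.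

Definition far A B := forall u v, u \in A -> v \in B -> u != v /\ ~~ adj u v.

Lemma far_sym A B : far A B -> far B A.
Proof. by move=> f u v uB vA; rewrite eq_sym adjC; apply: f. Qed.

Lemma far_sub A B A' B' :
  A' \subset A -> B' \subset B -> far A B -> far A' B'.
Proof. by move=> /subsetP sA /subsetP sB f u v /sA uA /sB; apply: f. Qed.

Lemma conn_sub_closed A X C u :
  conn A -> A \subset X -> closed_in X C -> u \in A -> u \in C -> A \subset C.
Proof.
move=> cA sA cC uA uC; apply/setIidPl; apply: cA; first exact: subsetIl.
  by apply/set0Pn; exists u; rewrite inE uA.
move=> v w; rewrite !inE => /andP[vA vC] wA vw; rewrite wA.
exact: cC vC (subsetP sA _ wA) vw.
Qed.

Lemma conn1 x : conn [set x].
Proof.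
move=> B sB /set0Pn[y yB] _; apply/eqP; rewrite eqEsubset sB sub1set.
by move: (subsetP sB _ yB); rewrite inE => /eqP <-.
Qed.

Lemma conn0 : conn set0.
Proof. by move=> B; rewrite subset0 => ->. Qed.

Lemma connU A B u v :
  conn A -> conn B -> u \in A -> v \in B -> (u == v) || adj u v ->
  conn (A :|: B).
Proof.
move=> cA cB uA vB uv C sC /set0Pn[w wC] clC.
have subA : forall w', w' \in A -> w' \in C -> A \subset C.
  by move=> w' w'A; apply: (conn_sub_closed cA _ clC w'A); apply: subsetUl.
have subB : forall w', w' \in B -> w' \in C -> B \subset C.
  by move=> w' w'B; apply: (conn_sub_closed cB _ clC w'B); apply: subsetUr.
apply/eqP; rewrite eqEsubset sC subUset.
move/(subsetP sC): (wC); rewrite inE => /orP[wA|wB].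
  have sA := subA _ wA wC; rewrite sA (subB v) //.
  have := subsetP sA u uA; case/orP: uv => [/eqP-> //|uv] uC.
  by apply: (clC u v uC _ uv); rewrite inE vB orbT.
have sB := subB _ wB wC; rewrite sB andbT (subA u) //.
have := subsetP sB v vB; case/orP: uv => [/eqP-> //|uv] vC.
by apply: (clC v u vC _ _); [rewrite inE uA | rewrite adjC uv].
Qed.

Lemma conn_add A x u : conn A -> u \in A -> adj x u -> conn (x |: A).
Proof.
by move=> cA uA xu; apply: (@connU [set x] A x u); rewrite ?inE ?xu ?orbT //; apply: conn1.
Qed.

(** The component of [w] is the least closed subset containing it: a closed proper part containing
    [w] would be smaller, and one missing [w] could be removed. *)
Lemma comp_ex A w : w \in A ->
  exists C, [/\ C \subset A, w \in C, conn C & closed_in A C].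
Proof.
move=> wA.
have [|C [sC [wC clC] minC]] :=
  @minimal_subset G (fun C => w \in C /\ closed_in A C) A; first by split.
exists C; split=> // B sB /set0Pn[x xB] clB.
have clBA : closed_in A B.
  move=> u v uB vA uv; apply: (clB u v uB _ uv).
  exact: clC (subsetP sB _ uB) vA uv.
apply/eqP; apply/negPn/negP => BC.
have [wB|wB] := boolP (w \in B).
  by apply: (minC B); rewrite ?properEneq ?BC.
apply: (minC (C :\: B)).
  rewrite properE subsetDl; apply/subsetPn; exists x; first exact: (subsetP sB).
  by rewrite inE xB.
split; first by rewrite inE wB.
move=> u v; rewrite !inE => /andP[uB uC] vA uv; have vC := clC _ _ uC vA uv.
rewrite vC andbT; apply: contra uB => vB; apply: (clB v u vB uC _).
by rewrite adjC.
Qed.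

Lemma conn_edge A B w : conn A -> B \subset A -> B != set0 ->
  w \in A -> w \notin B -> exists u v, [/\ u \in B, v \in A, v \notin B & adj u v].
Proof.
move=> cA sB B0 wA wB; apply: NNPP => no.
have BA : B = A.
  apply: cA => // u v uB vA uv; apply: contraT => vB.
  by case: no; exists u, v.
by rewrite BA wA in wB.
Qed.

Fixpoint ipath s :=
  if s is x :: s' then
    [&& x \notin s', all (fun v => adj x v == (v == head x s')) s' & ipath s']
  else true.

(** The defaults of [last] and [head] never matter, since the sequences contain [u] and [v]. *)
Definition joins s1 s2 := forall u v, u \in s1 -> v \in s2 ->
  u != v /\ adj u v = (u == last v s1) && (v == head u s2).

Lemma ipath_cons x s : ipath (x :: s) <-> ipath s /\ joins [:: x] s.
Proof.
split.
  case/and3P=> xs /allP al ips; split=> // u v; rewrite inE => /eqP-> vs.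
  split; first by apply: contraNneq xs => ->.
  by rewrite /= eqxx (eqP (al v vs)).
case=> ips jn; apply/and3P; split=> //.
  by apply/negP => xs; have := jn x x (mem_head _ _) xs; rewrite eqxx => -[].
apply/allP=> v vs; have [_ ->] := jn x v (mem_head _ _) vs.
by rewrite /= eqxx.
Qed.

Lemma last_indep (T : eqType) (x y z : T) (s : seq T) : x \in s -> last y s = last z s.
Proof. by case: s. Qed.

Lemma head_indep (T : eqType) (x y z : T) (s : seq T) : x \in s -> head y s = head z s.
Proof. by case: s. Qed.

Lemma ipath_cat s1 s2 :
  ipath (s1 ++ s2) <-> [/\ ipath s1, ipath s2 & joins s1 s2].
Proof.
elim: s1 => [|x s1 IH]; first by split=> [|[]].
rewrite cat_cons.
split=> [/ipath_cons[/IH[i1 i2 j12] jx]|[/ipath_cons[i1 jx] i2 j12]].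
  split=> //.
    apply/ipath_cons; split=> // u v; rewrite inE => /eqP-> vs1.
    have [|ne ->] := jx x v (mem_head _ _); first by rewrite mem_cat vs1.
    by split=> //; case: (s1) vs1.
  move=> u v; rewrite inE => /orP[/eqP->|us1] vs2.
    have [|ne ->] := jx x v (mem_head _ _); first by rewrite mem_cat vs2 orbT.
    split=> //; rewrite /= eqxx /=.
    case: s1 {IH i1 ne} j12 jx => [|a s1] j12 jx; first by rewrite /= eqxx.
    rewrite /=.
    have va : v != a.
      by have [] := j12 a v (mem_head _ _) vs2; rewrite eq_sym.
    have xl : (x == last a s1) = false.
      apply/negbTE; have [||ne' _] // := jx x (last a s1); first exact: mem_head.
      by rewrite mem_cat mem_last.
    by rewrite (negPf va) xl.
  have [ne ->] := j12 u v us1 vs2; split=> //=.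
  by rewrite (last_indep x v us1).
apply/ipath_cons; split.
  apply/IH; split=> // u v us1 vs2.
  have [|ne ->] := j12 u v _ vs2; first by rewrite inE us1 orbT.
  by split=> //=; rewrite (last_indep x v us1).
move=> u v; rewrite inE mem_cat => /eqP-> /orP[vs1|vs2].
  have [ne ->] := jx x v (mem_head _ _) vs1; split=> //=.
  by congr (_ && _); case: (s1) vs1.
have [ne ->] := j12 x v (mem_head _ _) vs2; split=> //=.
rewrite eqxx /=; case: s1 {IH i1} jx j12 => [|a s1] jx j12 /=; rewrite ?eqxx //.
have -> : (v == a) = false.
  by apply/negbTE; rewrite eq_sym; have [] := j12 a v _ vs2; rewrite ?inE ?eqxx ?orbT.
have [] := jx x (last a s1) (mem_head _ _); first exact: mem_last.
by move/negbTE->.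
Qed.

Lemma ipath_uniq s : ipath s -> uniq s.
Proof. by elim: s => //= x s IH /and3P[-> _ /IH]. Qed.

Lemma ipath_rev s : ipath s -> ipath (rev s).
Proof.
elim: s => // x s IH /ipath_cons[ips jx].
rewrite rev_cons -cats1; apply/ipath_cat; split=> //; first exact: IH.
move=> u v; rewrite mem_rev inE => us /eqP->.
have [ne e] := jx x u (mem_head _ _) us.
rewrite eq_sym adjC e; split=> //=; rewrite !eqxx andbT /=.
by case: (s) us => // a s' _; rewrite rev_cons last_rcons.
Qed.

Lemma ipath_nth x0 s i j : ipath s -> i < size s -> j < size s ->
  adj (nth x0 s i) (nth x0 s j) = (j == i.+1) || (i == j.+1).
Proof.
elim: s i j => // x s IH i j /ipath_cons[ips jx].
have ux := ipath_uniq ips.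
have h k : k < size s -> adj x (nth x0 s k) = (k == 0).
  move=> ks; have [|_ ->] := jx x (nth x0 s k) (mem_head _ _); first exact: mem_nth.
  rewrite /= eqxx /=; case: (s) ks ux => // a s' ks ux.
  by rewrite /= -[X in _ == X]/(nth x0 (a :: s') 0) nth_uniq.
case: i => [|i]; case: j => [|j] //=; rewrite ?ltnS => li lj.
- by rewrite adjxx.
- by rewrite h // orbF eqSS.
- by rewrite adjC h.
exact: IH.
Qed.

Lemma ipath_is_path s : s != [::] -> ipath s -> is_path s.
Proof.
move=> s0 ips; split; [by case: (s) s0 | exact: ipath_uniq |].
by move=> x0 i j li lj; apply: ipath_nth.
Qed.

Lemma ipath_adj s u v : ipath s -> u \in s -> v \in s ->
  adj u v = (index v s == (index u s).+1) || (index u s == (index v s).+1).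
Proof.
move=> ips us vs.
by rewrite -{1}(nth_index u us) -{1}(nth_index u vs) ipath_nth ?index_mem.
Qed.

(** All holes of the proof are made in this way. When one of the paths has a single vertex, both
    closing edges end in it. *)
Lemma hole_of_paths s1 s2 : ipath s1 -> ipath s2 -> 0 < size s1 -> 0 < size s2 ->
  4 <= size s1 + size s2 ->
  (forall u v, u \in s1 -> v \in s2 -> u != v /\
     adj u v = (u == last v s1) && (v == head u s2)
            || (u == head v s1) && (v == last u s2)) ->
  is_hole_cycle (s1 ++ s2).
Proof.
move=> ip1 ip2 n1 n2 n4 J; split; first by rewrite size_cat.
  rewrite cat_uniq !ipath_uniq // andbT /=; apply/hasPn=> v vs2.
  by apply/negP=> vs1; have [] := J v v vs1 vs2; rewrite eqxx.
move=> x0; rewrite size_cat.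
have u1 := ipath_uniq ip1; have u2 := ipath_uniq ip2.
set n := size s1 + size s2.
(* Only the last index wraps around, so the modular successor is resolved before the arithmetic is
   left to [lia]. *)
have modS i : i < n -> i.+1 %% n = if i.+1 == n then 0 else i.+1.
  move=> li; case: eqP => [->|ne]; first by rewrite modnn.
  by rewrite modn_small; lia.
have cross i j : i < size s1 -> j < size s2 ->
    adj (nth x0 s1 i) (nth x0 s2 j) = (i.+1 == size s1) && (j == 0)
       || (i == 0) && (j.+1 == size s2).
  move=> li lj.
  have [||_ ->] := J (nth x0 s1 i) (nth x0 s2 j); rewrite ?mem_nth //.
  have e1 : last (nth x0 s2 j) s1 = nth x0 s1 (size s1).-1.
    by rewrite (last_indep _ x0 (mem_nth x0 li)) nth_last.
  have e2 : last (nth x0 s1 i) s2 = nth x0 s2 (size s2).-1.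
    by rewrite (last_indep _ x0 (mem_nth x0 lj)) nth_last.
  have e3 : head (nth x0 s2 j) s1 = nth x0 s1 0.
    by rewrite (head_indep _ x0 (mem_nth x0 li)) nth0.
  have e4 : head (nth x0 s1 i) s2 = nth x0 s2 0.
    by rewrite (head_indep _ x0 (mem_nth x0 lj)) nth0.
  rewrite e1 e2 e3 e4 !nth_uniq ?ltn_predL //.
  have -> : (i == (size s1).-1) = (i.+1 == size s1) by lia.
  by have -> : (j == (size s2).-1) = (j.+1 == size s2) by lia.
move=> i j li lj; rewrite !nth_cat.
rewrite (modn_small li) (modn_small lj) !modS //.
case: (ltnP i (size s1)) => i1; case: (ltnP j (size s1)) => j1.
- rewrite ipath_nth //; case: (i.+1 =P n); case: (j.+1 =P n); rewrite /n; lia.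
- rewrite cross; [case: (i.+1 =P n); case: (j.+1 =P n); rewrite /n; lia | lia | rewrite /n in lj; lia].
- rewrite adjC cross; [case: (i.+1 =P n); case: (j.+1 =P n); rewrite /n; lia | lia | rewrite /n in li; lia].
- rewrite ipath_nth //; [case: (i.+1 =P n); case: (j.+1 =P n); rewrite /n; lia | rewrite /n in li; lia | rewrite /n in lj; lia].
Qed.

(** Unless [w] lies in [N], the component of [w] outside [N] has a neighbour [b] in [N]. A path to
    [w] inside this component that meets the neighbourhood of [b] only in its first vertex can be
    extended by [b]. Replacing [N] by the neighbourhood of [b] in the recursion is what keeps the
    path induced. *)
Lemma conn_ipath_to A N w u :
  conn A -> w \in A -> u \in A -> u \in N -> exists x s,
  [/\ ipath (x :: s), {subset x :: s <= A}, x \in N,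
      forall v, v \in s -> v \notin N & last x s = w].
Proof.
have [n] := ubnP #|A|; elim: n A N w u => // n IHn A N w u ltA cA wA uA uN.
have [wN|wN] := boolP (w \in N).
  by exists w, [::]; split=> // v; rewrite inE => /eqP->.
have [|C [sC wC cC clC]] := @comp_ex (A :\: N) w; first by rewrite inE wN.
have sCA : C \subset A by apply: subset_trans sC (subsetDl _ _).
have uC : u \notin C by apply/negP => /(subsetP sC); rewrite inE uN.
have [|a [b [aC bA bC ab]]] := conn_edge cA sCA _ uA uC.
  by apply/set0Pn; exists w.
have bN : b \in N.
  apply: contraR bC => bN; apply: (clC a b aC _ ab).
  by rewrite inE bN.
have ltC : #|C| < #|A| by apply: proper_card; rewrite properE sCA; apply/subsetPn; exists u.
have [||x [s [ips sub xN sN las]]] := IHn C [set v | adj b v] w a _ cC wC aC.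
- by lia.
- by rewrite inE adjC.
exists b, (x :: s); split=> //.
- apply/ipath_cons; split=> // y v; rewrite inE => /eqP-> vxs.
  split; first by apply: contraNneq bC => ->; apply: sub.
  rewrite /= eqxx; move: vxs; rewrite inE => /orP[/eqP->|vs].
    by move: xN; rewrite inE eqxx.
  have := sN v vs; rewrite inE => /negbTE->.
  move: vs ips => vs /= /and3P[xs _ _]; apply/esym/negbTE.
  by apply: contraNneq xs => <-.
- move=> v; rewrite inE => /orP[/eqP->//|vxs]; exact: (subsetP sCA _ (sub v vxs)).
- by move=> v /sub /(subsetP sC); rewrite inE => /andP[].
Qed.

Lemma conn_ipath A u w : conn A -> u \in A -> w \in A -> exists s,
  [/\ ipath (u :: s), {subset u :: s <= A} & last u s = w].
Proof.
move=> cA uA wA; have [|x [s [ips sub]]] := conn_ipath_to cA wA uA (_ : u \in [set u]).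
  by rewrite inE.
by rewrite inE => /eqP xu _ las; subst x; exists s.
Qed.

Lemma ipath_conn s : ipath s -> conn [set v in s].
Proof.
elim: s => [|x s IH]; first by move=> _; rewrite (_ : [set v in [::]] = set0);
  [exact: conn0 | apply/setP=> v; rewrite !inE].
case/ipath_cons=> ips jx.
have -> : [set v in x :: s] = x |: [set v in s].
  by apply/setP=> v; rewrite !inE.
case: s IH ips jx => [|a s] IH ips jx.
  rewrite (_ : _ |: _ = [set x]); first exact: conn1.
  by apply/setP=> v; rewrite !inE orbF.
apply: (conn_add (u := a)); [exact: IH | by rewrite !inE eqxx |].
by have [_ ->] := jx x a (mem_head _ _) (mem_head _ _); rewrite /= !eqxx.
Qed.

(** Take a minimal nonempty set avoiding [r] whose removal keeps [X] connected. Some vertex of it is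
    adjacent to the rest and could be put back, so the set is that single vertex. *)
Lemma noncut_ex X r : conn X -> r \in X -> X != [set r] ->
  exists2 v, v \in X :\ r & conn (X :\ v).
Proof.
move=> cX rX Xr.
have [|A [sA [A0 cA] minA]] := @minimal_subset G
   (fun A => A != set0 /\ conn (X :\: A)) (X :\ r).
  split; first by apply: contra Xr; rewrite setD_eq0 subset1 => /orP[//|/eqP X0];
    rewrite X0 inE in rX.
  rewrite (_ : _ :\: _ = [set r]); first exact: conn1.
  by apply/setP=> v; rewrite !inE; case: eqP => [->|_] /=; rewrite ?rX ?andbT ?andNb.
have rA : r \notin A by apply/negP => /(subsetP sA); rewrite !inE eqxx.
have sAX : A \subset X := subset_trans sA (subsetDl _ _).
have [x xA] : exists x, x \in A by apply/set0Pn.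
have [|||u [v [uB vX vB uv]]] := @conn_edge X (X :\: A) x cX (subsetDl _ _).
- by apply/set0Pn; exists r; rewrite inE rA.
- exact: (subsetP sAX).
- by rewrite inE xA.
have vA : v \in A by move: vB; rewrite inE vX andbT negbK.
have AvE : X :\: (A :\ v) = v |: (X :\: A).
  by apply/setP=> w; rewrite !inE; case: eqP => [->|_] //=; rewrite vX.
have A1 : A = [set v].
  apply: NNPP => An; apply: (minA (A :\ v)); first exact: properD1.
  split; last by rewrite AvE; apply: (conn_add cA uB); rewrite adjC.
  by apply/negP; rewrite setD_eq0 subset1 => /orP[/eqP //|/eqP A00]; rewrite A00 eqxx in A0.
by exists v; [exact: (subsetP sA) | rewrite -A1].
Qed.

End Graphs.

(** * Subdivided claws and triangles with legs *)

Section Configurations.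

Variable G : sgraph.
Implicit Types (u v w x y z c : G) (s p q : seq G).
Implicit Types (A B C D N S X Y : {set G}).

(** Connected sets are enough in place of paths: an induced path is chosen in each, and it has
    length at least 2 because its ends are distinct and nonadjacent. *)
Lemma theta_intro c c' (B : 'I_3 -> {set G}) :
  c != c' -> ~~ adj c c' ->
  (forall i, [/\ c \in B i, c' \in B i & conn (B i)]) ->
  (forall i j, i != j -> far (B i :\: [set c; c']) (B j :\: [set c; c'])) ->
  has_theta G.
Proof.
move=> ncc acc HB farB.
have ex i : exists s, [/\ ipath (c :: s), {subset c :: s <= B i} & last c s = c'].
  by have [cB cB' cnB] := HB i; apply: conn_ipath.
have [f Hf] := fin_all_exists ex.
exists c, c', (fun i => c :: f i); split=> [i|i j ij].
  have [ips sub las] := Hf i; split; first by split=> //; apply: ipath_is_path.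
  case: (f i) ips las => [|a [|b s]] // ips las.
    by rewrite /= in las; rewrite las eqxx in ncc.
  move: ips => /ipath_cons[_ /(_ c a (mem_head _ _) (mem_head _ _))[_]].
  by rewrite /= !eqxx => ca; rewrite /= in las; rewrite -las ca in acc.
have int i' v : v \in interior (c :: f i') -> v \in B i' :\: [set c; c'].
  have [_ sub las] := Hf i'; rewrite !inE /= las => /and3P[vi vc vc'].
  by rewrite negb_or vc vc' sub // inE.
have fij := farB _ _ ij.
split; last by move=> u v /int ui /int vj; case: (fij u v ui vj).
apply/pred0P => v /=; apply/negP => /andP[/int vi /int vj].
by case: (fij v v vi vj); rewrite eqxx.
Qed.

Lemma prism_intro (a b : 'I_3 -> G) (B : 'I_3 -> {set G}) :
  (forall i, [/\ a i \in B i, b i \in B i, conn (B i) & a i != b i]) ->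
  (forall i j, i != j -> forall u v, u \in B i -> v \in B j -> u != v /\
     adj u v = (u == a i) && (v == a j) || (u == b i) && (v == b j)) ->
  has_prism G.
Proof.
move=> HB farB.
have ex i : exists s, [/\ ipath (a i :: s), {subset a i :: s <= B i} & last (a i) s = b i].
  by have [aB bB cnB _] := HB i; apply: conn_ipath.
have [f Hf] := fin_all_exists ex.
exists a, b, (fun i => a i :: f i); split=> [i|i j ij].
  have [ips sub las] := Hf i; split; first by split=> //; apply: ipath_is_path.
  have [_ _ _ ab] := HB i.
  by case: (f i) las => [/= abE|//]; rewrite abE eqxx in ab.
have [_ subi _] := Hf i; have [_ subj _] := Hf j.
split; last by move=> u v /subi ui /subj vj; case: (farB _ _ ij u v ui vj).
apply/pred0P => v /=; apply/negP => /andP[/subi vi /subj vj].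
by case: (farB _ _ ij v v vi vj); rewrite eqxx.
Qed.

(** The one consequence of not being a hub that is used: in twin wheels and in short pyramids the
    centre has three neighbours in the hole, two of them adjacent. *)
Lemma nonhub_nbrs H y : ~ Hub y -> is_hole H -> 3 <= #|nbrs_in H y| ->
  #|nbrs_in H y| = 3 /\
  exists u v, [/\ u \in nbrs_in H y, v \in nbrs_in H y & adj u v].
Proof.
move=> nhub hH n3; apply: NNPP => no; apply: nhub; exists H.
split=> //.
  case=> _ [p [[p0 up ap] sp Np]]; apply: no; rewrite Np.
  case: p p0 up ap sp {Np} => [|a [|b [|d [|]]]] //= _ up ap _.
  split.
    rewrite /verts cardsE; have /card_uniqP-> // : uniq [:: a; b; d] by [].
  by exists a, b; rewrite !inE !eqxx orbT; have := ap a 0 1 isT isT => /= ->.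
by case=> _ N3 [u [v [uN vN uv _]]]; apply: no; split=> //; exists u, v.
Qed.

Definition link D y y' s := ipath (y :: rcons s y') /\ {subset s <= D}.

Lemma link_of_conn D A y y' : conn A -> y \in A -> y' \in A -> y != y' ->
  A \subset y |: (y' |: D) -> exists2 s, link D y y' s & {subset s <= A}.
Proof.
move=> cA yA y'A yy' sA.
have [s [ips sub las]] := conn_ipath cA yA y'A.
case/lastP: s ips sub las => [|s w] ips sub las.
  by rewrite /= in las; rewrite las eqxx in yy'.
rewrite last_rcons in las; subst w; exists s.
  split=> // v vs; have := ipath_uniq ips.
  rewrite /= mem_rcons inE rcons_uniq => /andP[]; rewrite negb_or => /andP[_ ys] /andP[y's _].
  have vA : v \in A by apply: sub; rewrite inE mem_rcons inE vs !orbT.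
  move: (subsetP sA v vA); rewrite !inE => /or3P[/eqP vy|/eqP vy|//].
    by rewrite -vy vs in ys.
  by rewrite -vy vs in y's.
by move=> v vs; apply: sub; rewrite inE mem_rcons inE vs !orbT.
Qed.

Definition sides D1 D2 Y := [/\ far D1 D2, forall y, y \in Y -> y \notin D1,
  forall y, y \in Y -> y \notin D2 & stable Y].

Lemma sides_sym D1 D2 Y : sides D1 D2 Y -> sides D2 D1 Y.
Proof. by case=> f n1 n2 st; split=> //; apply: far_sym. Qed.

(** Terminals are nonadjacent, so both links have nonempty interior; the sides are anticomplete, so
    the two paths meet only at their ends. *)
Lemma hole_links D1 D2 Y y y' s1 s2 : sides D1 D2 Y -> y \in Y -> y' \in Y ->
  y != y' -> link D1 y y' s1 -> link D2 y y' s2 ->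
  is_hole ([set v in y :: rcons s1 y'] :|: [set v in s2]).
Proof.
move=> [f n1 n2 st] yY y'Y yy' [ip1 sub1] [ip2 sub2].
have ayy' : ~~ adj y y' by apply: st.
have ne s : ipath (y :: rcons s y') -> s != [::].
  case: s => // /ipath_cons[_ /(_ y y' (mem_head _ _) (mem_head _ _))[_]].
  by rewrite /= !eqxx (negPf ayy').
have s20 := ne _ ip2; have s10 := ne _ ip1.
exists ((y :: rcons s1 y') ++ rev s2); last first.
  by apply/setP=> v; rewrite /verts !in_set mem_cat mem_rev.
have [jy ips2' jy'] : [/\ joins [:: y] s2, ipath s2 & joins s2 [:: y']].
  move: ip2 => /ipath_cons[]; rewrite -cats1 => /ipath_cat[i2 _ j2] jy; split=> //.
  move=> u v uy vs; have [|ne' ->] := jy u v uy; first by rewrite mem_cat vs.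
  by split=> //; case: (s2) vs.
apply: hole_of_paths => //.
- exact: ipath_rev.
- by rewrite size_rev; case: (s2) s20.
- rewrite /= size_rcons size_rev; case: (s1) s10; case: (s2) s20 => //=; lia.
move=> u v us1; rewrite mem_rev => vs2.
have vD := sub2 v vs2.
have lrev : last u (rev s2) = head u s2.
  by case: (s2) s20 => // a s _; rewrite rev_cons last_rcons.
have hrev : head u (rev s2) = last u s2.
  by case/lastP: (s2) s20 => // s a _; rewrite rev_rcons last_rcons.
rewrite lrev hrev /= last_rcons.
move: us1; rewrite inE mem_rcons inE => /or3P[/eqP->|/eqP->|us1].
- have [nyv ->] := jy y v (mem_head _ _) vs2; split=> //=.
  rewrite (negPf yy') /= eqxx /=; by case: (s2) vs2.
- have [nyv] := jy' v y' vs2 (mem_head _ _); rewrite adjC => ->; split; first by rewrite eq_sym.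
  rewrite /= !eqxx andbT [y' == y]eq_sym (negPf yy') orbF /=.
  by [].
have [nuv auv] := f u v (sub1 u us1) vD; split=> //; rewrite (negPf auv).
have nuy : u != y by apply: contraTneq (sub1 u us1) => ->; exact: n1.
have nuy' : u != y' by apply: contraTneq (sub1 u us1) => ->; exact: n1.
by rewrite (negPf nuy) (negPf nuy').
Qed.

Definition mid D y y' c := exists s, link D y y' s /\
  exists u v, [/\ u \in s, v \in s, u != v, ~~ adj u v & adj c u && adj c v].

(** The two neighbours given by [mid] lie in [D1] and [w] in [D2], so the three are pairwise
    nonadjacent. The two links form a hole in which [c] would have either more than three neighbours
    or three with no adjacent pair. *)
Lemma hub_mid D1 D2 Y y y' c s2 w : sides D1 D2 Y -> y \in Y -> y' \in Y ->
  y != y' -> ~ Hub c -> mid D1 y y' c -> link D2 y y' s2 ->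
  w \in s2 -> adj c w -> False.
Proof.
move=> sd yY y'Y yy' nhub [s1 [l1 [u [v [us vs uv auv /andP[cu cv]]]]]] l2 ws cw.
have hH := hole_links sd yY y'Y yy' l1 l2.
set H := _ :|: _ in hH.
have sub : [set u; v; w] \subset nbrs_in H c.
  by apply/subsetP=> a; rewrite !inE !mem_rcons !inE => /orP[/orP[]|] /eqP->;
    rewrite ?us ?vs ?ws ?cu ?cv ?cw ?orbT.
have [f _ _ _] := sd.
have [uw auw] : u != w /\ ~~ adj u w by apply: f; [apply: l1.2|apply: l2.2].
have [vw avw] : v != w /\ ~~ adj v w by apply: f; [apply: l1.2|apply: l2.2].
have c3 : #|[set u; v; w]| = 3.
  by rewrite setUC cardsU1 !inE negb_or cards2 uv ![w == _]eq_sym uw vw.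
have [|N3 [a [b [aN bN ab]]]] := nonhub_nbrs nhub hH.
  by rewrite -c3 subset_leq_card.
have NE : [set u; v; w] = nbrs_in H c by apply/eqP; rewrite eqEcard sub N3 c3.
move: aN bN ab; rewrite -NE !inE => /orP[/orP[]|] /eqP-> /orP[/orP[]|] /eqP->;
  rewrite ?adjxx ?(negPf auv) ?(negPf auw) ?(negPf avw) //;
  by rewrite adjC ?(negPf auv) ?(negPf auw) ?(negPf avw).
Qed.

(** Connected sets instead of paths, so that legs on the two sides can be merged by plain union. *)
Definition leg D y A := [/\ y \in A, A \subset y |: D & conn A].

Definition legs D S (A : G -> {set G}) := forall y, y \in S -> leg D y (A y).

(* An induced subdivided claw attached to [S] through [D]; its centre may be a
   vertex of [S], which is then a leg of length 0. *)
Definition claw D S := exists c (A : G -> {set G}),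
  [/\ legs D S A,
      forall y y', y \in S -> y' \in S -> y != y' -> far (A y :\ c) (A y' :\ c) &
      [/\ c \in D, forall y, y \in S -> c \notin A y
        & forall y, y \in S -> exists2 u, u \in A y & adj c u]
   \/ [/\ c \in S, A c = [set c],
          forall y, y \in S -> y != c -> exists2 u, u \in A y & adj c u
        & forall y y', y \in S :\ c -> y' \in S :\ c -> y != y' -> mid D y y' c]].

(** The corner [C y] may be the terminal [y] itself, a leg of length 0. *)
Definition tri D S := exists (C : G -> G) (A : G -> {set G}),
  [/\ legs D S A, forall y, y \in S -> C y \in A y &
      forall y y', y \in S -> y' \in S -> y != y' -> forall u v,
        u \in A y -> v \in A y' ->
        u != v /\ adj u v = (u == C y) && (v == C y')].

Lemma conn_addx A x :
  conn A -> x \in A \/ (exists2 u, u \in A & adj x u) -> conn (x |: A).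
Proof.
move=> cA [xA|[u uA xu]]; last exact: (conn_add cA uA xu).
by rewrite (setUidPr _) // sub1set.
Qed.

(** Without [c] the two legs would be disconnected from each other, so an induced path in their
    union with [c] has to pass through it. *)
Lemma link_through D A1 A2 y y' c u1 u2 : y != y' -> far A1 A2 ->
  y \in A1 -> y' \in A2 -> A1 \subset y |: D -> A2 \subset y' |: D ->
  conn A1 -> conn A2 -> c \in D -> u1 \in A1 -> adj c u1 ->
  u2 \in A2 -> adj c u2 -> exists2 s, link D y y' s & c \in s.
Proof.
move=> yy' f yA y'A s1 s2 c1 c2 cD u1A cu1 u2A cu2.
have cA : conn ((c |: A1) :|: A2).
  apply: (@connU _ _ _ c u2) => //; last by rewrite cu2 orbT.
    exact: conn_add cu1.
  by rewrite !inE eqxx.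
have [||||s l sub] := @link_of_conn D _ y y' cA => //.
- by rewrite !inE yA orbT.
- by rewrite !inE y'A orbT.
- apply/subsetP=> v; rewrite !inE => /orP[/orP[/eqP->|/(subsetP s1)]|/(subsetP s2)].
  + by rewrite cD !orbT.
  + by rewrite !inE => /orP[->|->]; rewrite ?orbT.
  + by rewrite !inE => /orP[->|->]; rewrite ?orbT.
exists s => //; apply: contraT => cs.
have [ips sD] := l.
have sU : [set v in y :: rcons s y'] \subset A1 :|: A2.
  apply/subsetP=> v; rewrite !inE mem_rcons inE => /or3P[/eqP->|/eqP->|vs].
  - by rewrite yA.
  - by rewrite y'A orbT.
  have := sub v vs; rewrite !inE => /orP[/orP[/eqP vc|->//]|->]; last by rewrite orbT.
  by rewrite -vc vs in cs.
have clA : closed_in (A1 :|: A2) A1.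
  move=> u v uA; rewrite inE => /orP[//|vA uv].
  by have [_] := f u v uA vA; rewrite uv.
have yU : y \in [set v in y :: rcons s y'] by rewrite !inE eqxx.
have /subsetP/(_ y') := conn_sub_closed (ipath_conn ips) sU clA yU yA.
rewrite !inE mem_rcons !inE eqxx orbT => /(_ isT) y'1.
by have [] := f y' y' y'1 y'A; rewrite eqxx.
Qed.

Lemma other_two S c : #|S| = 3 -> c \in S ->
  exists y y', [/\ y \in S :\ c, y' \in S :\ c & y != y'].
Proof.
move=> S3 cS; have /eqP/cards2P[y [y' [yy' SE]]] : #|S :\ c| = 2.
  by move: S3; rewrite (cardsD1 c) cS => -[].
by exists y, y'; rewrite SE !inE !eqxx orbT.
Qed.

Section TwoSides.

Variables (D1 D2 Y S : {set G}).
Hypothesis sd : sides D1 D2 Y.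
Hypothesis sS : S \subset Y.
Hypothesis S3 : #|S| = 3.
Hypothesis nhub : forall y, y \in Y -> ~ Hub y.

Lemma legs_cross (A A' : G -> {set G}) y y' u v :
  legs D1 S A -> legs D2 S A' -> y \in S -> y' \in S ->
  u \in A y -> v \in A' y' -> [\/ u = y, v = y' | u != v /\ ~~ adj u v].
Proof.
move=> lA lA' yS y'S uA vA.
have [_ /subsetP sA _] := lA y yS; have [_ /subsetP sA' _] := lA' y' y'S.
move: (sA u uA) (sA' v vA); rewrite !inE.
case/orP=> [/eqP->|uD]; first by constructor 1.
case/orP=> [/eqP->|vD]; first by constructor 2.
by constructor 3; have [f _ _ _] := sd; apply: f.
Qed.

(** Legs on different sides can only meet or see each other at a terminal, and a terminal belongs to
    both of its legs; the farness of either side then applies. *)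
Lemma far_both (A A' : G -> {set G}) c c' y y' :
  legs D1 S A -> legs D2 S A' ->
  (forall y y', y \in S -> y' \in S -> y != y' -> far (A y :\ c) (A y' :\ c)) ->
  (forall y y', y \in S -> y' \in S -> y != y' -> far (A' y :\ c') (A' y' :\ c')) ->
  y \in S -> y' \in S -> y != y' ->
  far ((A y :|: A' y) :\: [set c; c']) ((A y' :|: A' y') :\: [set c; c']).
Proof.
move=> lA lA' fA fA' yS y'S yy'.
have [yA _ _] := lA y yS; have [yA' _ _] := lA' y yS.
have [y'A _ _] := lA y' y'S; have [y'A' _ _] := lA' y' y'S.
move=> u v; rewrite !inE !negb_or.
move=> /andP[/andP[uc uc'] uA] /andP[/andP[vc vc'] vA].
have f : u \in A y -> v \in A y' -> u != v /\ ~~ adj u v.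
  by move=> u1 v1; apply: (fA y y'); rewrite // !inE ?uc ?vc.
have f' : u \in A' y -> v \in A' y' -> u != v /\ ~~ adj u v.
  by move=> u1 v1; apply: (fA' y y'); rewrite // !inE ?uc' ?vc'.
case/orP: uA => uA; case/orP: vA => vA; [exact: f | | | exact: f'].
- case: (legs_cross lA lA' yS y'S uA vA) => [uy|vy'|//].
    by apply: f' => //; rewrite uy.
  by apply: f => //; rewrite vy'.
- case: (legs_cross lA lA' y'S yS vA uA) => [vy|uy'|[]].
  + by apply: f' => //; rewrite vy.
  + by apply: f => //; rewrite uy'.
  + by rewrite eq_sym adjC.
Qed.

(** Excludes an edge from a centre in [S] to a centre on the other side: two legs of the other claw
    and [c'] give a link through a neighbour of [c], which together with [mid] makes [c] a hub. *)
Lemma claw_mid_False c c' (A' : G -> {set G}) : legs D2 S A' ->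
  (forall y y', y \in S -> y' \in S -> y != y' -> far (A' y :\ c') (A' y' :\ c')) ->
  c' \in D2 -> (forall y, y \in S -> c' \notin A' y) ->
  (forall y, y \in S -> exists2 u, u \in A' y & adj c' u) ->
  c \in S -> adj c c' ->
  (forall y y', y \in S :\ c -> y' \in S :\ c -> y != y' -> mid D1 y y' c) ->
  False.
Proof.
move=> lA' fA' cD c'A att cS cc' HM.
have [y [y' [yS y'S yy']]] := other_two S3 cS.
have m := HM y y' yS y'S yy'.
move: yS y'S; rewrite !inE => /andP[yc yS] /andP[y'c y'S].
have [yA sA cA] := lA' y yS; have [y'A sA' cA'] := lA' y' y'S.
have [u uA cu] := att y yS; have [u' uA' cu'] := att y' y'S.
have e z : z \in S -> A' z :\ c' = A' z.
  by move=> zS; apply/setDidPl; rewrite disjoint_sym disjoints1 c'A.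
have f := fA' y y' yS y'S yy'; rewrite !e // in f.
have [s l cs] := link_through yy' f yA y'A sA sA' cA cA' cD uA cu uA' cu'.
exact: (hub_mid sd (subsetP sS y yS) (subsetP sS y' y'S) yy'
          (nhub (subsetP sS c cS)) m l cs cc').
Qed.

End TwoSides.

(** The two centres are the ends of a theta, and the legs of each terminal, merged over the two
    sides, contain its paths. *)
Lemma not_both_claw D1 D2 Y S : ~ has_theta G -> sides D1 D2 Y -> S \subset Y ->
  #|S| = 3 -> (forall y, y \in Y -> ~ Hub y) -> claw D1 S -> claw D2 S -> False.
Proof.
move=> noth sd sS S3 nhub [c [A [lA fA H]]] [c' [A' [lA' fA' H']]].
have [f n1 n2 st] := sd; have sdC := sides_sym sd.
(* A theta needs distinct nonadjacent ends. This could fail only if a centre is a terminal, and then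
   that terminal would be a hub. *)
have ncc : c != c' /\ ~~ adj c c'.
  case: H H' => [[cD cA att]|[cS Ac att HM]] [[cD' cA' att']|[cS' Ac' att' HM']].
  - exact: f.
  - split; first by apply: contraTneq cD => ->; apply: n1; apply: (subsetP sS).
    apply/negP; rewrite adjC => cc'.
    exact: (claw_mid_False sdC sS S3 nhub lA fA cD cA att cS' cc' HM').
  - split; first by apply: contraTneq cD' => <-; apply: n2; apply: (subsetP sS).
    apply/negP=> cc'.
    exact: (claw_mid_False sd sS S3 nhub lA' fA' cD' cA' att' cS cc' HM).
  split; last by apply: st; apply: (subsetP sS).
  apply/negP=> /eqP cc'; subst c'.
  have [y [y' [yS y'S yy']]] := other_two S3 cS.
  have m := HM y y' yS y'S yy'; have [s [l [u [_ [us _ _ _ /andP[cu _]]]]]] := HM' y y' yS y'S yy'.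
  move: yS y'S; rewrite !inE => /andP[_ yS] /andP[_ y'S].
  exact: (hub_mid sd (subsetP sS y yS) (subsetP sS y' y'S) yy'
            (nhub _ (subsetP sS c cS)) m l us cu).
have [y injy yS] := cards3_ord S3.
case: ncc => ncc acc; apply: noth.
apply: (@theta_intro c c' (fun i => c |: (c' |: (A (y i) :|: A' (y i))))) => //.
  move=> i; have yiS := yS i; split; rewrite ?inE ?eqxx ?orbT //.
  have [yA _ cA] := lA _ yiS; have [yA' _ cA'] := lA' _ yiS.
  have cU : conn (A (y i) :|: A' (y i)).
    by apply: (connU cA cA' yA yA'); rewrite eqxx.
  apply: conn_addx; first apply: conn_addx => //.
    case: H' => [[_ _ /(_ _ yiS)[u uA cu]]|[c'S Ac' att _]].
      by right; exists u; rewrite // inE uA orbT.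
    have [yc|/(att _ yiS)[u uA cu]] := eqVneq (y i) c'.
      by left; rewrite yc Ac' !inE eqxx orbT.
    by right; exists u; rewrite // inE uA orbT.
  case: H => [[_ _ /(_ _ yiS)[u uA cu]]|[cS Ac att _]].
    by right; exists u; rewrite // !inE uA orbT.
  have [yc|/(att _ yiS)[u uA cu]] := eqVneq (y i) c.
    by left; rewrite yc Ac !inE eqxx orbT.
  by right; exists u; rewrite // !inE uA orbT.
move=> i j ij.
have yij : y i != y j by apply: contraNneq ij => /injy->.
have fij := far_both sd lA lA' fA fA' (yS i) (yS j) yij.
have E i' : (c |: (c' |: (A (y i') :|: A' (y i')))) :\: [set c; c'] =
            (A (y i') :|: A' (y i')) :\: [set c; c'].
  by apply/setP=> v; rewrite !inE; case: (v == c); case: (v == c').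
by rewrite !E.
Qed.

(** Merged at the terminals, the legs give a prism unless both corners of some [y] coincide. Then
    they equal [y], and the merged legs of the other two terminals give a hole on which [y] sees
    four corners, so that [y] would be a hub. *)
Lemma not_both_tri D1 D2 Y S : ~ has_prism G -> sides D1 D2 Y -> S \subset Y ->
  #|S| = 3 -> (forall y, y \in Y -> ~ Hub y) -> tri D1 S -> tri D2 S -> False.
Proof.
move=> nopr sd sS S3 nhub [C [A [lA CA H]]] [C' [A' [lA' CA' H']]].
have [f n1 n2 st] := sd.
have J y y' : y \in S -> y' \in S -> y != y' -> forall u v,
    u \in A y :|: A' y -> v \in A y' :|: A' y' -> u != v /\
    adj u v = (u == C y) && (v == C y') || (u == C' y) && (v == C' y').
  move=> yS y'S yy' u v uB vB.
  have [yA _ _] := lA y yS; have [yA' _ _] := lA' y yS.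
  have [y'A _ _] := lA y' y'S; have [y'A' _ _] := lA' y' y'S.
  have h : u \in A y -> v \in A y' -> u != v /\
    adj u v = (u == C y) && (v == C y') || (u == C' y) && (v == C' y').
    move=> uA vA; have [-> e] := H y y' yS y'S yy' u v uA vA; split=> //.
    apply/idP/orP => [|[|/andP[/eqP uC /eqP vC]]]; rewrite -?e; [by left|by []|].
    have [||_ ->] := H' y y' yS y'S yy' u v; rewrite ?uC ?vC ?eqxx ?CA' //.
  have h' : u \in A' y -> v \in A' y' -> u != v /\
    adj u v = (u == C y) && (v == C y') || (u == C' y) && (v == C' y').
    move=> uA vA; have [-> e] := H' y y' yS y'S yy' u v uA vA; split=> //.
    apply/idP/orP => [|[/andP[/eqP uC /eqP vC]|]]; rewrite -?e; [by right| |by []].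
    have [||_ ->] := H y y' yS y'S yy' u v; rewrite ?uC ?vC ?eqxx ?CA //.
  have hN : u != v /\ ~~ adj u v -> (u \in A y /\ v \in A' y') \/ (u \in A' y /\ v \in A y') -> u != v /\
    adj u v = (u == C y) && (v == C y') || (u == C' y) && (v == C' y').
    move=> [ne /negbTE e] _; split=> //; rewrite e; apply/esym/negbTE; rewrite negb_or.
    apply/andP; split; apply/negP=> /andP[/eqP uC /eqP vC].
      have [||_] := H y y' yS y'S yy' u v; rewrite ?uC ?vC ?CA // !eqxx.
      by rewrite -uC -vC e.
    have [||_] := H' y y' yS y'S yy' u v; rewrite ?uC ?vC ?CA' // !eqxx.
    by rewrite -uC -vC e.
  move: uB vB; rewrite !inE => /orP[uA|uA] /orP[vA|vA]; [exact: h| | |exact: h'].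
    case: (legs_cross sd lA lA' yS y'S uA vA) => [uy|vy|n].
    + by apply: h' => //; rewrite uy.
    + by apply: h => //; rewrite vy.
    + by apply: hN => //; left.
  case: (legs_cross sd lA lA' y'S yS vA uA) => [vy|uy|[]].
  + by apply: h' => //; rewrite vy.
  + by apply: h => //; rewrite uy.
  + by rewrite eq_sym adjC => ? ?; apply: hN => //; right.
have cB y : y \in S -> [/\ C y \in A y :|: A' y, C' y \in A y :|: A' y & conn (A y :|: A' y)].
  move=> yS; have [yA _ cA] := lA y yS; have [yA' _ cA'] := lA' y yS.
  rewrite !inE CA // CA' // orbT; split=> //.
  by apply: (connU cA cA' yA yA'); rewrite eqxx.
have Cy y : y \in S -> C y = C' y -> C y = y.
  move=> yS CC; have [_ /subsetP sA _] := lA y yS; have [_ /subsetP sA' _] := lA' y yS.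
  move: (sA _ (CA y yS)) (sA' _ (CA' y yS)); rewrite -CC !inE.
  move=> /orP[/eqP//|D1y] /orP[/eqP//|D2y].
  by have [] := f _ _ D1y D2y; rewrite eqxx.
case: (classic (exists2 y, y \in S & C y = C' y)) => [[y yS CC]|no]; last first.
  have [y injy yS] := cards3_ord S3; apply: nopr.
  apply: (@prism_intro (C \o y) (C' \o y) (fun i => A (y i) :|: A' (y i))) => [i|i j ij] /=.
    have [? ? ?] := cB _ (yS i); split=> //.
    by apply/eqP=> CC; apply: no; exists (y i).
  by apply: J => //; apply: contraNneq ij => /injy->.
have yE := Cy y yS CC.
have [y1 [y2 []]] := other_two S3 yS.
rewrite !inE => /andP[y1y y1S] /andP[y2y y2S] y12.
have yy1 : y != y1 by rewrite eq_sym.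
have yy2 : y != y2 by rewrite eq_sym.
(* Only one terminal can have coinciding corners, since corners of a triangle are adjacent and
   terminals are not. *)
have nC z : z \in S -> y != z -> C z != C' z.
  move=> zS yz; apply/eqP=> CCz.
  have [_] := H y z yS zS yz _ _ (CA y yS) (CA z zS).
  rewrite !eqxx yE (Cy z zS CCz) => yz1.
  by have := st y z (subsetP sS _ yS) (subsetP sS _ zS); rewrite yz1.
have pth z : z \in S -> y != z -> exists s, [/\ ipath (C z :: s),
    {subset C z :: s <= A z :|: A' z}, last (C z) s = C' z & s != [::]].
  move=> zS yz; have [CB CB' cnB] := cB z zS; have [s [ips sub las]] := conn_ipath cnB CB CB'.
  exists s; split=> //; case: s las {ips sub} => //= CCz.
  by have := nC z zS yz; rewrite CCz eqxx.
have [s1 [ip1 sub1 las1 n01]] := pth y1 y1S yy1.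
have [s2 [ip2 sub2 las2 n02]] := pth y2 y2S yy2.
(* Both paths have distinct ends, hence at least two vertices, and the only edges between them join
   corresponding corners. *)
have hc : is_hole_cycle ((C y1 :: s1) ++ rev (C y2 :: s2)).
  apply: hole_of_paths; rewrite ?size_rev //.
  - exact: ipath_rev.
  - by move: n01 n02; case: (s1) (s2) => [|? ?] [|? ?] //=; lia.
  move=> u v us; rewrite mem_rev => vs.
  have [ne ->] := J y1 y2 y1S y2S y12 u v (sub1 u us) (sub2 v vs); split=> //.
  have -> : last v (C y1 :: s1) = C' y1 by [].
  have -> : head u (rev (C y2 :: s2)) = C' y2.
    by rewrite -las2; case/lastP: (s2) n02 => // a b _; rewrite rev_cons rev_rcons last_rcons.
  by rewrite rev_cons last_rcons /= orbC.
set H0 := verts ((C y1 :: s1) ++ rev (C y2 :: s2)).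
have hH : is_hole H0 by exists ((C y1 :: s1) ++ rev (C y2 :: s2)).
have memC z : z \in S -> y != z -> adj y (C z).
  by move=> zS yz; have [_] := H y z yS zS yz _ _ (CA y yS) (CA z zS); rewrite !eqxx yE.
have memC' z : z \in S -> y != z -> adj y (C' z).
  by move=> zS yz; have [_] := H' y z yS zS yz _ _ (CA' y yS) (CA' z zS); rewrite !eqxx -CC yE.
have ends z s : last (C z) s = C' z -> C z \in C z :: s /\ C' z \in C z :: s.
  by move=> <-; rewrite mem_head mem_last.
have [e1 e1'] := ends _ _ las1; have [e2 e2'] := ends _ _ las2.
have sub : [set C y1; C' y1; C y2; C' y2] \subset nbrs_in H0 y.
  apply/subsetP=> v; rewrite 3!in_setU !in_set1.
  by rewrite /nbrs_in /H0 /verts !in_set mem_cat mem_rev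
    => /orP[/orP[/orP[]|]|] /eqP->; rewrite ?e1 ?e1' ?e2 ?e2' ?orbT /= ?memC ?memC'.
have c4 : #|[set C y1; C' y1; C y2; C' y2]| = 4.
  have d u v : u \in C y1 :: s1 -> v \in C y2 :: s2 -> u != v.
    by move=> us vs; have [] := J y1 y2 y1S y2S y12 u v (sub1 u us) (sub2 v vs).
  have U : uniq [:: C y1; C' y1; C y2; C' y2].
    by rewrite /= !inE !negb_or nC // (nC y2) // !d.
  rewrite -[4]/(size [:: C y1; C' y1; C y2; C' y2]) -(card_uniqP U).
  by apply: eq_card => v; rewrite !inE -!orbA.
have [|N3 _] := nonhub_nbrs (nhub y (subsetP sS _ yS)) hH.
  by apply: leq_trans (subset_leq_card sub); rewrite c4.
by have := subset_leq_card sub; rewrite N3 c4.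
Qed.

End Configurations.

(** * A third terminal attached to a path between two others *)

Section Attachments.

Variable G : sgraph.
Implicit Types (x y z c : G) (s p q : seq G).
Implicit Types (A B C D N S X Y : {set G}).

Lemma split_first (P : pred G) s : has P s ->
  exists u a v, [/\ s = u ++ a :: v, P a & ~~ has P u].
Proof.
elim: s => [|x s IH]; first by [].
have [Px _|nPx] := boolP (P x); first by exists [::], x, s.
rewrite /= (negPf nPx) => /IH[u [a [v [-> Pa nu]]]].
by exists (x :: u), a, v; split; rewrite //= (negPf nPx).
Qed.

Lemma ipath_far s1 m s2 : ipath (s1 ++ m ++ s2) -> m != [::] ->
  far [set v in s1] [set v in s2].
Proof.
move=> /ipath_cat[_ ipm jn] m0 u v; rewrite !inE => us vs.
have [|ne ->] := jn u v us; first by rewrite mem_cat vs orbT.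
split=> //; rewrite negb_and; apply/orP; right.
case: m m0 {jn} ipm => // a m _ /ipath_uniq /=.
by rewrite mem_cat => /andP[/norP[_ h] _]; apply: contraNneq h => <-.
Qed.

Lemma ipath_consecutive s a b t : ipath (s ++ [:: a, b & t]) -> adj a b.
Proof.
move=> /ipath_cat[_ /ipath_cons[_ j] _].
by have [_ ->] := j a b (mem_head _ _) (mem_head _ _); rewrite /= !eqxx.
Qed.

(** For a vertex attached to the path, the three cases will give respectively a claw centred on the
    path, a triangle, and a claw centred at the attached vertex. *)
Lemma nbr_cases (P : pred G) p : ipath p -> has P p ->
  [\/ exists u a v, [/\ p = u ++ a :: v, P a, ~~ has P u & ~~ has P v],
      exists u a b v, [/\ p = u ++ [:: a, b & v], P a && P b, ~~ has P u & ~~ has P v] |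
      exists x x', [/\ x \in p, x' \in p, x != x', ~~ adj x x' & P x && P x']].
Proof.
move=> ip /split_first[u [a [v [pE Pa nu]]]].
have [/split_first[m [b [w [vE Pb nm]]]]|nv] := boolP (has P v); last first.
  by constructor 1; exists u, a, v.
have far3 t r : v = t ++ r -> t != [::] -> forall b', b' \in r -> P b' ->
    exists x x', [/\ x \in p, x' \in p, x != x', ~~ adj x x' & P x && P x'].
  move=> vtx t0 b' bx Pb'; exists a, b'.
  have := @ipath_far (rcons u a) t r; rewrite cat_rcons -vtx -pE => /(_ ip t0 a b').
  rewrite !inE mem_rcons mem_head bx => /(_ isT isT)[-> ->].
  by rewrite pE vtx !mem_cat !inE !mem_cat bx eqxx !orbT Pa Pb'.
case: m vE nm => [|d m] vE nm; last first.
  by constructor 3; apply: (far3 (d :: m) (b :: w) vE isT b (mem_head _ _) Pb).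
have [/hasP[b' bw Pb']|nw] := boolP (has P w).
  by constructor 3; apply: (far3 [:: b] w vE isT b' bw Pb').
by constructor 2; exists u, a, b, w; rewrite pE vE Pa Pb.
Qed.

Lemma split_two p x x' : ipath p -> x \in p -> x' \in p -> x != x' ->
  ~~ adj x x' -> exists s1 a m h s2,
  [/\ p = s1 ++ a :: m ++ h :: s2, m != [::] & [set a; h] = [set x; x']].
Proof.
move=> ip xp x'p xx' axx'.
case/splitPr: xp ip x'p => p1 p2 ip; rewrite mem_cat inE [x' == x]eq_sym (negPf xx') /=.
case/orP=> /splitPr sp; case: sp ip => q1 q2 ip.
  exists q1, x', q2, x, p2; split; [by rewrite -catA | | by rewrite setUC].
  case: q2 ip => //; rewrite -catA => /ipath_consecutive.
  by rewrite adjC (negPf axx').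
exists p1, x, q1, x', q2; split=> //.
by case: q1 ip => // /ipath_consecutive; rewrite (negPf axx').
Qed.

Lemma link_rev D y y' s : link D y y' s -> link D y' y (rev s).
Proof.
case=> ip sub; split; last by move=> v; rewrite mem_rev => /sub.
by have := ipath_rev ip; rewrite rev_cons rev_rcons.
Qed.

Lemma mid_sym D y y' c : mid D y y' c -> mid D y' y c.
Proof.
case=> s [l [u [v [us vs uv auv cuv]]]]; exists (rev s); split.
  exact: link_rev.
by exists u, v; rewrite !mem_rev.
Qed.

Definition choose3 y1 y2 A1 A2 A3 y : {set G} :=
  if y == y1 then A1 else if y == y2 then A2 else A3.

Lemma choose3E y1 y2 y3 A1 A2 A3 : [/\ y1 != y2, y1 != y3 & y2 != y3] ->
  [/\ choose3 y1 y2 A1 A2 A3 y1 = A1, choose3 y1 y2 A1 A2 A3 y2 = A2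
    & choose3 y1 y2 A1 A2 A3 y3 = A3].
Proof.
case=> n12 n13 n23; rewrite /choose3 !eqxx.
by rewrite [y2 == _]eq_sym [y3 == _]eq_sym [y3 == y2]eq_sym (negPf n12) (negPf n13) (negPf n23).
Qed.

Lemma in_set3 y1 y2 y3 (P : G -> Prop) :
  P y1 -> P y2 -> P y3 -> forall y, y \in [set y1; y2; y3] -> P y.
Proof. by move=> ? ? ? y; rewrite !inE -orbA => /or3P[]/eqP->. Qed.

Lemma in_set3_pairs y1 y2 y3 (P : G -> G -> Prop) :
  (forall y y', P y y' -> P y' y) -> P y1 y2 -> P y1 y3 -> P y2 y3 ->
  forall y y', y \in [set y1; y2; y3] -> y' \in [set y1; y2; y3] -> y != y' -> P y y'.
Proof.
move=> sym p12 p13 p23 y y'; rewrite !inE -!orbA.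
by case/or3P=> /eqP-> /or3P[]/eqP->; rewrite ?eqxx // => _; apply: sym.
Qed.

Lemma claw_intro D y1 y2 y3 c A1 A2 A3 :
  [/\ y1 != y2, y1 != y3 & y2 != y3] ->
  leg D y1 A1 -> leg D y2 A2 -> leg D y3 A3 ->
  far A1 A2 -> far A1 A3 -> far A2 A3 ->
  c \in D -> c \notin A1 -> c \notin A2 -> c \notin A3 ->
  (exists2 u, u \in A1 & adj c u) -> (exists2 u, u \in A2 & adj c u) ->
  (exists2 u, u \in A3 & adj c u) -> claw D [set y1; y2; y3].
Proof.
move=> ny l1 l2 l3 f12 f13 f23 cD c1 c2 c3 e1 e2 e3.
exists c, (choose3 y1 y2 A1 A2 A3).
have [E1 E2 E3] := choose3E A1 A2 A3 ny.
split; [by apply: in_set3; rewrite ?E1 ?E2 ?E3 | | left; split=> //].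
- apply: in_set3_pairs; rewrite ?E1 ?E2 ?E3; first by move=> *; apply: far_sym.
  + by apply: far_sub f12; apply: subsetDl.
  + by apply: far_sub f13; apply: subsetDl.
  + by apply: far_sub f23; apply: subsetDl.
- by apply: in_set3; rewrite ?E1 ?E2 ?E3.
- by apply: in_set3; rewrite ?E1 ?E2 ?E3.
Qed.

Lemma claw_center D y1 y2 y3 A1 A2 :
  [/\ y1 != y2, y1 != y3 & y2 != y3] ->
  leg D y1 A1 -> leg D y2 A2 -> far A1 A2 ->
  (exists2 u, u \in A1 & adj y3 u) -> (exists2 u, u \in A2 & adj y3 u) ->
  mid D y1 y2 y3 -> claw D [set y1; y2; y3].
Proof.
move=> ny l1 l2 f12 e1 e2 md.
have l3 : leg D y3 [set y3].
  by split; [rewrite inE | rewrite subsetUl | apply: conn1].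
exists y3, (choose3 y1 y2 A1 A2 [set y3]).
have [E1 E2 E3] := choose3E A1 A2 [set y3] ny; have [n12 n13 n23] := ny.
split; [by apply: in_set3; rewrite ?E1 ?E2 ?E3 | | right; split].
- apply: in_set3_pairs; rewrite ?E1 ?E2 ?E3; first by move=> *; apply: far_sym.
  + by apply: far_sub f12; apply: subsetDl.
  + by move=> u v _; rewrite setDv inE.
  + by move=> u v _; rewrite setDv inE.
- by rewrite !inE eqxx orbT.
- by [].
- by apply: in_set3 => //; rewrite ?E1 ?E2 ?eqxx.
move=> y y'; rewrite !inE -!orbA => /andP[/negPf y3y] /or3P[]/eqP yE; subst y;
  move=> /andP[/negPf y3y'] /or3P[]/eqP yE; subst y'; rewrite ?eqxx // in y3y y3y' * => _ //.
exact: mid_sym.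
Qed.

Definition cross A B a b := forall u v, u \in A -> v \in B ->
  u != v /\ adj u v = (u == a) && (v == b).

Lemma cross_sym A B a b : cross A B a b -> cross B A b a.
Proof. by move=> h u v uB vA; have [] := h v u vA uB; rewrite eq_sym adjC andbC. Qed.

Lemma tri_intro D y1 y2 y3 c1 c2 c3 A1 A2 A3 :
  [/\ y1 != y2, y1 != y3 & y2 != y3] ->
  leg D y1 A1 -> leg D y2 A2 -> leg D y3 A3 ->
  c1 \in A1 -> c2 \in A2 -> c3 \in A3 ->
  cross A1 A2 c1 c2 -> cross A1 A3 c1 c3 -> cross A2 A3 c2 c3 ->
  tri D [set y1; y2; y3].
Proof.
move=> ny l1 l2 l3 cA1 cA2 cA3 x12 x13 x23.
exists (fun y => if y == y1 then c1 else if y == y2 then c2 else c3).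
exists (choose3 y1 y2 A1 A2 A3).
have [E1 E2 E3] := choose3E A1 A2 A3 ny; have [n12 n13 n23] := ny.
have e21 : (y2 == y1) = false by rewrite eq_sym (negPf n12).
have e31 : (y3 == y1) = false by rewrite eq_sym (negPf n13).
have e32 : (y3 == y2) = false by rewrite eq_sym (negPf n23).
split; [by apply: in_set3; rewrite ?E1 ?E2 ?E3 | |].
  by apply: in_set3; rewrite ?E1 ?E2 ?E3 ?eqxx ?e21 ?e31 ?e32.
apply: in_set3_pairs; rewrite ?E1 ?E2 ?E3 ?eqxx ?e21 ?e31 ?e32 //.
by move=> y y'; exact: cross_sym.
Qed.

Lemma link_prefix D y1 y2 s1 s2 : link D y1 y2 (s1 ++ s2) ->
  leg D y1 [set v in y1 :: s1].
Proof.
case; rewrite rcons_cat -cat_cons => /ipath_cat[ip _ _] sub; split.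
- by rewrite !inE eqxx.
- apply/subsetP=> v; rewrite !inE => /orP[->//|vs].
  by rewrite sub ?orbT // mem_cat vs.
- exact: ipath_conn.
Qed.

Lemma link_suffix D y1 y2 s1 s2 : link D y1 y2 (s1 ++ s2) ->
  leg D y2 [set v in rcons s2 y2].
Proof.
case; rewrite rcons_cat -cat_cons => /ipath_cat[_ ip _] sub; split.
- by rewrite inE mem_rcons mem_head.
- apply/subsetP=> v; rewrite !inE mem_rcons inE => /orP[->//|vs].
  by rewrite sub ?orbT // mem_cat vs orbT.
- exact: ipath_conn.
Qed.

Lemma link_far D y1 y2 s1 m s2 : link D y1 y2 (s1 ++ m ++ s2) -> m != [::] ->
  far [set v in y1 :: s1] [set v in rcons s2 y2].
Proof. by case; rewrite !rcons_cat -cat_cons => ip _; apply: ipath_far ip. Qed.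

(** The general position of a third terminal: its leg can see the link only from [c], and only in
    the interior. [c] may be [y3]. *)
Definition hangs D y1 y2 p y3 c A :=
  [/\ [/\ y1 != y2, y1 != y3 & y2 != y3], link D y1 y2 p, leg D y3 A, c \in A
    & forall u v, u \in A -> v \in y1 :: rcons p y2 ->
        u != v /\ (adj u v -> u = c /\ v \in p)].

(** The unique neighbour [a] is the centre; the legs are the two halves of the path and [A]. *)
Lemma hang_single D y1 y2 p y3 c A u a v : hangs D y1 y2 p y3 c A ->
  p = u ++ a :: v -> adj c a -> ~~ has (adj c) u -> ~~ has (adj c) v ->
  claw D [set y1; y2; y3].
Proof.
case=> ny lk lg cA HA pE ca nu nv.
have lk' : link D y1 y2 (u ++ [:: a] ++ v) by rewrite /= -pE.
have ip := lk'.1; rewrite !rcons_cat -cat_cons in ip.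
have up := ipath_uniq lk'.1.
have ap : a \in p by rewrite pE mem_cat mem_head orbT.
have farA t : {subset t <= y1 :: rcons p y2} -> ~~ has (adj c) [seq x <- t | x \in p] ->
    far [set x in t] A.
  move=> st nt x z; rewrite inE => xt zA.
  have [ne h] := HA z x zA (st x xt); rewrite eq_sym adjC; split=> //.
  apply/negP=> zx; have [zc xp] := h zx; case/negP: nt; apply/hasP; exists x.
    by rewrite mem_filter xp.
  by rewrite -zc.
have y1p : y1 \notin p.
  by have := ipath_uniq lk.1; rewrite /= mem_rcons inE negb_or => /andP[/andP[]].
have y2p : y2 \notin p.
  by have := ipath_uniq lk.1; rewrite /= rcons_uniq => /andP[_ /andP[]].
have anb b : b \in rcons p y2 -> b != y1.
  move=> bp; have := ipath_uniq lk.1 => /= /andP[h _].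
  by apply: contraNneq h => <-.
apply: (@claw_intro _ _ _ _ a [set x in y1 :: u] [set x in rcons v y2] A) => //.
- exact: link_prefix lk'.
- by apply: (@link_suffix D y1 y2 (rcons u a)); rewrite cat_rcons -pE.
- exact: link_far lk' isT.
- apply: farA.
    by move=> x; rewrite inE pE !inE mem_rcons inE mem_cat => /orP[->//|->]; rewrite !orbT.
  rewrite /= (negPf y1p); apply: contra nu => /hasP[x]; rewrite mem_filter => /andP[_ xu] cx.
  by apply/hasP; exists x.
- apply: farA.
    move=> x; rewrite mem_rcons inE pE !inE mem_rcons inE mem_cat inE.
    by case/orP=> ->; rewrite !orbT.
  rewrite filter_rcons (negPf y2p); apply: contra nv => /hasP[x].
  by rewrite mem_filter => /andP[_ xu] cx; apply/hasP; exists x.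
- exact: lk.2.
- rewrite !inE negb_or anb ?mem_rcons ?inE ?ap ?orbT //=.
  by move: up; rewrite /= rcons_cat cat_uniq /= => /and4P[_ _ /norP[]].
- move: up; rewrite /= rcons_cat cat_uniq /= inE => /and5P[_ _ _ //].
- apply/negP=> aA.
  have [|] := HA a a aA; last by rewrite eqxx.
  by rewrite inE mem_rcons inE ap !orbT.
- exists (last y1 u); first by rewrite inE mem_last.
  move: ip; rewrite lastI cat_rcons adjC => ip.
  exact: (ipath_consecutive ip).
- exists (head y2 v); first by rewrite inE; case: (v) => [|? ?]; rewrite /= mem_head.
  case: (v) ip => [|b v'] ip; exact: (@ipath_consecutive (y1 :: u) _ _ _ ip).
- by exists c => //; rewrite adjC.
Qed.

Lemma hang_pair D y1 y2 p y3 c A u a b v : hangs D y1 y2 p y3 c A ->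
  p = u ++ [:: a, b & v] -> adj c a -> adj c b ->
  ~~ has (adj c) u -> ~~ has (adj c) v -> tri D [set y1; y2; y3].
Proof.
case=> ny lk lg cA HA pE ca cb nu nv.
have pE1 : p = rcons u a ++ b :: v by rewrite cat_rcons.
have pE2 : p = (u ++ [:: a; b]) ++ v by rewrite -catA.
have lk1 := lk; rewrite pE1 in lk1.
have ip := lk1.1; rewrite rcons_cat -cat_cons in ip.
have up := ipath_uniq lk.1.
have y1p : y1 \notin p.
  by move: up; rewrite /= mem_rcons inE negb_or => /andP[/andP[]].
have y2p : y2 \notin p.
  by move: up; rewrite /= rcons_uniq => /andP[_ /andP[]].
have ap : a \in p by rewrite pE mem_cat mem_head orbT.
have bp : b \in p by rewrite pE mem_cat !inE eqxx !orbT.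
have up' : uniq p by move: up; rewrite /= rcons_uniq => /and3P[].
have crossA x t : {subset t <= y1 :: rcons p y2} -> x \in p -> x \in t -> adj c x ->
    (forall z, z \in t -> z \in p -> z != x -> ~~ adj c z) ->
    cross [set z in t] A x c.
  move=> st xp xt cx h z w; rewrite inE => zt wA.
  have [ne hw] := HA w z wA (st z zt); rewrite eq_sym; split=> //.
  rewrite adjC; apply/idP/andP => [wz|[/eqP-> /eqP->]//].
  have [wc zp] := hw wz; subst w; split=> //.
  by apply: contraT => zx; have := h z zt zp zx; rewrite wz.
apply: (@tri_intro _ _ _ _ a b c [set x in y1 :: rcons u a] [set x in rcons (b :: v) y2] A) => //.
- exact: link_prefix lk1.
- exact: link_suffix lk1.
- by rewrite inE in_cons mem_rcons mem_head orbT.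
- by rewrite inE mem_rcons !inE eqxx orbT.
- move=> x z; rewrite !in_set => xu zv; case/ipath_cat: ip => _ _ /(_ x z xu zv)[ne ->].
  by split=> //=; rewrite last_rcons.
- apply: crossA => //.
  + move=> x; rewrite inE mem_rcons inE pE !inE mem_rcons inE mem_cat inE.
    by case/or3P=> ->; rewrite ?orbT.
  + by rewrite inE mem_rcons mem_head orbT.
  move=> z; rewrite inE mem_rcons inE => /or3P[/eqP->|/eqP->|zu] zp; first by rewrite zp in y1p.
    by rewrite eqxx.
  by move=> _; apply: contra nu => cz; apply/hasP; exists z.
- apply: crossA => //.
  + move=> x; rewrite mem_rcons !inE pE mem_rcons inE mem_cat !inE.
    by case/or3P=> ->; rewrite ?orbT.
  + by rewrite mem_rcons !inE eqxx orbT.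
  move=> z; rewrite mem_rcons !inE => /or3P[/eqP->|/eqP->|zu] zp; first by rewrite zp in y2p.
    by rewrite eqxx.
  by move=> _; apply: contra nv => cz; apply/hasP; exists z.
Qed.

(** Here [c] is the centre, and the two legs along the path stop at the two given neighbours, which
    are separated by a nonempty stretch. If [c] is the terminal [y3], the claw is degenerate and the
    link itself witnesses [mid]. *)
Lemma hang_mid D y1 y2 p y3 c A x x' : hangs D y1 y2 p y3 c A ->
  x \in p -> x' \in p -> x != x' -> ~~ adj x x' -> adj c x -> adj c x' ->
  c = y3 \/ [/\ c \in D, leg D y3 (A :\ c) & exists2 u, u \in A :\ c & adj c u] ->
  claw D [set y1; y2; y3].
Proof.
case=> ny lk lg cA HA xp x'p xx' axx' cx cx' H.
have ipp : ipath p.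
  by have := lk.1; rewrite -cats1 -cat1s => /ipath_cat[_ /ipath_cat[]].
have [s1 [a [m [h [s2 [pE m0 E]]]]]] := split_two ipp xp x'p xx' axx'.
have [ca ch] : adj c a /\ adj c h.
  have eq2 w : w \in [set a; h] -> adj c w.
    by rewrite E !inE => /orP[]/eqP->.
  by split; apply: eq2; rewrite !inE eqxx ?orbT.
have pE1 : p = rcons s1 a ++ m ++ h :: s2 by rewrite cat_rcons.
have lk1 : link D y1 y2 (rcons s1 a ++ m ++ h :: s2) by rewrite -pE1.
have l1 := link_prefix lk1.
have l2 : leg D y2 [set z in rcons (h :: s2) y2].
  by apply: (@link_suffix D y1 y2 (rcons s1 a ++ m)); rewrite -catA.
have f12 := link_far lk1 m0.
have e1 : exists2 u, u \in [set z in y1 :: rcons s1 a] & adj c u.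
  by exists a => //; rewrite in_set in_cons mem_rcons mem_head orbT.
have e2 : exists2 u, u \in [set z in rcons (h :: s2) y2] & adj c u.
  by exists h => //; rewrite in_set mem_rcons !inE eqxx orbT.
case: H => [cy|[cD lc [u uA cu]]].
  subst c; apply: claw_center l1 l2 f12 e1 e2 _ => //.
  by exists p; split=> //; exists x, x'; rewrite cx cx'.
have sub1 : {subset y1 :: rcons s1 a <= y1 :: rcons p y2}.
  move=> z; rewrite pE1 !(inE, mem_rcons, mem_cat).
  by case/or3P=> ->; rewrite ?orbT.
have sub2 : {subset rcons (h :: s2) y2 <= y1 :: rcons p y2}.
  move=> z; rewrite pE1 !(inE, mem_rcons, mem_cat).
  by case/or3P=> ->; rewrite ?orbT.
have fA t : {subset t <= y1 :: rcons p y2} -> far [set z in t] (A :\ c).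
  move=> st z w; rewrite !inE => zt /andP[wc wA].
  have [ne hw] := HA w z wA (st z zt); rewrite eq_sym; split=> //.
  by rewrite adjC; apply/negP=> /hw[wc']; rewrite wc' eqxx in wc.
have cn t : {subset t <= y1 :: rcons p y2} -> c \notin [set z in t].
  by move=> st; apply/negP; rewrite inE => ct; have [] := HA c c cA (st c ct); rewrite eqxx.
apply: (@claw_intro _ _ _ _ c _ _ (A :\ c) ny l1 l2 lc f12) => //.
- exact: fA.
- exact: fA.
- exact: cn.
- exact: cn.
- by rewrite !inE eqxx.
- by exists u.
Qed.

Lemma hang_cases D y1 y2 p y3 c A : hangs D y1 y2 p y3 c A ->
  has (adj c) p ->
  c = y3 \/ [/\ c \in D, leg D y3 (A :\ c) & exists2 u, u \in A :\ c & adj c u] ->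
  claw D [set y1; y2; y3] \/ tri D [set y1; y2; y3].
Proof.
move=> hg hp H; have [_ lk _ _ _] := hg.
have ipp : ipath p.
  by have := lk.1; rewrite -cats1 -cat1s => /ipath_cat[_ /ipath_cat[]].
case: (nbr_cases ipp hp) => [[u [a [v [pE ca nu nv]]]]|[u [a [b [v [pE /andP[ca cb] nu nv]]]]]|].
- by left; apply: hang_single hg pE ca nu nv.
- by right; apply: hang_pair hg pE ca cb nu nv.
- by case=> x [x' [xp x'p xx' axx' /andP[cx cx']]]; left; apply: (hang_mid hg xp x'p).
Qed.

(** In a minimal connected set attached to all of [S], each non-cut vertex has a private terminal.
    Two such vertices give an induced path between two terminals, and the third terminal attaches to
    it directly or by a path whose first vertex alone sees it. *)
Lemma claw_or_tri D S : conn D -> stable S -> [disjoint S & D] -> #|S| = 3 ->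
  (forall y, y \in S -> exists2 x, x \in D & adj y x) -> claw D S \/ tri D S.
Proof.
move=> cD stS dSD S3 att.
have [X [sX [cX attX] minX]] := minimal_subset (P := fun X => conn X /\
   forall y, y \in S -> exists2 x, x \in X & adj y x) (conj cD att).
have nD y : y \in S -> y \notin D by move=> yS; rewrite (disjointFr dSD).
have nX y : y \in S -> y \notin X by move=> yS; apply: contra (nD y yS); apply: (subsetP sX).
have [y0 y0S] : exists y, y \in S by apply/set0Pn; rewrite -card_gt0 S3.
have [r rX _] := attX y0 y0S.
have priv v : v \in X -> conn (X :\ v) -> exists2 y, y \in S &
    forall x, x \in X -> adj y x -> x = v.
  move=> vX cXv; apply: NNPP => no.
  apply: (minX (X :\ v)); first exact: properD1.
  split=> // y yS; apply: NNPP => no'; apply: no; exists y => // x xX yx.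
  by apply: NNPP => xv; apply: no'; exists x => //; rewrite !inE xX andbT; apply/eqP.
have dist y1 y2 : y1 \in S -> y2 \in S -> y1 != y2 ->
    exists y3, [/\ y3 \in S, y1 != y3, y2 != y3 & S = [set y1; y2; y3]].
  move=> y1S y2S y12.
  have /eqP/cards1P[y3 E] : #|S :\ y1 :\ y2| = 1.
    by move: S3; rewrite (cardsD1 y1) y1S (cardsD1 y2) !inE eq_sym y12 y2S => -[].
  have : y3 \in S :\ y1 :\ y2 by rewrite E inE.
  rewrite !inE => /and3P[n2 n1 y3S]; exists y3; split; rewrite // 1?eq_sym //.
  have y2y1 : y2 \in S :\ y1 by rewrite !inE eq_sym y12.
  by rewrite -(setD1K y1S) -(setD1K y2y1) E setUA.
have leg1 y : leg D y [set y].
  by split; [rewrite inE | apply: subsetUl | apply: conn1].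
have [XE|Xr] := eqVneq X [set r].
  left; have [y1 [y2 []]] := other_two S3 y0S.
  rewrite !inE => /andP[n1 y1S] /andP[n2 y2S] n12.
  have [|y3 [y3S n13 n23 SE]] := dist y1 y2 y1S y2S; first by [].
  have adjr y : y \in S -> exists2 u, u \in [set y] & adj r u.
    move=> yS; exists y; rewrite ?inE // adjC.
    by have [x] := attX y yS; rewrite XE inE => /eqP->.
  have nr y : y \in S -> r \notin [set y].
    by move=> yS; rewrite inE; apply: contraTneq rX => ->; apply: nX.
  have fr y y' : y \in S -> y' \in S -> y != y' -> far [set y] [set y'].
    by move=> yS y'S yy' u v; rewrite !inE => /eqP-> /eqP->; split=> //; apply: stS.
  rewrite SE; apply: (@claw_intro D y1 y2 y3 r [set y1] [set y2] [set y3]) => //;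
    try (by apply: fr); try (by apply: nr); try (by apply: adjr).
  exact: (subsetP sX).
(* Non-cut vertices are found twice, the second time with the first one as the vertex to avoid, so
   they differ. *)
have [u uX cXu] := noncut_ex cX rX Xr; move: uX; rewrite !inE => /andP[_ uX].
have Xu : X != [set u].
  by apply: contraNneq Xr => XE; move: rX; rewrite XE inE => /eqP->.
have [w wX cXw] := noncut_ex cX uX Xu; move: wX; rewrite !inE => /andP[wu wX].
have [y1 y1S p1] := priv u uX cXu; have [y2 y2S p2] := priv w wX cXw.
have n12 : y1 != y2.
  apply/eqP=> E; have [x xX yx] := attX y1 y1S.
  by move: wu; rewrite -(p1 x xX yx) -(p2 x xX) ?eqxx // -E.
have [y3 [y3S n13 n23 SE]] := dist y1 y2 y1S y2S n12.
have ny : [/\ y1 != y2, y1 != y3 & y2 != y3] by [].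
have [s [ips sub las]] := conn_ipath cX uX wX.
set p := u :: s in ips sub.
have y1u : adj y1 u by have [x xX yx] := attX y1 y1S; rewrite -(p1 x xX yx).
have y2w : adj y2 w by have [x xX yx] := attX y2 y2S; rewrite -(p2 x xX yx).
have nbr1 v : v \in X -> adj y1 v = (v == u).
  by move=> vX; apply/idP/eqP => [/(p1 v vX)|->].
have nbr2 v : v \in X -> adj y2 v = (v == w).
  by move=> vX; apply/idP/eqP => [/(p2 v vX)|->].
have yX y v : y \in S -> v \in X -> y != v.
  by move=> yS vX; apply: contraTneq vX => <-; apply: nX.
have lk : link D y1 y2 p.
  split; last by move=> v /sub; apply: (subsetP sX).
  apply/ipath_cons; split.
    rewrite -cats1; apply/ipath_cat; split=> // v v' vp; rewrite inE => /eqP->.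
    rewrite eq_sym (yX _ _ y2S (sub v vp)) adjC (nbr2 v (sub v vp)); split=> //.
    by rewrite /= eqxx andbT las.
  move=> v v'; rewrite inE => /eqP->; rewrite mem_rcons inE => /orP[/eqP->|vp].
    split=> //; rewrite /= eqxx /=; have := stS y1 y2 y1S y2S => /negbTE->.
    by apply/esym/negbTE; apply: yX.
  by rewrite (yX _ _ y1S (sub v' vp)) (nbr1 v' (sub v' vp)) /= eqxx.
rewrite SE.
have [hp|np] := boolP (has (adj y3) p).
  apply: (@hang_cases D y1 y2 p y3 y3 [set y3]) => //; last by left.
  split; rewrite ?inE // => a v; rewrite inE => /eqP->.
  rewrite inE mem_rcons inE => /or3P[/eqP->|/eqP->|vp].
  - by rewrite eq_sym; split=> //; move/negP: (stS y3 y1 y3S y1S).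
  - by rewrite eq_sym; split=> //; move/negP: (stS y3 y2 y3S y2S).
  - by rewrite (yX _ _ y3S (sub v vp)).
have cX3 : conn (y3 |: X) by have [x xX yx] := attX y3 y3S; apply: (conn_add cX xX yx).
have y3p : y3 \notin p by apply: contra (nX _ y3S) => /sub.
(* The part reachable from [y3] off the path; since [X] with [y3] is connected, it has a neighbour
   on the path. *)
have [|E [sE y3E cE clE]] := @comp_ex G ((y3 |: X) :\: [set v in p]) y3.
  by rewrite !inE eqxx y3p.
have EE v : v \in E -> v \notin p /\ (v = y3 \/ v \in X).
  by move/(subsetP sE); rewrite !inE => /andP[vp /orP[/eqP->|vX]]; split=> //; [left|right].
have [e0 [f0 [eE fX fE ef]]] : exists e f, [/\ e \in E, f \in y3 |: X, f \notin E & adj e f].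
  apply: (conn_edge cX3 (w := u)).
  - by apply: subset_trans sE (subsetDl _ _).
  - by apply/set0Pn; exists y3.
  - by rewrite !inE uX orbT.
  - by apply/negP=> /EE[]; rewrite mem_head.
have f0p : f0 \in p.
  apply: contraR fE => fp; apply: (clE e0 f0 eE) => //.
  by rewrite inE fX inE fp.
have e0N : e0 \in [set x | has (adj x) p] by rewrite inE; apply/hasP; exists f0.
(* [a] is the only vertex of this path to [y3] that sees [p], so it plays the role of [c] in
   [hangs]. *)
have [a [s' [ips' sub' aN sN las']]] := conn_ipath_to cE y3E eE e0N.
have ha : has (adj a) p by move: aN; rewrite inE.
have ay3 : a != y3 by apply: contraNneq np => <-.
have aX : a \in X.
  by have [_ []] := EE a (sub' a (mem_head _ _)) => // ay; rewrite ay eqxx in ay3.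
have [b [s'' s'E]] : exists b s'', s' = b :: s''.
  case: (s') las' => [ay|b s'' _]; last by exists b, s''.
  by rewrite -ay eqxx in ay3.
have y3s' : y3 \in s'.
  by have := mem_last a s'; rewrite las' inE eq_sym (negPf ay3).
have /ipath_cons[ipt jt] := ips'.
have as' : a \notin s'.
  by apply/negP=> h; have [] := jt a a (mem_head _ _) h; rewrite eqxx.
have AE : [set v in a :: s'] :\ a = [set v in s'].
  apply/setP=> v; rewrite !inE; case: eqP => [->|//].
  by rewrite (negPf as').
have subD (t : seq G) : {subset t <= a :: s'} -> [set v in t] \subset y3 |: D.
  move=> st; apply/subsetP=> v; rewrite !inE => /st/sub'/EE[_ [->|vX]].
    by rewrite eqxx.
  by rewrite (subsetP sX) ?orbT.
apply: (@hang_cases D y1 y2 p y3 a [set v in a :: s']) => //.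
  split=> //.
  - split; [by rewrite !inE y3s' orbT | exact: subD | exact: ipath_conn].
  - by rewrite inE mem_head.
  move=> x v; rewrite inE => xA.
  have [xp xX] := EE x (sub' x xA).
  have xS y y' : y \in S -> y3 != y -> (forall z, z \in X -> adj y z = (z == y')) ->
      y' \in p -> x != y /\ ~~ adj x y.
    move=> yS yy3 nb y'p; case: xX => [->|xX]; first by split=> //; apply: stS.
    rewrite eq_sym (yX _ _ yS xX) adjC nb //; split=> //.
    by apply: contraNneq xp => ->.
  rewrite inE mem_rcons inE => /or3P[/eqP->|/eqP->|vp].
  - have [|ne na] := xS y1 u y1S _ nbr1 (mem_head _ _); first by rewrite eq_sym.
    by split=> // h; rewrite h in na.
  - have [||ne na] := xS y2 w y2S _ nbr2; [by rewrite eq_sym | by rewrite -las mem_last|].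
    by split=> // h; rewrite h in na.
  split; first by apply: contraNneq xp => ->.
  move=> xv; split=> //; move: xA; rewrite inE => /orP[/eqP//|/sN].
  by rewrite inE => /hasP[]; exists v.
right; split; first exact: (subsetP sX).
  rewrite AE; split; [by rewrite inE | | exact: ipath_conn].
  by apply: subD => v vs; rewrite inE vs orbT.
have bs' : b \in s' by rewrite s'E mem_head.
exists b; first by rewrite AE inE.
by have [_ ->] := jt a b (mem_head _ _) bs'; rewrite s'E /= !eqxx.
Qed.

End Attachments.

Lemma pigeonhole_cover (T I : finType) (Z : {set T}) (N : {set I})
    (F : I -> {set T}) v0 : v0 \in N ->
  (forall z, z \in Z -> exists2 v, v \in N & z \in F v) ->
  exists2 v, v \in N & #|Z| <= #|N| * #|F v|.
Proof.
move=> v0N cov; case: (arg_maxnP (fun v => #|F v|) v0N) => v vN maxv.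
exists v => //; rewrite -sum_nat_const.
apply: (@leq_trans (\sum_(i in N) #|F i|)); last exact: leq_sum.
apply: (@leq_trans #|\bigcup_(i in N) F i|).
  apply/subset_leq_card/subsetP=> z /cov[i iN zi].
  by apply/bigcupP; exists i.
elim/big_rec2: _ => [|i x y _ le_yx]; first by rewrite cards0.
by apply: leq_trans (leq_card_setU _ _) _; rewrite leq_add2l.
Qed.

(** * Minimal rooted connectors *)

Section Rooted.

Variable G : sgraph.
Implicit Types (x y z c r : G) (s p q : seq G).
Implicit Types (A B C D E K L M N S T W X Y Z : {set G}).

Definition attached Z X := forall z, z \in Z -> exists2 x, x \in X & adj z x.

Definition att Z X := [set z in Z | [exists x in X, adj z x]].

Lemma attP Z X z : reflect (z \in Z /\ exists2 x, x \in X & adj z x) (z \in att Z X).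
Proof.
rewrite inE; apply: (iffP andP) => [[-> /exists_inP]|[-> h]] //.
by split=> //; apply/exists_inP.
Qed.

Lemma att_attached Z X : attached (att Z X) X.
Proof. by move=> z /attP[]. Qed.

Definition coll Z q := att Z [set x in q].

Lemma att_sub Z X : att Z X \subset Z.
Proof. by apply/subsetP=> z /attP[]. Qed.

Definition rooted_min X r Z :=
  forall X', X' \proper X -> r \in X' -> conn X' -> ~ attached Z X'.

(** [K] is the part of [X] behind [x], seen from the root: whatever leads from [K] or from the
    terminal [y] to the rest of [X] passes through [x]. With [K] empty, [x] is the only possible
    neighbour of [y] in [X]. *)
Definition private_leg X r Z x y K :=
  [/\ y \in Z, [/\ K \subset X :\ x, r \notin K & conn (x |: K)],
      forall u v, u \in K -> v \in X -> adj u v -> v \in x |: K,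
      forall v, v \in X -> adj y v -> v \in x |: K
    & conn (y |: K) /\ exists2 u, u \in y |: K & adj x u].

(** If [X] without [x] is connected, minimality yields a terminal seeing only [x]. Otherwise [K] is
    a component of [X] without [x] that misses the root; deleting it leaves a connected set, and
    minimality yields a terminal whose neighbours in [X] all lie in [K]. *)
Lemma private_leg_ex X r Z x : conn X -> r \in X -> attached Z X ->
  rooted_min X r Z -> x \in X -> x != r -> exists y K, private_leg X r Z x y K.
Proof.
move=> cX rX attX minX xX xr.
have wit X' : X' \proper X -> r \in X' -> conn X' ->
    exists2 y, y \in Z & forall v, v \in X' -> ~~ adj y v.
  move=> pX' rX' cX'; apply: NNPP => no; apply: (minX X' pX' rX' cX').
  move=> z zZ; apply: NNPP => no'; apply: no; exists z => // v vX'.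
  by apply/negP=> zv; apply: no'; exists v.
have rXx : r \in X :\ x by rewrite !inE eq_sym xr.
have [C [sC rC cC clC]] := comp_ex rXx.
have [CE|CE] := eqVneq C (X :\ x).
  have [y yZ ny] := wit (X :\ x) (properD1 xX) rXx (eq_ind _ (@conn G) cC _ CE).
  have [v vX yv] := attX y yZ.
  have vx : v = x.
    by apply/eqP; apply: contraTT yv => vx; apply: ny; rewrite !inE vx.
  exists y, set0; split=> //.
  - by rewrite sub0set inE setU0; split=> //; apply: conn1.
  - by move=> u w; rewrite inE.
  - move=> w wX yw; rewrite setU0 inE; apply: contraTT yw => wx.
    by apply: ny; rewrite !inE wx.
  rewrite setU0; split; first exact: conn1.
  by exists y; rewrite ?inE // -vx adjC.
have [w wX wC] : exists2 w, w \in X :\ x & w \notin C.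
  by apply/subsetPn; apply: contra CE => h; rewrite eqEsubset sC.
have [K [sK wK cK clK]] := comp_ex wX.
have rK : r \notin K.
  apply: contra wC => rK.
  exact: (subsetP (conn_sub_closed cK sK clC rK rC) w wK).
have clKx u v : u \in K -> v \in X -> adj u v -> v \in x |: K.
  move=> uK vX uv; rewrite !inE; case: eqP => //= /eqP vx.
  by apply: (clK u v) => //; rewrite !inE vx.
have sKX : K \subset X by apply: subset_trans sK (subsetDl _ _).
have xK : x \notin K by apply/negP=> /(subsetP sK); rewrite !inE eqxx.
have rXK : r \in X :\: K by rewrite inE rK.
have [u [uK xu]] : exists u, u \in K /\ adj x u.
  have [|u [v [uK vX vK uv]]] := conn_edge cX sKX _ rX rK.
    by apply/set0Pn; exists w.
  have := clKx u v uK vX uv; rewrite !inE (negPf vK) orbF => /eqP vx.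
  by exists u; rewrite adjC -vx.
(* A closed part of the remainder either contains [x], and then extends by [K] to all of [X], or
   misses [x] and is already closed in [X]. *)
have cXK : conn (X :\: K).
  move=> B sB B0 clB; have [xB|xB] := boolP (x \in B).
    have : B :|: K = X.
      apply: cX; first by rewrite subUset (subset_trans sB (subsetDl _ _)).
        by apply/set0Pn; exists x; rewrite inE xB.
      move=> a b; rewrite !inE => aBK bX ab; have [//|bK] := boolP (b \in K); first by rewrite orbT.
      case/orP: aBK => [aB|aK]; first by rewrite (clB a b) ?inE ?bK.
      by have := clKx a b aK bX ab; rewrite !inE (negPf bK) orbF => /eqP->; rewrite xB.
    move=> BK; apply/eqP; rewrite eqEsubset sB; apply/subsetP=> a.
    by move=> /setDP[aX aK]; move: aX; rewrite -BK inE (negPf aK) orbF.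
  have BX : B = X.
    apply: cX => //; first exact: subset_trans sB (subsetDl _ _).
    move=> a b aB bX ab; apply: (clB a b aB _ ab); rewrite inE bX andbT.
    apply/negP=> bK; move: (subsetP sB a aB); rewrite inE => /andP[aK aX].
    have := clKx b a bK aX; rewrite adjC ab => /(_ isT).
    by rewrite !inE (negPf aK) orbF => /eqP ax; rewrite -ax aB in xB.
  by rewrite BX xX in xB.
have [|y yZ ny] := wit (X :\: K) _ rXK cXK.
  by rewrite properE subsetDl; apply/subsetPn; exists w; rewrite ?inE ?wK // (subsetP sKX).
have nyK v : v \in X -> adj y v -> v \in K.
  by move=> vX; apply: contraTT => vK; apply: ny; rewrite inE vK.
exists y, K; split=> //.
- by split=> //; apply: (conn_add cK uK).
- by move=> v vX yv; rewrite inE nyK ?orbT.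
have [v vX yv] := attX y yZ; split; first exact: (conn_add cK (nyK v vX yv)).
by exists u; rewrite // inE uK orbT.
Qed.

Section Legs.

Variables (D Y X Z : {set G}) (r : G).
Hypothesis stY : stable Y.
Hypothesis disjYD : [disjoint Y & D].
Hypothesis sZY : Z \subset Y.
Hypothesis sXD : X \subset D.
Hypothesis rX : r \in X.
Hypothesis attX : attached Z X.

Lemma notinX z : z \in Z -> z \notin X.
Proof.
move=> zZ; apply: contraTN isT => /(subsetP sXD) zD.
by have := disjointFr disjYD (subsetP sZY z zZ); rewrite zD.
Qed.

(** A connected set containing the root but not [x] cannot enter [K], so it can be adjacent to the
    leg only at [x]. *)
Lemma leg_avoid x y K W : private_leg X r Z x y K -> conn W -> W \subset X ->
  r \in W -> x \notin W ->
  forall u v, u \in x |: (y |: K) -> v \in W -> u != v /\ (adj u v -> u = x).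
Proof.
case=> yZ [sK rK _] clK nyK _ cW sW rW xW.
have KW v : v \in W -> v \notin K.
  move=> vW; apply: contra rK => vK.
  have sWx : W \subset X :\ x by rewrite subsetD1 sW.
  have clK' : closed_in (X :\ x) K.
    move=> a b aK; rewrite !inE => /andP[bx bX] /(clK a b aK bX).
    by rewrite !inE (negPf bx).
  exact: (subsetP (conn_sub_closed cW sWx clK' vW vK) r rW).
have xKW v : v \in W -> v \notin x |: K.
  by move=> vW; rewrite !inE negb_or KW // andbT; apply: contraNneq xW => <-.
move=> u v; rewrite !inE => /or3P[/eqP->|/eqP->|uK] vW.
- by split=> //; apply: contraNneq xW => ->.
- have vX := subsetP sW v vW.
  split; first by apply: contraTneq vX => <-; apply: notinX.
  by move=> /(nyK v vX); rewrite (negPf (xKW v vW)).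
split; first by apply: contraTneq uK => ->; apply: KW.
by move=> /(clK u v uK (subsetP sW v vW)); rewrite (negPf (xKW v vW)).
Qed.

Lemma leg_root x y K : private_leg X r Z x y K -> x != r ->
  forall u, u \in x |: (y |: K) -> u != r /\ (adj u r -> u = x).
Proof.
move=> pl xr u uL; apply: (leg_avoid pl (@conn1 G r) _ _ _ uL).
- by rewrite sub1set.
- by rewrite inE.
- by rewrite inE.
- by rewrite inE.
Qed.

Lemma private_leg_sub x y K : private_leg X r Z x y K -> x \in X ->
  x |: (y |: K) \subset y |: X.
Proof.
case=> yZ [sK _ _] _ _ _ xX; apply/subsetP=> v; rewrite !inE.
move=> /or3P[/eqP->|->//|/(subsetP sK)]; first by rewrite xX orbT.
by rewrite !inE => /andP[_ ->]; rewrite orbT.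
Qed.

Lemma private_leg_leg x y K : private_leg X r Z x y K -> x \in X ->
  leg X y (x |: (y |: K)).
Proof.
move=> pl xX; split; [by rewrite !inE eqxx orbT | exact: private_leg_sub pl xX |].
by case: pl => _ _ _ _ [cyK [u uyK xu]]; apply: (conn_add cyK uyK xu).
Qed.

(** The root with one leg, without its terminal, is a connected set that the other leg avoids. So
    edges between the legs can only join [x] to [x'], and a common terminal would have a neighbour
    in both. *)
Lemma two_legs x y K x' y' K' : private_leg X r Z x y K ->
  private_leg X r Z x' y' K' -> x \in X -> x' \in X ->
  adj r x -> adj r x' -> x != x' -> y != y' /\
  forall u v, u \in x |: (y |: K) -> v \in x' |: (y' |: K') ->
    u != v /\ (adj u v -> u = x /\ v = x').
Proof.
move=> pl pl' xX x'X rx rx' xx'.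
have sW a b C : private_leg X r Z a b C -> a \in X -> adj r a ->
    [/\ conn (r |: (a |: C)), r |: (a |: C) \subset X & r \in r |: (a |: C)].
  case=> _ [sC rC cC] _ _ _ aX ra; split.
  - by apply: (conn_add (u := a) cC) => //; rewrite !inE eqxx.
  - by rewrite !subUset !sub1set rX aX (subset_trans sC (subsetDl _ _)).
  - by rewrite !inE eqxx.
(* A neighbour of the root cannot lie behind another one, since the part behind has no edge to the
   root. *)
have nin a b C a' b' C' : private_leg X r Z a b C -> private_leg X r Z a' b' C' ->
    a \in X -> a' \in X -> adj r a -> adj r a' -> a != a' ->
    a \notin r |: (a' |: C').
  case=> _ [sC rC _] _ _ _ [_ [sC' rC' _] clC' _ _] aX a'X ra ra' aa'.
  rewrite !inE (negPf aa') orFb negb_or eq_sym (adj_neq ra) /=.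
  apply/negP=> aC'; have := clC' a r aC' rX; rewrite adjC ra => /(_ isT).
  by rewrite !inE (negPf rC') orbF (negPf (adj_neq ra')).
have [c1 s1 r1] := sW _ _ _ pl xX rx; have [c2 s2 r2] := sW _ _ _ pl' x'X rx'.
have n1 := nin _ _ _ _ _ _ pl pl' xX x'X rx rx' xx'.
have n2 : x' \notin r |: (x |: K).
  by apply: (nin _ _ _ _ _ _ pl' pl) => //; rewrite eq_sym.
have a1 := leg_avoid pl c2 s2 r2 n1; have a2 := leg_avoid pl' c1 s1 r1 n2.
case: (pl) => yZ [sK _ _] _ nyK _; case: (pl') => y'Z [sK' _ _] _ nyK' _.
have yy' : y != y'.
  apply/eqP=> yy'; have [v vX yv] := attX yZ.
  have v1 := nyK v vX yv; rewrite yy' in yv; have v2 := nyK' v vX yv.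
  have [||] := a1 v v; rewrite ?eqxx //.
    by move: v1; rewrite !inE => /orP[->|->]; rewrite ?orbT.
  by rewrite inE v2 orbT.
split=> // u v uL vL.
have [vy'|vy'] := eqVneq v y'; last first.
  have vW : v \in r |: (x' |: K').
    by move: vL; rewrite !inE (negPf vy') orFb => ->; rewrite orbT.
  have [ne h] := a1 u v uL vW; split=> // uv; have ux := h uv; split=> //.
  have [uy|uy] := eqVneq u y.
    by have := notinX yZ; rewrite -uy ux xX.
  have uW : u \in r |: (x |: K) by rewrite ux !inE eqxx orbT.
  by have [_ h'] := a2 v u vL uW; apply: h'; rewrite adjC.
have [uy|uy] := eqVneq u y.
  rewrite uy vy'; split=> //; have := stY (subsetP sZY y yZ) (subsetP sZY y' y'Z).
  by move/negbTE->.
have uW : u \in r |: (x |: K).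
  by move: uL; rewrite !inE (negPf uy) orFb => ->; rewrite orbT.
have [ne h] := a2 v u vL uW; rewrite eq_sym; split=> //.
rewrite adjC => /h vx'; have := notinX y'Z; by rewrite -vy' vx' x'X.
Qed.

(** The leg is thinned to an induced path. If this path sees [c] terminals it is itself crowded;
    otherwise dropping the fewer than [c] terminals it sees leaves only terminals far from it. Its
    own terminal [y] is among those dropped. *)
Lemma thin_leg x y K (Zh : {set G}) (c : nat) : private_leg X r Z x y K -> x \in X -> Zh \subset Z ->
  (exists q, [/\ ipath q, {subset q <= D} & c <= #|coll Y q|]) \/
  exists L (Z' : {set G}), [/\ [/\ leg X y L, x \in L, L \subset x |: (y |: K), leg X y (L :\ x)
                     & exists2 u, u \in L :\ x & adj x u],
                   [/\ Z' \subset Zh, y \notin Z' & far L Z'] & #|Zh| <= #|Z'| + c].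
Proof.
move=> pl xX sZh; have [yZ _ _ _ _] := pl.
have [yL sL cL] := private_leg_leg pl xX.
have xL : x \in x |: (y |: K) by rewrite !inE eqxx.
have [l [ipl subl lasl]] := conn_ipath cL xL yL.
have xy : x != y by apply: contraTneq xX => ->; apply: notinX.
case/lastP: l ipl subl lasl => [|l y1] ipl subl lasl.
  by rewrite /= in lasl; rewrite lasl eqxx in xy.
rewrite last_rcons in lasl; subst y1.
have [ipx _ jx] : [/\ ipath (x :: l), ipath [:: y] & joins (x :: l) [:: y]].
  by apply/ipath_cat; rewrite -[_ ++ _]/(x :: (l ++ [:: y])) cats1.
have /ipath_cons[ipl' jx'] := ipl.
have xl : x \notin rcons l y.
  by apply/negP=> h; have [] := jx' x x (mem_head _ _) h; rewrite eqxx.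
have subX v : v \in x :: l -> v \in X.
  move=> vl; have : v \in x :: rcons l y.
    by move: vl; rewrite !inE mem_rcons inE => /orP[->//|->]; rewrite !orbT.
  move=> /subl/(subsetP sL); rewrite !inE => /orP[/eqP vy|//].
  by have [] := jx v y vl (mem_head _ _); rewrite vy eqxx.
have [h|h] := leqP c #|coll Y (x :: l)|.
  by left; exists (x :: l); split=> // v /subX; apply: (subsetP sXD).
right; exists [set v in x :: rcons l y], (Zh :\: coll Y (x :: l)).
have edge_first : [set v in x :: rcons l y] :\ x = [set v in rcons l y].
  apply/setP=> v; rewrite !inE; case: eqP => [->|//].
  by rewrite (negPf xl).
have sub1 t : {subset t <= x :: rcons l y} -> [set v in t] \subset y |: X.
  by move=> st; apply/subsetP=> v; rewrite inE => /st/subl/(subsetP sL).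
have yadj : y \in coll Y (x :: l).
  apply/attP; split; first exact: (subsetP sZY).
  exists (last x l); first by rewrite inE mem_last.
  by rewrite adjC; have [_ ->] := jx (last x l) y (mem_last _ _) (mem_head _ _); rewrite /= !eqxx.
split.
- split.
  + split; [by rewrite !inE mem_rcons mem_head orbT | exact: sub1 | exact: ipath_conn].
  + by rewrite inE mem_head.
  + by apply/subsetP=> v; rewrite inE => /subl.
  + rewrite edge_first; split; [by rewrite inE mem_rcons mem_head | | exact: ipath_conn].
    by apply: sub1 => v vl; rewrite inE vl orbT.
  have hd : head y (rcons l y) \in rcons l y by case: (l) => [|? ?]; rewrite /= mem_head.
  exists (head y (rcons l y)); first by rewrite edge_first inE.
  have [_ ->] := jx' x _ (mem_head _ _) hd; rewrite /= eqxx /=.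
  by apply/eqP; apply: head_indep hd.
- split; first exact: subsetDl.
    by rewrite inE yadj.
  move=> u v; rewrite in_set => uL /setDP[vZh vn].
  have vZ := subsetP sZh v vZh.
  have vX := notinX vZ.
  have [uy|uy] := eqVneq u y.
    rewrite uy; split; last by apply: stY; apply: (subsetP sZY).
    by apply: contraNneq vn => <-; exact: yadj.
  have ul : u \in x :: l.
    by move: uL; rewrite inE mem_rcons inE (negPf uy).
  split; first by apply: contraNneq vX => <-; apply: subX.
  rewrite adjC; apply: contra vn => vu; apply/attP; split; first exact: (subsetP sZY).
  by exists u; rewrite ?inE.
rewrite -(cardsID (coll Y (x :: l)) Zh) addnC leq_add2l.
by apply: leq_trans (ltnW h); apply/subset_leq_card/subsetIr.
Qed.

End Legs.

(** Each neighbour of the root owns the component it reaches when the root and its other neighbours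
    are removed. These pieces cover [X] apart from the root, so one of them is attached to at least
    an average share of [Z]. *)
Lemma heavy_nbr X Z r : conn X -> r \in X -> attached Z X ->
  (forall z, z \in Z -> ~~ adj r z) -> (exists2 v, v \in X & adj r v) ->
  exists v C, [/\ v \in X /\ adj r v, C \subset X :\ r, v \in C /\ conn C,
     forall x, x \in C -> adj r x -> x = v
   & #|Z| <= #|[set x in X | adj r x]| * #|att Z C|].
Proof.
move=> cX rX attX nZ [v0 v0X rv0].
set N := [set x in X | adj r x].
have ex v : exists C, v \in N ->
    [/\ C \subset X :\: (r |: (N :\ v)), v \in C, conn C & closed_in (X :\: (r |: (N :\ v))) C].
  have [vN|vN] := boolP (v \in N); last by exists set0.
  have [|C HC] := @comp_ex G (X :\: (r |: (N :\ v))) v; last by exists C.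
  by move: vN; rewrite !inE eqxx /= => /andP[-> /adj_neq]; rewrite eq_sym orbF => ->.
have [C HC] := fin_all_exists ex.
have NX v : v \in N -> v \in X /\ adj r v by rewrite inE => /andP[].
have cov : r |: \bigcup_(v in N) C v = X.
  apply: cX.
  - rewrite subUset sub1set rX; apply/bigcupsP=> v vN.
    by have [sC _ _ _] := HC v vN; apply: subset_trans sC (subsetDl _ _).
  - by apply/set0Pn; exists r; rewrite !inE eqxx.
  move=> a b aU bX ab; rewrite !inE; case: eqP => //= /eqP br.
  have [bN|bN] := boolP (b \in N).
    by apply/bigcupP; exists b => //; have [] := HC b bN.
  move: aU; rewrite !inE => /orP[/eqP ar|/bigcupP[v vN aC]].
    by move: bN; rewrite inE bX -ar ab.
  apply/bigcupP; exists v => //; have [_ _ _ clC] := HC v vN.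
  by apply: (clC a b aC _ ab); rewrite in_setD in_setU1 in_setD1 (negPf br) (negPf bN) andbF bX.
have v0N : v0 \in N by rewrite inE v0X.
have [z zZ|v vN cnt] := @pigeonhole_cover G G Z N (fun v => att Z (C v)) v0 v0N.
  have [x xX zx] := attX z zZ; move: (xX); rewrite -cov !inE => /orP[/eqP xr|/bigcupP[v vN xC]].
    by have := nZ z zZ; rewrite adjC -xr zx.
  by exists v => //; apply/attP; split=> //; exists x.
have [sC vC cC _] := HC v vN; exists v, (C v); split=> //; first exact: NX.
  apply: subset_trans sC _; apply/subsetP=> x; rewrite !inE negb_or -andbA.
  by case/and3P=> -> _ ->.
move=> x xC rx; have := subsetP sC x xC; rewrite !inE rx andbT.
by case/andP=> /norP[_ h] xX; move: h; rewrite xX andbT negbK => /eqP.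
Qed.

(** [E] is the component of [v] after deleting from [C] the neighbours of [w] other than [v]. Every
    vertex of [C] bordering [E] from outside is then a neighbour of [w], which keeps the remainder
    connected once [w] is added. *)
Lemma split_at C v w : conn C -> v \in C -> w \notin C ->
  exists E, let F := w |: (C :\: E) in
  [/\ [/\ E \subset C, v \in E & conn E], forall x, x \in E -> adj w x -> x = v,
      conn F & forall x e, x \in C :\: E -> e \in E -> adj x e -> adj w x].
Proof.
move=> cC vC wC; set M := [set x in C | adj w x && (x != v)].
have [|E [sE vE cE clE]] := @comp_ex G (C :\: M) v; first by rewrite !inE eqxx vC !andbF.
have sEC : E \subset C by apply: subset_trans sE (subsetDl _ _).
have bd x e : x \in C :\: E -> e \in E -> adj x e -> adj w x.
  rewrite inE => /andP[xE xC] eE xe; apply: contraNT xE => wx.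
  by apply: (clE e x eE); rewrite ?inE ?xC ?(negPf wx) // adjC.
exists E; split=> //.
  move=> x xE wx; apply/eqP; have := subsetP sE x xE; rewrite !inE wx.
  by case/andP=> + xC; rewrite xC /= negbK.
move=> B sB B0 clB; have [wB|wB] := boolP (w \in B); last first.
  have sBC : B \subset C :\: E.
    apply/subsetP=> x xB; have := subsetP sB x xB; rewrite !inE => /orP[/eqP xw|//].
    by rewrite -xw xB in wB.
  have BC : B = C.
    apply: cC => //; first exact: subset_trans sBC (subsetDl _ _).
    move=> a b aB bC ab; have aCE := subsetP sBC a aB.
    have [bE|bE] := boolP (b \in E); last by apply: (clB a b aB _ ab); rewrite !inE bE bC orbT.
    have := clB a w aB; rewrite !inE eqxx (negPf wB) => /(_ isT).
    by rewrite adjC (bd a b aCE bE ab) => /(_ isT).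
  by have := subsetP sBC v; rewrite BC vC inE vE => /(_ isT).
apply/eqP; rewrite eqEsubset sB; apply/subsetP=> x xF; apply: contraT => xB.
have wE : w \notin E by apply: contra wC => /(subsetP sEC).
have vU : v \in B :|: E by rewrite inE vE orbT.
have : (B :\ w) :|: E = C.
  apply: cC.
  - rewrite subUset sEC andbT; apply/subsetP=> a; rewrite !inE => /andP[aw aB].
    by have := subsetP sB a aB; rewrite !inE (negPf aw) => /andP[].
  - by apply/set0Pn; exists v; rewrite inE vE orbT.
  move=> a b; rewrite !inE => aBE bC ab; have [//|bE] := boolP (b \in E); first by rewrite orbT.
  have bw : b != w by apply: contraNneq wC => <-.
  have bF : b \in w |: (C :\: E) by rewrite !inE bE bC orbT.
  rewrite bw orbF /=; case/orP: aBE => [/andP[_ aB]|aE]; first exact: (clB a b).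
  apply: (clB w b wB bF); apply: (bd b a) => //; first by rewrite inE bE.
  by rewrite adjC.
move=> CE; move: xF; rewrite !inE -CE !inE => /orP[/eqP xw|].
  by rewrite xw wB in xB.
by case/andP=> /negPf->; rewrite orbF (negPf xB) andbF.
Qed.

Lemma conn_remove_leaf X r v : conn X -> r \in X -> v \in X -> r != v ->
  (forall x, x \in X -> adj r x -> x = v) -> conn (X :\ r).
Proof.
move=> cX rX vX rv uniq B sB B0 clB; have [vB|vB] := boolP (v \in B).
  have : r |: B = X.
    apply: cX; first by rewrite subUset sub1set rX (subset_trans sB (subsetDl _ _)).
      by apply/set0Pn; exists r; rewrite !inE eqxx.
    move=> a b; rewrite !inE => /orP[/eqP->|aB] bX ab; first by rewrite (uniq b bX ab) vB orbT.
    by case: eqP => //= /eqP br; apply: (clB a b aB); rewrite // !inE br.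
  move=> E; apply/eqP; rewrite eqEsubset sB; apply/subsetP=> a.
  by rewrite !inE -E !inE => /andP[/negPf->].
have BX : B = X.
  apply: cX => //; first exact: subset_trans sB (subsetDl _ _).
  move=> a b aB bX ab; apply: (clB a b aB _ ab); rewrite !inE bX andbT.
  apply: contraNneq vB => br; rewrite -(uniq a) //; first by apply: (subsetP (subset_trans sB (subsetDl _ _))).
  by rewrite -br adjC.
by have := subsetP sB r; rewrite BX rX !inE eqxx => /(_ isT).
Qed.

End Rooted.

(** * Combs *)

Section Combs.

Variable G : sgraph.
Implicit Types (x y z r : G) (s p q : seq G).
Implicit Types (A B C D E K L M N S T W X Y Z : {set G}).

(** The path lives in [D] and the legs in [E]: prepending a root to the path enlarges only the first
    set, and the two are equalized afterwards. *)
Definition claw_comb D E T q := exists (L : G -> {set G}) (at_ : G -> G),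
  [/\ ipath q /\ {subset q <= D}, legs E T L,
      forall y y', y \in T -> y' \in T -> y != y' -> far (L y) (L y')
    & forall y, y \in T -> [/\ at_ y \in q, exists2 u, u \in L y & adj u (at_ y)
        & forall u v, u \in L y -> v \in q -> u != v /\ (adj u v -> v = at_ y)]].

(** Each leg forms a triangle with the path on the edge from [x y] to [x' y], with third corner
    [a y]. Injectivity of [x] makes these edges distinct; they may still share an end. *)
Definition tri_teeth D E T q (L : G -> {set G}) (a x x' : G -> G) :=
  [/\ ipath q /\ {subset q <= D}, legs E T L,
      forall y y', y \in T -> y' \in T -> y != y' -> far (L y) (L y'),
      forall y, y \in T -> [/\ a y \in L y,
        x y \in q /\ x' y \in q, index (x' y) q = (index (x y) q).+1
        & forall u v, u \in L y -> v \in q ->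
            u != v /\ adj u v = (u == a y) && ((v == x y) || (v == x' y))]
    & {in T &, injective x}].

Definition tri_comb D E T q :=
  exists (L : G -> {set G}) (a x x' : G -> G), tri_teeth D E T q L a x x'.

Lemma claw_comb_widen D D' E E' T q : D \subset D' -> E \subset E' ->
  claw_comb D E T q -> claw_comb D' E' T q.
Proof.
move=> sD sE [L [at_ [[ip sq] lL fL aL]]]; exists L, at_; split=> //.
  by split=> // v /sq; apply: (subsetP sD).
move=> y yT; have [yL sL cL] := lL y yT; split=> //.
by apply: subset_trans sL _; rewrite setUS.
Qed.

Lemma tri_comb_widen D D' E E' T q : D \subset D' -> E \subset E' ->
  tri_comb D E T q -> tri_comb D' E' T q.
Proof.
move=> sD sE [L [a [x [x' [[ip sq] lL fL aL ix]]]]]; exists L, a, x, x'; split=> //.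
  by split=> // v /sq; apply: (subsetP sD).
move=> y yT; have [yL sL cL] := lL y yT; split=> //.
by apply: subset_trans sL _; rewrite setUS.
Qed.

Lemma tri_comb_sub D E T T' q : T' \subset T -> tri_comb D E T q -> tri_comb D E T' q.
Proof.
move=> /subsetP sT [L [a [x [x' [sq lL fL aL ix]]]]]; exists L, a, x, x'.
split=> // [y /sT/lL //|y y' /sT ? /sT|y /sT/aL //|y y' /sT ? /sT]; [exact: fL | exact: ix].
Qed.

Definition upd (V : Type) (v : V) (f : G -> V) y0 y := if y == y0 then v else f y.

(** The conditions under which [r] can be put in front of a path that starts at [r'] without seeing
    anything else of the comb. *)
Definition new_root X X' Z' r r' :=
  [/\ [/\ X' \subset X, r \in X, r \notin X' & adj r r'], r' \in X',
      forall x, x \in X' -> adj r x -> x = r'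
    & forall z, z \in Z' -> z != r /\ ~~ adj r z].

Lemma ipath_prepend X X' Z' r r' q : new_root X X' Z' r r' ->
  ipath (r' :: q) -> {subset r' :: q <= X'} ->
  ipath [:: r, r' & q] /\ {subset [:: r, r' & q] <= X}.
Proof.
move=> [[sX rX rX' rr'] r'X' uq _] ip sq; split; last first.
  by move=> v; rewrite inE => /orP[/eqP->//|/sq]; apply: (subsetP sX).
apply/ipath_cons; split=> // u v; rewrite inE => /eqP-> vq.
split; first by apply: contraNneq rX' => ->; apply: sq.
rewrite /= eqxx /=; apply/idP/eqP => [|->//].
by apply: uq; apply: sq.
Qed.

(** A leg vertex in [X'] seen by [r] would have to be [r'], which already lies on the path. *)
Lemma prepend_far X X' Z' r r' q A y : new_root X X' Z' r r' -> y \in Z' ->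
  leg X' y A -> {subset r' :: q <= X'} ->
  (forall u v, u \in A -> v \in r' :: q -> u != v) ->
  forall u, u \in A -> u != r /\ ~~ adj u r.
Proof.
move=> [[sX rX rX' rr'] r'X' uq nZ] yZ [_ sA _] sq ne u uA.
have := subsetP sA u uA; rewrite !inE => /orP[/eqP->|uX'].
  by rewrite adjC; apply: nZ.
split; first by apply: contraNneq rX' => <-.
rewrite adjC; apply/negP=> /(uq u uX') ur'.
by have := ne u r' uA (mem_head _ _); rewrite ur' eqxx.
Qed.

Lemma claw_comb_prepend X X' Z' r r' q T : new_root X X' Z' r r' -> T \subset Z' ->
  claw_comb X' X' T (r' :: q) -> claw_comb X X' T [:: r, r' & q].
Proof.
move=> nr /subsetP sT [L [at_ [[ip sq] lL fL aL]]]; exists L, at_; split=> //.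
  exact: ipath_prepend nr ip sq.
move=> y yT; have [aq ex h] := aL y yT; split=> //; first by rewrite inE aq orbT.
move=> u v uL; rewrite inE => /orP[/eqP->|vq]; last exact: h.
have [|ne /negPf->] := prepend_far nr (sT y yT) (lL y yT) sq _ uL; last by [].
by move=> u' v' u'L v'q; have [] := h u' v' u'L v'q.
Qed.

Lemma claw_comb_add X X' T q y0 L0 r : X' \subset X -> claw_comb X X' T q -> r \in q ->
  y0 \notin T -> leg X y0 L0 -> far L0 (X' :|: T) ->
  (exists2 u, u \in L0 & adj u r) ->
  (forall u v, u \in L0 -> v \in q -> u != v /\ (adj u v -> v = r)) ->
  claw_comb X X (y0 |: T) q.
Proof.
move=> sX [L [at_ [[ip sq] lL fL aL]]] rq y0T l0 f0 ex0 h0.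
exists (upd L0 L y0), (fun y => if y == y0 then r else at_ y).
have ny y : y \in T -> (y == y0) = false.
  by move=> yT; apply/negbTE; apply: contraNneq y0T => <-.
have far0 y : y \in T -> far L0 (L y).
  move=> yT; have [_ sL _] := lL y yT; apply: far_sub f0 => //.
  apply: subset_trans sL _; rewrite subUset subsetUl sub1set inE yT orbT //.
split=> //.
- move=> y; rewrite !inE /upd => /orP[/eqP->|yT]; first by rewrite eqxx.
  rewrite ny //; have [yL sL cL] := lL y yT; split=> //.
  by apply: subset_trans sL _; rewrite setUS.
- move=> y y'; rewrite !inE /upd => /orP[/eqP->|yT] /orP[/eqP->|y'T] yy'.
  + by rewrite eqxx in yy'.
  + by rewrite eqxx ny //; apply: far0.
  + by rewrite eqxx ny //; apply/far_sym/far0.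
  + by rewrite !ny //; apply: fL.
move=> y; rewrite !inE /upd => /orP[/eqP->|yT]; first by rewrite eqxx.
by rewrite ny //; apply: aL.
Qed.

Lemma tri_teeth_prepend X X' Z' r r' q T (L : G -> {set G}) (a x x' : G -> G) : new_root X X' Z' r r' ->
  T \subset Z' -> tri_teeth X' X' T (r' :: q) L a x x' ->
  tri_teeth X X' T [:: r, r' & q] L a x x'.
Proof.
move=> nr /subsetP sT [[ip sq] lL fL aL ix].
have rq v : v \in r' :: q -> (r == v) = false.
  move=> vq; apply/negbTE; have [[_ _ rX' _] _ _ _] := nr.
  by apply: contraNneq rX' => ->; apply: sq.
split=> //; first exact: ipath_prepend nr ip sq.
move=> y yT; have [aA [xq xq'] ixq h] := aL y yT; split=> //.
- by rewrite inE xq inE xq' !orbT.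
- by rewrite /= !rq // -ixq.
move=> u v uL; rewrite inE => /orP[/eqP->|vq]; last exact: h.
have [|ne /negPf->] := prepend_far nr (sT y yT) (lL y yT) sq _ uL.
  by move=> u' v' u'L v'q; have [] := h u' v' u'L v'q.
by split=> //; rewrite !rq // andbF.
Qed.

(** The new tooth sits on the first edge of the path, from [r] to [r'], and [w] is its third
    corner. *)
Lemma tri_comb_add X X' Z' r r' q T y0 L0 w : new_root X X' Z' r r' -> T \subset Z' ->
  tri_comb X' X' T (r' :: q) -> y0 \notin T -> leg X y0 L0 -> w \in L0 ->
  far L0 T ->
  (forall u v, u \in L0 -> v \in X' ->
     u != v /\ adj u v = (u == w) && (v == r')) ->
  (forall u, u \in L0 -> u != r /\ adj u r = (u == w)) ->
  tri_comb X X (y0 |: T) [:: r, r' & q].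
Proof.
move=> nr sT [L [a [x [x' tt']]]] y0T l0 wL fT hX hr.
have [[sX rX rX' rr'] r'X' uq nZ] := nr.
have [ipq lL fL aL ix] := tri_teeth_prepend nr sT tt'.
have [[_ sq] _ _ aL' _] := tt'.
have ny y : y \in T -> (y == y0) = false.
  by move=> yT; apply/negbTE; apply: contraNneq y0T => <-.
have xr y : y \in T -> x y != r.
  move=> yT; have [_ [xq _] _ _] := aL' y yT.
  by apply: contraNneq rX' => <-; apply: sq.
have far0 y : y \in T -> far L0 (L y).
  move=> yT u v uL vL; have [_ sL _] := lL y yT.
  have := subsetP sL v vL; rewrite !inE => /orP[/eqP->|vX]; first exact: fT.
  have [ne e] := hX u v uL vX; split=> //; rewrite e negb_and; apply/orP; right.
  have [_ _ _ h] := aL' y yT; have [] // := h v r' vL.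
  exact: mem_head.
exists (upd L0 L y0), (upd w a y0), (upd r x y0), (upd r' x' y0).
split=> //.
- move=> y; rewrite !inE /upd => /orP[/eqP->|yT]; first by rewrite eqxx.
  rewrite ny //; have [yL sL cL] := lL y yT; split=> //.
  by apply: subset_trans sL _; rewrite setUS.
- move=> y y'; rewrite !inE /upd => /orP[/eqP->|yT] /orP[/eqP->|y'T] yy'.
  + by rewrite eqxx in yy'.
  + by rewrite eqxx ny //; apply: far0.
  + by rewrite eqxx ny //; apply/far_sym/far0.
  + by rewrite !ny //; apply: fL.
- move=> y; rewrite !inE /upd => /orP[/eqP->|yT]; last first.
    by rewrite ny //; apply: aL.
  rewrite !eqxx; split=> //.
  + by rewrite orbT.
  + by rewrite /= !eqxx; case: eqP => // rE; rewrite rE r'X' in rX'.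
  move=> u v uL; rewrite inE => /orP[/eqP->|vq].
    by have [ne ->] := hr u uL; rewrite eqxx andbT.
  have [ne ->] := hX u v uL (sq v vq); split=> //; congr (_ && _).
  rewrite [v == r]eq_sym.
  have -> // : (r == v) = false.
  by apply/negbTE; apply: contraNneq rX' => ->; apply: sq.
move=> y y'; rewrite !inE /upd => /orP[/eqP->|yT] /orP[/eqP->|y'T] //.
- by rewrite eqxx ny // => xE; have := xr y' y'T; rewrite -xE eqxx.
- by rewrite eqxx ny // => xE; have := xr y yT; rewrite xE eqxx.
- by rewrite !ny //; apply: ix.
Qed.

(** [r] is the current end of the growing path, [X] the part still ahead, [Z] the terminals attached
    to it. [B] is what has been walked, down to the terminal [y0]; it touches the part ahead only at
    [r] and is a ready-made leg for claws and triangles at the root. *)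
Definition state D Y X B Z r y0 :=
  [/\ [/\ X \subset D, r \in X & conn X], attached Z X, Z \subset Y,
      leg D y0 B /\ y0 \in Y
    & [/\ far B (X :\ r), far B Z, r \notin B & exists2 b, b \in B & adj r b]].

Lemma state_min D Y X B Z r y0 : state D Y X B Z r y0 ->
  exists X', [/\ X' \subset X, state D Y X' B Z r y0 & rooted_min X' r Z].
Proof.
case=> [[sX rX cX] aX sZ lB [f1 f2 rB eb]].
have [|X' [sX' [rX' cX' aX'] minX']] := @minimal_subset G
  (fun X => [/\ r \in X, conn X & attached Z X]) X; first by [].
exists X'; split=> //; last by move=> X'' pX rX'' cX'' aX''; apply: (minX' X'' pX).
split=> //; first by split=> //; apply: subset_trans sX.
by split=> //; apply: far_sub f1 => //; apply: setSD.
Qed.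

(** The old root joins the walked part, which stays far from the new part ahead because [r'] is the
    only neighbour of [r] there. *)
Lemma state_move D Y X B Z r y0 X' Z' r' : [disjoint Y & D] ->
  state D Y X B Z r y0 -> X' \subset X :\ r -> conn X' -> r' \in X' -> adj r r' ->
  Z' \subset Z -> attached Z' X' -> (forall x, x \in X' -> adj r x -> x = r') ->
  (forall z, z \in Z' -> ~~ adj r z) ->
  state D Y X' (r |: B) Z' r' y0 /\ new_root X X' Z' r r'.
Proof.
move=> dYD [[sX rX cX] aX sZ [[yB sB cB] yY] [f1 f2 rB [b bB rb]]].
move=> sX' cX' r'X' rr' sZ' aX' uq nZ'.
have nr z : z \in Z' -> z != r.
  move=> zZ; have zY := subsetP sZ z (subsetP sZ' z zZ).
  by apply: contraFneq (disjointFr dYD zY) => ->; apply: (subsetP sX).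
have sX'X : X' \subset X by apply: subset_trans sX' (subsetDl _ _).
have rX' : r \notin X' by apply/negP=> /(subsetP sX'); rewrite !inE eqxx.
split; last by split=> // z zZ; split; [exact: nr | exact: nZ'].
split=> //.
- by split=> //; apply: subset_trans sX.
- exact: subset_trans sZ' sZ.
- split=> //; split; last exact: conn_add rb.
    by rewrite inE yB orbT.
  by rewrite subUset sub1set !inE (subsetP sX) ?orbT.
split.
- move=> u v; rewrite !inE => /orP[/eqP->|uB] /andP[vr' vX'].
    split; first by apply: contraNneq rX' => ->.
    by apply/negP=> /(uq v vX') vr; rewrite vr eqxx in vr'.
  by apply: f1 => //; apply: (subsetP sX').
- move=> u v; rewrite !inE => /orP[/eqP->|uB] vZ'; last exact: f2 (subsetP sZ' v vZ').
  by rewrite eq_sym nr // nZ'.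
- rewrite !inE negb_or eq_sym (adj_neq rr') /=; apply/negP=> r'B.
  by have [] := f1 r' r' r'B (subsetP sX' r' r'X'); rewrite eqxx.
by exists r; rewrite ?inE ?eqxx // adjC.
Qed.

(** Terminals needed for [j] more teeth. Fewer than [J] are lost at the root; a branching keeps a
    share of one in [2 * J] of the rest, there being at most [J] pieces, one of which is cut in two.
    Of the [2 * c], one [c] pays for the thinned leg and the other is the allowance for the next
    unbranched stretch. *)
Fixpoint weight (J c j : nat) := if j is j'.+1 then J + 2 * J * (weight J c j' + 2 * c) else 0.

(** * Growth of a comb, common to both sides *)

Section Recursion.

Variable comb : {set G} -> {set G} -> {set G} -> seq G -> Prop.
Variables (D Y : {set G}) (J c : nat).

Definition crowded := exists q, [/\ ipath q, {subset q <= D} & c <= #|coll Y q|].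

Definition big_comb X Z r j := exists T q, [/\ T \subset Z, j <= #|T| & comb X X T (r :: q)].

Hypothesis J0 : 0 < J.
Hypothesis dYD : [disjoint Y & D].
Hypothesis comb0 : forall X r, r \in X -> comb X X set0 [:: r].
Hypothesis comb_prepend : forall X X' Z' r r' q T, new_root X X' Z' r r' ->
  T \subset Z' -> comb X' X' T (r' :: q) -> comb X X T [:: r, r' & q].
Hypothesis comb_star : forall X B Z r y0, state D Y X B Z r y0 ->
  rooted_min X r Z -> J <= #|att Z [set r]| -> big_comb X Z r J.
Hypothesis comb_branch : forall X B Z r y0, state D Y X B Z r y0 ->
  rooted_min X r Z -> 1 < #|[set x in X | adj r x]| ->
  [\/ big_comb X Z r J, crowded | exists X' Z' r' y,
   [/\ X' \subset X :\ r /\ state D Y X' (r |: B) Z' r' y0,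
       #|Z :\: att Z [set r]| <= 2 * J * (#|Z'| + c),
       Z' \subset Z, y \in Z :\: Z'
     & forall T q, T \subset Z' -> comb X' X' T (r' :: q) ->
         comb X X (y |: T) [:: r, r' & q]]].
Hypothesis comb_widen : forall X X' T q, X \subset X' -> comb X X T q -> comb X' X' T q.

(** Induction on the size of [X]. A branching at the root yields one tooth and uses up one unit of
    [j]. Without branching the root is merely prepended, and the terminals it sees are charged to
    [c']: once [c'] is used up, the unbranched stretch sees enough terminals. After a branching the
    allowance starts anew at [c]. *)
Lemma comb_rec n X B Z r y0 j c' : #|X| < n -> state D Y X B Z r y0 ->
  j <= J -> c' <= c -> weight J c j + c' <= #|Z| ->
  [\/ big_comb X Z r j,
      exists q, [/\ ipath (r :: q), {subset r :: q <= X} & c' <= #|coll Z (r :: q)|]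
    | crowded].
Proof.
elim: n X B Z r y0 j c' => // n IHn X0 B Z r y0 j c' ltX st0 jJ cc wZ.
have [X [sX st minX]] := state_min st0.
have {ltX}ltX : #|X| <= n by apply: leq_trans (subset_leq_card sX) _.
suff: [\/ big_comb X Z r j,
      exists q, [/\ ipath (r :: q), {subset r :: q <= X} & c' <= #|coll Z (r :: q)|]
    | crowded].
  case=> [[T [q [sT jT cT]]]|[q [ip sq cq]]|h]; [| |by constructor 3].
    by constructor 1; exists T, q; split=> //; apply: comb_widen cT.
  by constructor 2; exists q; split=> // v /sq; apply: (subsetP sX).
move: (st) => [[sXD rX cX] attX sZ _ _].
case: j jJ wZ => [|j] jJ wZ.
  by constructor 1; exists set0, [::]; rewrite sub0set cards0; split=> //; apply: comb0.
have [|ltJ] := leqP J #|att Z [set r]|.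
  move=> /(comb_star st minX)[T [q [sT JT cT]]]; constructor 1; exists T, q.
  by split=> //; apply: leq_trans jJ JT.
have cZ : #|Z :\: att Z [set r]| + #|att Z [set r]| = #|Z|.
  by rewrite -(cardsID (att Z [set r]) Z) addnC (setIidPr (att_sub _ _)).
have coll1 : coll Z [:: r] = att Z [set r].
  by congr att; apply/setP=> v; rewrite !inE.
have nZ' z : z \in Z :\: att Z [set r] -> ~~ adj r z.
  move=> /setDP[zZ]; rewrite adjC; apply: contra => zr.
  by apply/attP; split=> //; exists r; rewrite ?inE.
have [|le1] := ltnP 1 #|[set x in X | adj r x]|.
  case/(comb_branch st minX) => [[T [q [sT JT cT]]]|h|].
  - by constructor 1; exists T, q; split=> //; apply: leq_trans jJ JT.
  - by constructor 3.
  case=> X' [Z' [r' [y [[sX' st'] cnt sZ' yZ ext]]]].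
  have ltX' : #|X'| < n.
    by apply: leq_trans ltX; rewrite (cardsD1 r X) rX ltnS; apply: subset_leq_card.
  have wZ' : weight J c j + c <= #|Z'|.
    rewrite -(leq_add2r c) -(@leq_pmul2l (2 * J)) ?muln_gt0 //.
    apply: leq_trans cnt; rewrite -(leq_add2r #|att Z [set r]|) cZ.
    apply: leq_trans wZ => /=; rewrite -addnA addnn -mul2n; lia.
  case: (IHn X' (r |: B) Z' r' y0 j c ltX' st' (ltnW jJ) (leqnn c) wZ') => [[T [q [sT jT cT]]]|[q [ip sq cq]]|h].
  - constructor 1; exists (y |: T), (r' :: q); split; last exact: ext.
      by rewrite subUset sub1set (subset_trans sT sZ') andbT; case/setDP: yZ.
    have yT : y \notin T by case/setDP: yZ => _; apply: contra; apply: (subsetP sT).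
    by rewrite cardsU1 yT.
  (* The allowance was reset to the full [c], so this path is crowded by itself. *)
  - constructor 3; exists (r' :: q); split=> //.
      move=> v /sq vX'; apply: (subsetP sXD); have := subsetP sX' v vX'.
      by rewrite !inE => /andP[].
    apply: leq_trans cq _; apply/subset_leq_card/subsetP=> z /attP[zZ' ex].
    by apply/attP; split=> //; apply/(subsetP sZ)/(subsetP sZ').
  - by constructor 3.
have [h|lt_c] := leqP c' #|att Z [set r]|.
  constructor 2; exists [::]; rewrite coll1; split=> //.
  by move=> v; rewrite inE => /eqP->.
have Z'0 : 0 < #|Z :\: att Z [set r]|.
  have := leq_trans (leq_trans lt_c (leq_addl _ _)) wZ.
  by rewrite -cZ -{1}[#|att Z [set r]|]add0n ltn_add2r.
have [z zZ'] : exists z, z \in Z :\: att Z [set r] by apply/set0Pn; rewrite -card_gt0.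
have [r' r'X rr'] : exists2 x, x \in X & adj r x.
  have [x xX zx] : exists2 x, x \in X & adj z x by apply: attX; case/setDP: zZ'.
  have xr : x \notin [set r].
    by rewrite inE; apply: contraNneq (nZ' z zZ') => <-; rewrite adjC.
  have [||u [v [+ vX _ uv]]] := conn_edge cX _ _ xX xr.
  - by rewrite sub1set.
  - by apply/set0Pn; exists r; rewrite inE.
  by rewrite inE => /eqP ur; exists v; rewrite // -ur.
have uq x : x \in X -> adj r x -> x = r'.
  move=> xX rx; move: le1; rewrite (cardsD1 r') inE r'X rr' ltnS leqn0 cards_eq0 => /eqP E.
  apply/eqP; apply: contraT => xr'.
  have : x \in [set x in X | adj r x] :\ r' by rewrite !inE xr' xX.
  by rewrite E inE.
have rr'n := adj_neq rr'.
have attX' : attached (Z :\: att Z [set r]) (X :\ r).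
  move=> z1 z1Z; have [x xX zx] : exists2 x, x \in X & adj z1 x by apply: attX; case/setDP: z1Z.
  exists x => //; rewrite !inE xX andbT; apply: contraNneq (nZ' z1 z1Z) => <-.
  by rewrite adjC.
have r'X' : r' \in X :\ r by rewrite !inE eq_sym rr'n.
have [st' nr] := state_move dYD st (subxx _) (conn_remove_leaf cX rX r'X rr'n uq)
  r'X' rr' (subsetDl _ _) attX' (fun x xX' => uq x (subsetP (subsetDl _ _) x xX')) nZ'.
have ltX' : #|X :\ r| < n by apply: leq_trans ltX; rewrite (cardsD1 r X) rX.
(* The terminals seen by the root leave [Z] and are deducted from [c'] in equal number. *)
have wZ' : weight J c j.+1 + (c' - #|att Z [set r]|) <= #|Z :\: att Z [set r]|.
  by rewrite addnBA ?(ltnW lt_c) // leq_subLR [_ + #|_ :\: _|]addnC cZ.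
have cc' : c' - #|att Z [set r]| <= c by apply: leq_trans (leq_subr _ _) cc.
case: (IHn _ _ _ _ _ _ _ ltX' st' jJ cc' wZ') => [[T [q [sT jT cT]]]|[q [ip sq cq]]|h].
- constructor 1; exists T, (r' :: q); split=> //; last exact: comb_prepend nr sT cT.
  exact: subset_trans sT (subsetDl _ _).
- constructor 2; exists (r' :: q); have [ip' sq'] := ipath_prepend nr ip sq; split=> //.
  rewrite leq_subLR in cq; apply: leq_trans cq _.
  have dis : [disjoint att Z [set r] & coll (Z :\: att Z [set r]) (r' :: q)].
    apply/pred0P=> v /=; apply/negP=> /andP[v1 /attP[]].
    by rewrite inE v1.
  rewrite -cardsUI (disjoint_setI0 dis) cards0 addn0; apply/subset_leq_card/subsetP => v.
  rewrite inE => /orP[|] /attP[vZ [x xr vx]]; apply/attP.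
    by split=> //; exists x => //; move: xr; rewrite !inE => ->.
  split; first by case/setDP: vZ.
  by exists x => //; move: xr; rewrite !in_set [in X in _ -> X]in_cons => ->; rewrite orbT.
- by constructor 3.
Qed.

End Recursion.

End Combs.

(** * Branching at the root *)

Section Branching.

Variable G : sgraph.
Implicit Types (a b d x y z r : G) (s p q : seq G).
Implicit Types (A B C D E K L M N S T W X Y Z : {set G}).

Lemma C4_intro a b (c : G) d : ~ has_C4 G -> a != c -> b != d -> ~~ adj a c -> ~~ adj b d ->
  adj a b -> adj b c -> adj c d -> adj d a -> False.
Proof.
move=> noC4 ac bd aac abd ab bc cd da; apply: noC4.
have [abn bcn cdn dan] := And4 (adj_neq ab) (adj_neq bc) (adj_neq cd) (adj_neq da).
have hc : is_hole_cycle ([:: a; b; c] ++ [:: d]).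
  apply: hole_of_paths => //.
    rewrite /= !inE negb_or abn ac bcn !eqxx ab bc (negPf aac) /=.
    by rewrite [c == b]eq_sym (negPf bcn).
  move=> u v; rewrite !inE => uabc /eqP->; case/or3P: uabc => /eqP->.
  - by rewrite eq_sym dan adjC da /= !eqxx orbT.
  - rewrite bd (negPf abd) /= eqxx !andbT orbC.
    by rewrite [b == a]eq_sym (negPf abn) (negPf bcn).
  by rewrite cdn cd /= !eqxx.
exists (verts ([:: a; b; c] ++ [:: d])); first by exists ([:: a; b; c] ++ [:: d]).
by rewrite /verts cardsE; have /card_uniqP-> : uniq ([:: a; b; c] ++ [:: d]) by case: hc.
Qed.

Lemma no3 (P : {set G} -> Prop) Y y1 y2 y3 :
  (forall S, S \subset Y -> #|S| = 3 -> ~ P S) ->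
  y1 \in Y -> y2 \in Y -> y3 \in Y -> [/\ y1 != y2, y1 != y3 & y2 != y3] ->
  ~ P [set y1; y2; y3].
Proof.
move=> H y1Y y2Y y3Y [n12 n13 n23]; apply: H.
  by apply/subsetP; apply: in_set3.
by rewrite setUC cardsU1 !inE negb_or cards2 n12 ![y3 == _]eq_sym n13 n23.
Qed.

Section Root.

Variables (D Y X B Z : {set G}) (r y0 : G) (J c : nat).
Hypothesis stY : stable Y.
Hypothesis dYD : [disjoint Y & D].
Hypothesis st : state D Y X B Z r y0.
Hypothesis minX : rooted_min X r Z.

Let sXD : X \subset D. Proof. by case: st => -[]. Qed.
Let rX : r \in X. Proof. by case: st => -[]. Qed.
Let cX : conn X. Proof. by case: st => -[]. Qed.
Let attX : attached Z X. Proof. by case: st. Qed.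
Let sZY : Z \subset Y. Proof. by case: st. Qed.
Let y0Y : y0 \in Y. Proof. by case: st => _ _ _ []. Qed.
Let lB : leg D y0 B. Proof. by case: st => _ _ _ []. Qed.
Let y0B : y0 \in B. Proof. by case: lB. Qed.
Let fBX : far B (X :\ r). Proof. by case: st => _ _ _ _ []. Qed.
Let fBZ : far B Z. Proof. by case: st => _ _ _ _ []. Qed.
Let rB : r \notin B. Proof. by case: st => _ _ _ _ []. Qed.
Let eB : exists2 b, b \in B & adj r b. Proof. by case: st => _ _ _ _ []. Qed.
Let y0Z z : z \in Z -> y0 != z.
Proof. by move=> zZ; have [] := fBZ y0B zZ. Qed.
Let nX z : z \in Z -> z \notin X.
Proof. exact: (notinX dYD sZY sXD). Qed.

Lemma back_far x y K : private_leg X r Z x y K -> x \in X -> x != r ->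
  far B (x |: (y |: K)).
Proof.
move=> pl xX xr u v uB; rewrite !inE => /or3P[/eqP->|/eqP->|vK].
- by apply: fBX; rewrite // !inE xr.
- by apply: fBZ => //; case: pl.
apply: fBX => //; case: pl => _ [sK rK _] _ _ _.
move: (subsetP sK v vK); rewrite !inE => /andP[_ ->].
by rewrite andbT; apply: contraNneq rK => <-.
Qed.

Lemma root_leg : leg D y0 (r |: B).
Proof.
have [_ sB cB] := lB; split.
- by rewrite inE y0B orbT.
- by rewrite subUset sub1set inE (subsetP sXD r rX) orbT sB.
- by have [b bB rb] := eB; apply: (conn_add cB bB rb).
Qed.

Lemma root_cross x y K : private_leg X r Z x y K -> x \in X -> adj r x ->
  cross (r |: B) (x |: (y |: K)) r x.
Proof.
move=> pl xX rx; have xr : x != r by rewrite eq_sym adj_neq.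
move=> u v; rewrite in_setU1 => /orP[/eqP->|uB] vL.
  have [ne h] := leg_root dYD sZY sXD rX pl xr vL; rewrite eq_sym ne eqxx; split=> //=.
  by apply/idP/eqP => [|->//]; rewrite adjC.
have [ne /negPf->] := back_far pl xX xr uB vL; split=> //.
by have -> : (u == r) = false by apply/negbTE; apply: contraNneq rB => <-.
Qed.

Lemma leg_widen x y K : private_leg X r Z x y K -> x \in X -> leg D y (x |: (y |: K)).
Proof.
move=> pl xX; have [yL sL cL] := private_leg_leg pl xX; split=> //.
by apply: subset_trans sL _; apply: setUS.
Qed.

Lemma two_distinct x y K x' y' K' : private_leg X r Z x y K ->
  private_leg X r Z x' y' K' -> y != y' -> [/\ y0 != y, y0 != y' & y != y'].
Proof. by case=> yZ _ _ _ _ [y'Z _ _ _ _] yy'; split=> //; apply: y0Z. Qed.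

(** Adjacent neighbours [x] and [x'] form a triangle with [r], whose three legs are the two private
    legs and the walked part [B] with [r]. *)
Lemma root_nbrs_stable x x' : (forall S, S \subset Y -> #|S| = 3 -> ~ tri D S) ->
  x \in X -> x' \in X -> adj r x -> adj r x' -> x != x' -> ~~ adj x x'.
Proof.
move=> notri xX x'X rx rx' xx'; apply/negP=> axx'.
have xr : x != r by rewrite eq_sym adj_neq.
have x'r : x' != r by rewrite eq_sym adj_neq.
have [y [K pl]] := private_leg_ex cX rX attX minX xX xr.
have [y' [K' pl']] := private_leg_ex cX rX attX minX x'X x'r.
have [yy' h] := two_legs stY dYD sZY sXD rX attX pl pl' xX x'X rx rx' xx'.
have d3 := two_distinct pl pl' yy'.
case: (no3 notri y0Y _ _ d3); first by apply: (subsetP sZY); case: pl.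
  by apply: (subsetP sZY); case: pl'.
apply: (tri_intro d3 root_leg (leg_widen pl xX) (leg_widen pl' x'X)
  (setU11 _ _) (setU11 _ _) (setU11 _ _) (root_cross pl xX rx) (root_cross pl' x'X rx')).
move=> u v uL vL; have [ne hh] := h u v uL vL; split=> //.
by apply/idP/andP => [/hh[-> ->]|[/eqP-> /eqP->]].
Qed.

(** Nonadjacent neighbours would give a claw centred at [r], whose legs are the two private legs and
    the walked part [B]. *)
Lemma root_nbrs_clique x x' : (forall S, S \subset Y -> #|S| = 3 -> ~ claw D S) ->
  x \in X -> x' \in X -> adj r x -> adj r x' -> x != x' -> adj x x'.
Proof.
move=> noclaw xX x'X rx rx' xx'; apply: contraT => axx'.
have xr : x != r by rewrite eq_sym adj_neq.
have x'r : x' != r by rewrite eq_sym adj_neq.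
have [y [K pl]] := private_leg_ex cX rX attX minX xX xr.
have [y' [K' pl']] := private_leg_ex cX rX attX minX x'X x'r.
have [yy' h] := two_legs stY dYD sZY sXD rX attX pl pl' xX x'X rx rx' xx'.
have d3 := two_distinct pl pl' yy'.
case: (no3 noclaw y0Y _ _ d3); first by apply: (subsetP sZY); case: pl.
  by apply: (subsetP sZY); case: pl'.
have rL a b M : private_leg X r Z a b M -> a \in X -> adj r a -> r \notin a |: (b |: M).
  move=> pla aX ra; apply/negP=> h1.
  have [] := root_cross pla aX ra (setU11 _ _) h1.
  by rewrite eqxx.
apply: (@claw_intro _ D y0 y y' r B _ _ d3 lB (leg_widen pl xX) (leg_widen pl' x'X)).
- exact: back_far pl xX xr.
- exact: back_far pl' x'X x'r.
- move=> u v uL vL; have [ne hh] := h u v uL vL; split=> //.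
  by apply/negP=> uv; have [ux vx'] := hh uv; rewrite ux vx' (negPf axx') in uv.
- exact: (subsetP sXD).
- exact: rB.
- exact: rL pl xX rx.
- exact: rL pl' x'X rx'.
- exact: eB.
- by exists x => //; apply: setU11.
- by exists x' => //; apply: setU11.
Qed.

Lemma claw_comb_star : J <= #|att Z [set r]| -> big_comb (@claw_comb G) X Z r J.
Proof.
move=> JT; exists (att Z [set r]), [::]; split=> //; first exact: att_sub.
have TZ z : z \in att Z [set r] -> z \in Z by apply: (subsetP (att_sub _ _)).
exists (fun y => [set y]), (fun=> r); split.
- by split=> // v; rewrite inE => /eqP->.
- move=> y yT; split; [by rewrite inE | exact: subsetUl | exact: conn1].
- move=> y y' yT y'T yy' u v; rewrite !inE => /eqP-> /eqP->; split=> //.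
  by apply: stY; apply: (subsetP sZY); apply: TZ.
move=> y yT; split; first by rewrite inE.
  exists y; rewrite ?inE //; by case/attP: yT => _ [x]; rewrite inE => /eqP->.
move=> u v; rewrite !inE => /eqP-> /eqP->; split=> //.
by apply: contraTneq rX => <-; apply: nX; apply: TZ.
Qed.

(** The neighbours of the root are pairwise nonadjacent, so their private legs are far from each
    other and all attach at [r]: the path of the comb is the single vertex [r]. *)
Lemma claw_legs_star : (forall S, S \subset Y -> #|S| = 3 -> ~ tri D S) ->
  J <= #|[set x in X | adj r x]| -> big_comb (@claw_comb G) X Z r J.
Proof.
move=> notri; set N := [set x in X | adj r x] => JN.
have NX x : x \in N -> [/\ x \in X, adj r x & x != r].
  by rewrite inE => /andP[-> rx]; rewrite rx eq_sym adj_neq.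
have ex x : exists yK : G * {set G}, x \in N -> private_leg X r Z x yK.1 yK.2.
  have [/NX[xX rx xr]|xN] := boolP (x \in N); last by exists (r, set0).
  by have [y [K pl]] := private_leg_ex cX rX attX minX xX xr; exists (y, K).
have [f Hf] := fin_all_exists ex.
have two x x' : x \in N -> x' \in N -> x != x' -> (f x).1 != (f x').1 /\
    far (x |: ((f x).1 |: (f x).2)) (x' |: ((f x').1 |: (f x').2)).
  move=> xN x'N xx'; have [xX rx _] := NX x xN; have [x'X rx' _] := NX x' x'N.
  have [ne h] := two_legs stY dYD sZY sXD rX attX (Hf x xN) (Hf x' x'N) xX x'X rx rx' xx'.
  split=> // u v uL vL; have [ne' hh] := h u v uL vL; split=> //.
  apply/negP=> uv; have [ux vx'] := hh uv; move: uv; rewrite ux vx'.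
  by apply/negP; apply: root_nbrs_stable.
(* Recovers from a private terminal the neighbour of the root that owns it. *)
pose g y := odflt r [pick x in N | (f x).1 == y].
have gK x : x \in N -> g (f x).1 = x.
  move=> xN; rewrite /g; case: pickP => [x' /andP[x'N /eqP E]|/(_ x)]; last by rewrite xN eqxx.
  apply/eqP; apply: contraT => /= xx'.
  by have [] := two x' x x'N xN xx'; rewrite E eqxx.
have injf : {in N &, injective (fun x => (f x).1)}.
  by move=> x x' xN x'N E; rewrite -(gK x xN) -(gK x' x'N) E.
exists [set (f x).1 | x in N], [::]; split.
- by apply/subsetP=> _ /imsetP[x xN ->]; case: (Hf x xN).
- by rewrite card_in_imset.
exists (fun y => g y |: (y |: (f (g y)).2)), (fun=> r); split.
- by split=> // v; rewrite inE => /eqP->.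
- move=> _ /imsetP[x xN ->]; rewrite gK //; apply: private_leg_leg (Hf x xN) _.
  by case: (NX x xN).
- move=> _ _ /imsetP[x xN ->] /imsetP[x' x'N ->] ff; rewrite !gK //.
  by apply: (two x x' xN x'N _).2; apply: contraNneq ff => ->.
move=> _ /imsetP[x xN ->]; rewrite gK //; have [xX rx xr] := NX x xN.
split; first by rewrite inE.
  by exists x; [apply: setU11 | rewrite adjC].
move=> u v uL; rewrite inE => /eqP->; split=> //.
by have [] := leg_root dYD sZY sXD rX (Hf x xN) xr uL.
Qed.

Let Z0 := Z :\: att Z [set r].

Let Z0Z : Z0 \subset Z. Proof. exact: subsetDl. Qed.

Let nZ0 z : z \in Z0 -> ~~ adj r z.
Proof.
move=> /setDP[zZ]; rewrite adjC; apply: contra => zr.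
by apply/attP; split=> //; exists r; rewrite ?inE.
Qed.

(** One tooth of the claw comb: the thinned leg of [y] starting at [x] attaches at [r], and growth
    continues in [X'] from [r']. *)
Lemma claw_close X' r' x y K : private_leg X r Z x y K -> x \in X -> adj r x ->
  X' \subset X :\ r -> conn X' -> r' \in X' -> adj r r' ->
  (forall x, x \in X' -> adj r x -> x = r') -> x \notin X' ->
  (forall x', x' \in X' -> ~~ adj x x') -> #|Z0| <= 2 * J * #|att Z0 X'| ->
  crowded D Y c \/ exists X' Z' r' y,
   [/\ X' \subset X :\ r /\ state D Y X' (r |: B) Z' r' y0,
       #|Z :\: att Z [set r]| <= 2 * J * (#|Z'| + c),
       Z' \subset Z, y \in Z :\: Z'
     & forall T q, T \subset Z' -> claw_comb X' X' T (r' :: q) ->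
         claw_comb X X (y |: T) [:: r, r' & q]].
Proof.
move=> pl xX rx sX' cX' r'X' rr' uq xX' nxX' cnt.
have sAZ : att Z0 X' \subset Z by apply: subset_trans (att_sub _ _) Z0Z.
case: (thin_leg stY dYD sZY sXD c pl xX sAZ) => [|[L [Z' [[lL xL sL _ _] [sZ' yZ' fL] cnt']]]].
  by left.
right; exists X', Z', r', y.
have sZ'Z : Z' \subset Z := subset_trans sZ' sAZ.
have aZ' : attached Z' X' by move=> z /(subsetP sZ'); apply: att_attached.
have nZ' z : z \in Z' -> ~~ adj r z.
  by move=> /(subsetP sZ')/(subsetP (att_sub _ _)); apply: nZ0.
have [st' nr] := state_move dYD st sX' cX' r'X' rr' sZ'Z aZ' uq nZ'.
split=> //.
- apply: leq_trans cnt _; by rewrite leq_mul2l cnt' orbT.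
- by rewrite inE yZ'; case: pl.
move=> T q sT cT.
have xr : x != r by rewrite eq_sym adj_neq.
have farX' : far L X'.
  move=> u v /(subsetP sL) uL vX'.
  have cW : conn (r |: X') by apply: (conn_add cX' r'X').
  have sW : r |: X' \subset X.
    by rewrite subUset sub1set rX (subset_trans sX' (subsetDl _ _)).
  have xW : x \notin r |: X' by rewrite !inE negb_or xr.
  have vW : v \in r |: X' by rewrite inE vX' orbT.
  have [ne h] := leg_avoid dYD sZY sXD pl cW sW (setU11 _ _) xW uL vW; split=> //.
  by apply/negP=> uv; have ux := h uv; rewrite ux (negPf (nxX' v vX')) in uv.
have sX'X : X' \subset X := subset_trans sX' (subsetDl _ _).
apply: (claw_comb_add (r := r) (L0 := L) sX'X) => //.
- exact: claw_comb_widen (subxx _) (subxx _) (claw_comb_prepend nr sT cT).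
- by rewrite mem_head.
- by apply: contra yZ'; apply: (subsetP sT).
- move=> u v uL; rewrite inE => /orP[|vT]; first exact: farX'.
  by apply: fL => //; apply: (subsetP sT).
- by exists x; rewrite // adjC.
move=> u v uL; rewrite inE => /orP[/eqP->|vq].
  by have [] := leg_root dYD sZY sXD rX pl xr (subsetP sL u uL).
have [_ [_ [[_ sq] _ _ _]]] := cT.
by have [ne /negPf->] := farX' u v uL (sq v vq).
Qed.

Let Z0X : attached Z0 X.
Proof. by move=> z /(subsetP Z0Z); apply: attX. Qed.

(** The heavy piece [C] at [v] is cut by a second neighbour [w] of the root into [E], kept by [v],
    and [F], given to [w]. The better part keeps at least half of the terminals seen by [C], which
    with at most [J] pieces accounts for [2 * J]. *)
Lemma two_ways : 1 < #|[set x in X | adj r x]| -> #|[set x in X | adj r x]| <= J ->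
  exists v w C E, let F := w |: (C :\: E) in
  [/\ [/\ v \in X, w \in X, adj r v, adj r w & v != w],
      [/\ C \subset X :\ r, conn C, w \notin C & forall x, x \in C -> adj r x -> x = v],
      [/\ E \subset C, v \in E, conn E & forall x, x \in E -> adj w x -> x = v],
      conn F /\ (forall x e, x \in C :\: E -> e \in E -> adj x e -> adj w x)
    & #|Z0| <= 2 * J * #|att Z0 E| \/ #|Z0| <= 2 * J * #|att Z0 F| /\
        #|att Z0 E| < #|att Z0 F|].
Proof.
set N := [set x in X | adj r x] => N2 NJ.
have [v0 v0N] : exists v, v \in N by apply/set0Pn; rewrite -card_gt0 (ltnW N2).
have exv : exists2 v, v \in X & adj r v by exists v0; move: v0N; rewrite inE => /andP[].
have [v [C [[vX rv] sC [vC cC] uqC cntC]]] := heavy_nbr cX rX Z0X nZ0 exv.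
have vN : v \in N by rewrite inE vX.
have [w wN] : exists w, w \in N :\ v.
  by apply/set0Pn; rewrite -card_gt0; move: N2; rewrite (cardsD1 v) vN.
move: wN; rewrite !inE => /and3P[wv wX rw].
have wC : w \notin C by apply: contra wv => /uqC/(_ rw)->.
have [E [[sE vE cE] uqE cF bd]] := split_at cC vC wC.
exists v, w, C, E; split=> //; first by rewrite eq_sym.
set F := w |: (C :\: E).
have sZ : att Z0 C \subset att Z0 E :|: att Z0 F.
  apply/subsetP=> z /attP[zZ [x xC zx]]; rewrite in_setU; apply/orP.
  have [xE|xE] := boolP (x \in E); [left|right]; apply/attP; split=> //; exists x => //.
  by rewrite !inE xE xC orbT.
have le1 : #|Z0| <= J * (#|att Z0 E| + #|att Z0 F|).
  apply: leq_trans cntC _; apply: leq_mul => //.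
  by apply: leq_trans (subset_leq_card sZ) (leq_card_setU _ _).
have dbl (a b : nat) : a <= b -> J * (a + b) <= 2 * J * b.
  by move=> ab; rewrite [2 * J]mulnC -mulnA leq_mul2l mul2n -addnn leq_add2r ab orbT.
have [le|lt] := leqP #|att Z0 F| #|att Z0 E|; [left|right; split=> //].
  by apply: leq_trans le1 _; rewrite addnC dbl.
by apply: leq_trans le1 _; rewrite dbl // ltnW.
Qed.

Lemma claw_comb_branch : ~ has_C4 G ->
  (forall S, S \subset Y -> #|S| = 3 -> ~ tri D S) ->
  1 < #|[set x in X | adj r x]| ->
  [\/ big_comb (@claw_comb G) X Z r J, crowded D Y c | exists X' Z' r' y,
   [/\ X' \subset X :\ r /\ state D Y X' (r |: B) Z' r' y0,
       #|Z :\: att Z [set r]| <= 2 * J * (#|Z'| + c),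
       Z' \subset Z, y \in Z :\: Z'
     & forall T q, T \subset Z' -> claw_comb X' X' T (r' :: q) ->
         claw_comb X X (y |: T) [:: r, r' & q]]].
Proof.
move=> noC4 notri N2.
have [JN|NJ] := leqP J #|[set x in X | adj r x]|.
  by constructor 1; apply: claw_legs_star.
have [v [w [C [E [[vX wX rv rw vw] [sC cC wC uqC] [sE vE cE uqE] [cF bd] cnt]]]]] :=
  two_ways N2 (ltnW NJ).
have avw := root_nbrs_stable notri vX wX rv rw vw.
have vr : v != r by rewrite eq_sym adj_neq.
have wr : w != r by rewrite eq_sym adj_neq.
have [yv [Kv plv]] := private_leg_ex cX rX attX minX vX vr.
have [yw [Kw plw]] := private_leg_ex cX rX attX minX wX wr.
suff [h|h] : crowded D Y c \/ exists X' Z' r' y,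
   [/\ X' \subset X :\ r /\ state D Y X' (r |: B) Z' r' y0,
       #|Z :\: att Z [set r]| <= 2 * J * (#|Z'| + c),
       Z' \subset Z, y \in Z :\: Z'
     & forall T q, T \subset Z' -> claw_comb X' X' T (r' :: q) ->
         claw_comb X X (y |: T) [:: r, r' & q]].
- by constructor 2.
- by constructor 3.
case: cnt => [cnt|[cnt _]].
  apply: (claw_close (X' := E) plw wX rw _ cE vE rv _ _ _ cnt).
  - exact: subset_trans sE sC.
  - by move=> x xE; apply: uqC; apply: (subsetP sE).
  - by apply: contra wC; apply: (subsetP sE).
  - move=> x xE; apply/negP=> wx; have xv := uqE x xE wx.
    by rewrite adjC -xv wx in avw.
apply: (claw_close (X' := w |: (C :\: E)) plv vX rv _ cF (setU11 _ _) rw _ _ _ cnt).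
- rewrite subUset (subset_trans (subsetDl _ _) sC) andbT sub1set !inE wr wX //.
- move=> x; rewrite !inE => /orP[/eqP//|/andP[xE xC]] /(uqC x xC) xv.
  by rewrite xv vE in xE.
- by rewrite !inE negb_or vw vE.
move=> x; rewrite !inE => /orP[/eqP->//|/andP[xE xC]].
(* A neighbour [x] of [v] in [C] outside [E] borders [E], hence is adjacent to [w], and [r], [v],
   [x], [w] would be an induced cycle of length four. *)
apply/negP=> vx; have xCE : x \in C :\: E by rewrite inE xE.
have wx : adj w x by apply: (bd x v) => //; rewrite adjC.
have nrx : ~~ adj r x by apply: contra xE => /(uqC x xC)->.
have rx : r != x.
  by apply: contraTneq (subsetP sC x xC) => <-; rewrite !inE eqxx.
by apply: (C4_intro noC4 rx vw nrx avw rv vx); rewrite adjC.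
Qed.

(** Two terminals at the root would form a claw with the walked part. Hence a star at the root never
    arises on the triangle side. *)
Lemma tri_few_terminals : (forall S, S \subset Y -> #|S| = 3 -> ~ claw D S) ->
  #|att Z [set r]| <= 1.
Proof.
move=> noclaw; rewrite leqNgt; apply/negP=> /card_gt1P[z [z' [zT z'T zz']]].
have TZ a : a \in att Z [set r] -> [/\ a \in Z, a \in Y & adj a r].
  by case/attP=> aZ [x]; rewrite inE => /eqP-> ax; split=> //; apply: (subsetP sZY).
have [zZ zY zr] := TZ z zT; have [z'Z z'Y z'r] := TZ z' z'T.
have leg1 a : leg D a [set a].
  by split; [rewrite inE | apply: subsetUl | apply: conn1].
have rT a : a \in Z -> r \notin [set a].
  by move=> aZ; rewrite inE; apply: contraTneq rX => ->; apply: nX.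
have fB a : a \in Z -> far B [set a].
  by move=> aZ u v uB; rewrite inE => /eqP->; apply: fBZ.
have d3 : [/\ y0 != z, y0 != z' & z != z'] by split=> //; apply: y0Z.
case: (no3 noclaw y0Y zY z'Y d3).
apply: (@claw_intro _ D y0 z z' r B [set z] [set z'] d3 lB (leg1 z) (leg1 z')).
- exact: fB.
- exact: fB.
- by move=> u v; rewrite !inE => /eqP-> /eqP->; split=> //; apply: stY.
- exact: (subsetP sXD).
- exact: rB.
- exact: rT.
- exact: rT.
- exact: eB.
- by exists z; rewrite ?inE // adjC.
- by exists z'; rewrite ?inE // adjC.
Qed.

(** The neighbours of the root form a clique, so [J] bounds their number. Growth always continues in
    [E] from [v]: [w] sees both [r] and [v] and nothing else of [E], so its leg sits on the edge
    from [r] to [v]. *)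
Lemma tri_comb_branch t : (forall A : {set G}, clique A -> #|A| <> t) -> t <= J ->
  (forall S, S \subset Y -> #|S| = 3 -> ~ claw D S) ->
  1 < #|[set x in X | adj r x]| ->
  [\/ big_comb (@tri_comb G) X Z r J, crowded D Y c | exists X' Z' r' y,
   [/\ X' \subset X :\ r /\ state D Y X' (r |: B) Z' r' y0,
       #|Z :\: att Z [set r]| <= 2 * J * (#|Z'| + c),
       Z' \subset Z, y \in Z :\: Z'
     & forall T q, T \subset Z' -> tri_comb X' X' T (r' :: q) ->
         tri_comb X X (y |: T) [:: r, r' & q]]].
Proof.
move=> nocl tJ noclaw N2; set N := [set x in X | adj r x] in N2.
have NJ : #|N| <= J.
  apply: leq_trans tJ; rewrite leqNgt; apply/negP=> /ltnW/subset_of_card[A sA cA].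
  apply: (nocl A _ cA) => u v /(subsetP sA)+ /(subsetP sA).
  by rewrite !inE => /andP[uX ru] /andP[vX rv]; apply: root_nbrs_clique.
have [v [w [C [E [[vX wX rv rw vw] [sC cC wC uqC] [sE vE cE uqE] [cF bd] cnt]]]]] :=
  two_ways N2 NJ.
have avw := root_nbrs_clique noclaw vX wX rv rw vw.
have wr : w != r by rewrite eq_sym adj_neq.
have [y [K pl]] := private_leg_ex cX rX attX minX wX wr.
have sHZ A : att Z0 A \subset Z by apply: subset_trans (att_sub _ _) Z0Z.
have wC' A : A \subset C -> w \notin A by move=> sA; apply: contra wC; apply: (subsetP sA).
have sCX : C \subset X by apply: subset_trans sC (subsetDl _ _).
have cW : conn (r |: C) by apply: (conn_add cC (subsetP sE v vE)).
have sW : r |: C \subset X by rewrite subUset sub1set rX.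
have wW : w \notin r |: C by rewrite !inE negb_or wr.
have avoid u x : u \in w |: (y |: K) -> x \in C -> u != x /\ (adj u x -> u = w).
  move=> uL xC; apply: (leg_avoid dYD sZY sXD pl cW sW (setU11 _ _) wW uL).
  by rewrite inE xC orbT.
(* It remains to bound [Z0] by the terminals of [E] or by [c] alone, unless a crowded path
   appears. *)
suff [|cntE] : crowded D Y c \/ (#|Z0| <= 2 * J * #|att Z0 E| \/ #|Z0| <= 2 * J * c).
- by constructor 2.
- case: (thin_leg stY dYD sZY sXD c pl wX (sHZ E)) => [|[L [Z' [[lL wL sL _ _] [sZ' yZ' fL] cnt']]]].
    by constructor 2.
  constructor 3; exists E, Z', v, y.
  have sZ'Z : Z' \subset Z := subset_trans sZ' (sHZ E).
  have aZ' : attached Z' E by move=> z /(subsetP sZ'); apply: att_attached.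
  have nZ' z : z \in Z' -> ~~ adj r z.
    by move=> /(subsetP sZ')/(subsetP (att_sub _ _)); apply: nZ0.
  have sEX := subset_trans sE sC.
  have uq x : x \in E -> adj r x -> x = v by move=> xE; apply: uqC; apply: (subsetP sE).
  have [st' nr] := state_move dYD st sEX cE vE rv sZ'Z aZ' uq nZ'.
  split=> //.
  - case: cntE => cntE; apply: leq_trans cntE _; rewrite leq_mul2l ?cnt' ?orbT //.
    by rewrite leq_addl orbT.
  - by rewrite inE yZ'; case: pl.
  move=> T q sT cT.
  apply: (tri_comb_add nr sT cT _ lL wL).
  - by apply: contra yZ'; apply: (subsetP sT).
  - by move=> u z uL zT; apply: fL => //; apply: (subsetP sT).
  - move=> u x /(subsetP sL) uL xE.
    have [ne h] := avoid u x uL (subsetP sE x xE); split=> //.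
    apply/idP/andP => [ux|[/eqP-> /eqP->]]; last by rewrite adjC.
    by have uw := h ux; rewrite uw eqxx (uqE x xE) // -uw.
  move=> u /(subsetP sL) uL; have [ne h] := leg_root dYD sZY sXD rX pl wr uL; split=> //.
  by apply/idP/eqP => [/h//|->]; rewrite adjC.
(* If instead [F] sees most terminals, any of them that survives the thinning of the leg at [w], say
   [z], completes a claw centred at [w]: the legs lead back through the root, to [y], and through
   [C] outside [E] to [z]. *)
case: cnt => [|[cntF _]]; first by right; left.
case: (thin_leg stY dYD sZY sXD c pl wX (sHZ (w |: (C :\: E)))) =>
  [|[L [Z' [[lL wL sL lLw exw] [sZ' yZ' fL] cnt']]]]; first by left.
have [Z'0|[z zZ']] := set_0Vmem Z'.
  right; right; apply: leq_trans cntF _; rewrite leq_mul2l.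
  by move: cnt'; rewrite Z'0 cards0 add0n => ->; rewrite orbT.
have zZ0 : z \in Z0 by apply/(subsetP (att_sub _ _))/(subsetP sZ').
have zZ : z \in Z by apply: (subsetP Z0Z).
have [_ [x xF zx]] : z \in Z0 /\ exists2 x, x \in w |: (C :\: E) & adj z x.
  exact/attP/(subsetP sZ').
have xCE : x \in C :\: E.
  move: xF; rewrite in_setU1 => /orP[/eqP xw|//].
  by have [_] := fL w z wL zZ'; rewrite adjC -xw zx.
have [M [sM xM cM clM]] := comp_ex xCE.
have [u uM wu] : exists2 u, u \in M & adj w u.
  have [||u [u' [uM u'F u'M uu']]] := conn_edge cF _ _ (setU11 _ _) (wC' M (subset_trans sM (subsetDl _ _))).
  - by apply: subset_trans sM _; apply: subsetUr.
  - by apply/set0Pn; exists x.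
  move: u'F; rewrite in_setU1 => /orP[/eqP u'w|u'CE].
    by exists u; rewrite // adjC -u'w.
  by rewrite (clM u u' uM u'CE uu') in u'M.
have sMC : M \subset C := subset_trans sM (subsetDl _ _).
have yZ : y \in Z by case: pl.
have yz : y != z by apply: contraNneq yZ' => ->.
have d3 : [/\ y0 != y, y0 != z & y != z] by split=> //; apply: y0Z.
case: (no3 noclaw y0Y (subsetP sZY y yZ) (subsetP sZY z zZ) d3).
have MX b : b \in M -> b \in X :\ r by move=> /(subsetP sMC)/(subsetP sC).
have fLM : far (r |: B) (L :\ w).
  move=> a b aB /setD1P[bw /(subsetP sL) bL].
  have [ne ->] := root_cross pl wX rw aB bL.
  by rewrite negb_and bw orbT.
have lXD a A : leg X a A -> leg D a A.
  by case=> aA sA cA; split=> //; apply: subset_trans sA _; apply: setUS.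
apply: (@claw_intro _ D y0 y z w (r |: B) (L :\ w) (z |: M) d3 root_leg (lXD _ _ lLw)) => //.
- split; [exact: setU11 | | exact: conn_add xM zx].
  by apply: setUS; apply: subset_trans sXD; apply: subset_trans sCX.
- move=> a b aB; rewrite in_setU1 => /orP[/eqP->|bM].
    move: aB; rewrite in_setU1 => /orP[/eqP->|aB]; last exact: fBZ.
    by split; [apply: contraTneq rX => ->; apply: nX | apply: nZ0].
  move: aB; rewrite in_setU1 => /orP[/eqP->|aB]; last by apply: fBX => //; apply: MX.
  split; first by apply: contraTneq (MX b bM) => <-; rewrite !inE eqxx.
  apply/negP=> /(uqC b (subsetP sMC b bM)) bv.
  by have := subsetP sM b bM; rewrite bv inE vE.
- move=> a b /setD1P[aw aL]; rewrite in_setU1 => /orP[/eqP->|bM]; first exact: fL.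
  have [ne h] := avoid a b (subsetP sL a aL) (subsetP sMC b bM); split=> //.
  by apply/negP=> /h aw'; rewrite aw' eqxx in aw.
- exact: (subsetP sXD).
- rewrite in_setU1 negb_or wr; apply/negP=> wB.
  have [] := fBX wB (_ : w \in X :\ r); first by rewrite !inE wr.
  by rewrite eqxx.
- by rewrite !inE eqxx.
- rewrite in_setU1 negb_or (wC' M sMC) andbT; apply: contraTneq wX => ->; exact: nX.
- by exists r; [apply: setU11 | rewrite adjC].
- by exists u; rewrite // in_setU1 uM orbT.
Qed.

End Root.

End Branching.

(** * Crowded paths *)

Section OneSide.

Variable G : sgraph.
Implicit Types (a b d x y z r : G) (s p q : seq G).
Implicit Types (A B C D E K L M N S T W X Y Z : {set G}).

(** In a minimal connected set attached to all of [Y], a non-cut vertex [r] has a private terminal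
    [y0]; that terminal alone is the initial walked part. *)
Lemma init_state D Y : conn D -> attached Y D -> [disjoint Y & D] -> Y != set0 ->
  stable Y -> exists X r y0, state D Y X [set y0] (Y :\ y0) r y0.
Proof.
move=> cD aD dYD /set0Pn[z zY] stY.
have [|X [sX [cX aX] minX]] := @minimal_subset G (fun X => conn X /\ attached Y X) D.
  by [].
have nX y : y \in Y -> y \notin X.
  by move=> yY; apply: contraFN (disjointFr dYD yY); apply: (subsetP sX).
have st r y0 : r \in X -> y0 \in Y -> adj y0 r -> (forall x, x \in X -> adj y0 x -> x = r) ->
    state D Y X [set y0] (Y :\ y0) r y0.
  move=> rX y0Y y0r uq; split=> //.
  - by move=> y /setD1P[_ yY]; apply: aX.
  - exact: subsetDl.
  - by split=> //; split; [rewrite inE | apply: subsetUl | apply: conn1].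
  split.
  - move=> u v; rewrite inE => /eqP-> /setD1P[vr vX]; split.
      by apply: contraTneq vX => <-; apply: nX.
    by apply/negP=> /(uq v vX) vE; rewrite vE eqxx in vr.
  - by move=> u v; rewrite inE => /eqP-> /setD1P[vy vY]; rewrite eq_sym; split=> //; apply: stY.
  - by rewrite inE; apply: contraTneq rX => ->; apply: nX.
  - by exists y0; rewrite ?inE // adjC.
have [r0 r0X zr0] := aX z zY.
have [XE|Xr] := eqVneq X [set r0].
  exists X, r0, z; apply: st => // x; rewrite XE inE => /eqP.
  by [].
have [r rX cXr] := noncut_ex cX r0X Xr; move: rX => /setD1P[_ rX].
have [y0 y0Y ny0] : exists2 y, y \in Y & forall x, x \in X :\ r -> ~~ adj y x.
  apply: NNPP => no; apply: (minX (X :\ r)); first exact: properD1.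
  split=> // y yY; apply: NNPP => no'; apply: no; exists y => // x xX.
  by apply/negP=> yx; apply: no'; exists x.
have uq x : x \in X -> adj y0 x -> x = r.
  by move=> xX; apply: contraTeq => xr; apply: ny0; rewrite !inE xr.
exists X, r, y0; apply: st => //.
by have [x xX yx] := aX y0 y0Y; rewrite -(uq x xX yx).
Qed.

(** The bound on [Y] is strict to pay for the terminal [y0] spent at the start. *)
Lemma side_comb (comb : {set G} -> {set G} -> {set G} -> seq G -> Prop) D Y J c :
  0 < J -> conn D -> attached Y D -> [disjoint Y & D] -> stable Y ->
  (forall X r, r \in X -> comb X X set0 [:: r]) ->
  (forall X X' Z' r r' q T, new_root X X' Z' r r' ->
    T \subset Z' -> comb X' X' T (r' :: q) -> comb X X T [:: r, r' & q]) ->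
  (forall X B Z r y0, state D Y X B Z r y0 ->
    rooted_min X r Z -> J <= #|att Z [set r]| -> big_comb comb X Z r J) ->
  (forall X B Z r y0, state D Y X B Z r y0 ->
    rooted_min X r Z -> 1 < #|[set x in X | adj r x]| ->
    [\/ big_comb comb X Z r J, crowded D Y c | exists X' Z' r' y,
     [/\ X' \subset X :\ r /\ state D Y X' (r |: B) Z' r' y0,
         #|Z :\: att Z [set r]| <= 2 * J * (#|Z'| + c),
         Z' \subset Z, y \in Z :\: Z'
       & forall T q, T \subset Z' -> comb X' X' T (r' :: q) ->
           comb X X (y |: T) [:: r, r' & q]]]) ->
  (forall X X' T q, X \subset X' -> comb X X T q -> comb X' X' T q) ->
  weight J c J + c < #|Y| ->
  (exists T q, [/\ T \subset Y, J <= #|T| & comb D D T q]) \/ crowded D Y c.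
Proof.
move=> J0 cD aD dYD stY comb0 combP combS combB combW wY.
have [|X [r [y0 st]]] := init_state cD aD dYD _ stY.
  by rewrite -card_gt0; apply: leq_ltn_trans wY.
have [[sX _ _] _ sZ [_ y0Y] _] := st.
have wZ : weight J c J + c <= #|Y :\ y0| by move: wY; rewrite (cardsD1 y0) y0Y.
case: (comb_rec J0 dYD comb0 combP combS combB combW (ltnSn _) st (leqnn _) (leqnn _) wZ).
- move=> [T [q [sT JT cT]]]; left; exists T, (r :: q); split=> //.
    exact: subset_trans sT sZ.
  exact: combW cT.
- move=> [q [ip sq cq]]; right; exists (r :: q); split=> //.
    by move=> v /sq; apply: (subsetP sX).
  apply: leq_trans cq _; apply/subset_leq_card/subsetP=> z /attP[zZ ex].
  by apply/attP; split=> //; apply: (subsetP sZ).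
by right.
Qed.

Lemma claw_side D Y J c : ~ has_C4 G -> 0 < J -> conn D -> attached Y D ->
  [disjoint Y & D] -> stable Y ->
  (forall S, S \subset Y -> #|S| = 3 -> ~ tri D S) -> weight J c J + c < #|Y| ->
  (exists T q, [/\ T \subset Y, J <= #|T| & claw_comb D D T q]) \/ crowded D Y c.
Proof.
move=> noC4 J0 cD aD dYD stY notri.
apply: (@side_comb (@claw_comb G)) => //.
- move=> X r rX; exists (fun y => [set y]), (fun=> r); split=> //; try by move=> y; rewrite inE.
  by split=> // v; rewrite inE => /eqP->.
- move=> X X' Z' r r' q T nr sT cT; have [[sX _ _ _] _ _ _] := nr.
  exact: claw_comb_widen (subxx _) sX (claw_comb_prepend nr sT cT).
- by move=> X B Z r y0 st minX; apply: (claw_comb_star stY dYD st).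
- by move=> X B Z r y0 st minX; apply: (claw_comb_branch J c stY dYD st minX).
- by move=> X X' T q sX; apply: claw_comb_widen.
Qed.

Lemma tri_side D Y J c t : (forall A, clique A -> #|A| <> t) -> 1 < J -> t <= J ->
  conn D -> attached Y D -> [disjoint Y & D] -> stable Y ->
  (forall S, S \subset Y -> #|S| = 3 -> ~ claw D S) -> weight J c J + c < #|Y| ->
  (exists T q, [/\ T \subset Y, J <= #|T| & tri_comb D D T q]) \/ crowded D Y c.
Proof.
move=> nocl J1 tJ cD aD dYD stY noclaw.
apply: (@side_comb (@tri_comb G)) => //; first exact: ltnW.
- move=> X r rX; exists (fun y => [set y]), (fun=> r), (fun=> r), (fun=> r).
  split=> //; try by move=> y; rewrite inE.
    by split=> // v; rewrite inE => /eqP->.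
  by move=> y; rewrite in_set0.
- move=> X X' Z' r r' q T nr sT [L [a [x [x' tt]]]]; have [[sX _ _ _] _ _ _] := nr.
  by apply: (tri_comb_widen (subxx _) sX); exists L, a, x, x'; apply: tri_teeth_prepend nr sT tt.
- move=> X B Z r y0 st minX JT; have := tri_few_terminals stY dYD st noclaw.
  by rewrite leqNgt (leq_trans J1 JT).
- by move=> X B Z r y0 st minX; apply: (tri_comb_branch c stY dYD st minX nocl tJ noclaw).
- by move=> X X' T q sX; apply: tri_comb_widen.
Qed.

Lemma crowded_min D Y c : crowded D Y c -> exists q,
  [/\ ipath q, {subset q <= D}, c <= #|coll Y q|
    & forall q', ipath q' -> {subset q' <= D} -> size q' < size q -> #|coll Y q'| < c].
Proof.
case=> q; have [n] := ubnP (size q); elim: n q => // n IHn q ltq [ip sq cq].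
case: (classic (exists q', [/\ ipath q', {subset q' <= D}, size q' < size q & c <= #|coll Y q'|])).
  by move=> [q' [ip' sq' lt' cq']]; apply: (IHn q') => //; apply: leq_trans lt' _.
move=> no; exists q; split=> // q' ip' sq' lt'; rewrite ltnNge; apply/negP=> cq'.
by apply: no; exists q'.
Qed.

(** On a crowded path of minimum length, deleting either end loses a terminal, which therefore sees
    only that end. These two terminals turn the path into a link, unless it is a single vertex. *)
Lemma crowded_link D Y c : 0 < c -> stable Y -> [disjoint Y & D] -> crowded D Y c ->
  exists q, c <= #|coll Y q| /\ ((exists2 x, x \in D & q = [:: x]) \/
    exists y1 y2, [/\ y1 \in Y, y2 \in Y, y1 != y2 & link D y1 y2 q]).
Proof.
move=> c0 stY dYD /crowded_min[q [ip sq cq minq]]; exists q; split=> //.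
have priv q' : ipath q' -> {subset q' <= D} -> size q' < size q ->
    exists2 y, y \in coll Y q & y \notin coll Y q'.
  move=> ip' sq' lt'; apply/subsetPn; apply/negP=> /subset_leq_card le.
  by have := leq_trans cq le; rewrite leqNgt minq.
case: q ip sq cq minq priv => [|x q] ip sq cq minq priv.
  have [|v /attP[_ [w]]] := set0Pn (coll Y [::]) _; last by rewrite inE.
  by rewrite -card_gt0; apply: leq_trans c0 cq.
case/lastP: q ip sq cq minq priv => [|q w] ip sq cq minq priv.
  by left; exists x => //; apply: sq; rewrite mem_head.
right; have [ipt jx] : ipath (rcons q w) /\ joins [:: x] (rcons q w) by apply/ipath_cons.
have [ipi jw] : ipath (x :: q) /\ joins (x :: q) [:: w].
  by move: ip; rewrite -cats1 -cat_cons => /ipath_cat[].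
have [||y1 y1c y1n] := priv (rcons q w) ipt.
- by move=> v vq; apply: sq; rewrite inE vq orbT.
- by [].
have [||y2 y2c y2n] := priv (x :: q) ipi.
- by move=> v vq; apply: sq; rewrite -rcons_cons mem_rcons inE vq orbT.
- by rewrite /= size_rcons.
have adj1 v : v \in x :: rcons q w -> adj y1 v = (v == x).
  have [y1Y [u uq y1u]] : y1 \in Y /\ exists2 u, u \in [set v in x :: rcons q w] & adj y1 u by exact/attP.
  have h v' : v' \in rcons q w -> ~~ adj y1 v'.
    move=> v'q; apply: contra y1n => y1v; apply/attP; split=> //; exists v' => //.
    by rewrite inE.
  move: uq; rewrite inE inE => /orP[/eqP ux|uq]; last by have := h u uq; rewrite y1u.
  rewrite inE => /orP[/eqP->|vq]; first by rewrite -ux y1u eqxx.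
  rewrite (negPf (h v vq)); apply/esym/negbTE.
  by have [] := jx x v (mem_head _ _) vq; rewrite eq_sym.
have adj2 v : v \in x :: rcons q w -> adj y2 v = (v == w).
  have [y2Y [u uq y2u]] : y2 \in Y /\ exists2 u, u \in [set v in x :: rcons q w] & adj y2 u by exact/attP.
  have h v' : v' \in x :: q -> ~~ adj y2 v'.
    move=> v'q; apply: contra y2n => y1v; apply/attP; split=> //; exists v' => //.
    by rewrite inE.
  move: uq; rewrite inE -rcons_cons mem_rcons inE => /orP[/eqP ux|uq]; last by have := h u uq; rewrite y2u.
  rewrite mem_rcons inE => /orP[/eqP->|vq]; first by rewrite -ux y2u eqxx.
  rewrite (negPf (h v vq)); apply/esym/negbTE.
  by have [] := jw v w vq (mem_head _ _).
have [y1Y _] : y1 \in Y /\ exists2 u, u \in [set v in x :: rcons q w] & adj y1 u by exact/attP.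
have [y2Y _] : y2 \in Y /\ exists2 u, u \in [set v in x :: rcons q w] & adj y2 u by exact/attP.
have wq : w \in x :: rcons q w by rewrite inE mem_rcons mem_head orbT.
have y12 : y1 != y2.
  apply/eqP=> E; have := adj1 w wq; rewrite E adj2 // eqxx => /esym/eqP wx.
  by have [|] := jx x w (mem_head _ _); rewrite ?mem_rcons ?mem_head // wx eqxx.
have nD y v : y \in Y -> v \in x :: rcons q w -> y != v.
  move=> yY vq; apply: contraFneq (disjointFr dYD yY) => ->; exact: sq.
exists y1, y2; split=> //; split=> //; apply/ipath_cons; split.
  rewrite -cats1; apply/ipath_cat; split=> // u v uq; rewrite inE => /eqP->.
  rewrite eq_sym nD //; split=> //.
  by rewrite adjC adj2 //= eqxx andbT last_rcons.
move=> u v; rewrite inE => /eqP->; rewrite mem_rcons inE => /orP[/eqP->|vq].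
  split=> //; rewrite (negPf (stY y1 y2 y1Y y2Y)) /= eqxx /=.
  by apply/esym/negbTE; rewrite eq_sym eq_sym; apply: nD => //; rewrite mem_head.
by rewrite nD // adj1 //= eqxx.
Qed.

Lemma vertex_star D Y x : stable Y -> [disjoint Y & D] -> x \in D ->
  claw_comb D D (att Y [set x]) [:: x].
Proof.
move=> stY dYD xD; exists (fun y => [set y]), (fun=> x).
have TY z : z \in att Y [set x] -> z \in Y by apply: (subsetP (att_sub _ _)).
split.
- by split=> // v; rewrite inE => /eqP->.
- move=> y yT; split; [by rewrite inE | exact: subsetUl | exact: conn1].
- move=> y y' yT y'T yy' u v; rewrite !inE => /eqP-> /eqP->; split=> //.
  by apply: stY; apply: TY.
move=> y yT; split; first by rewrite inE.
  exists y; rewrite ?inE //; by case/attP: yT => _ [v]; rewrite inE => /eqP->.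
move=> u v; rewrite !inE => /eqP-> /eqP->; split=> //.
by apply: contraFneq (disjointFr dYD (TY y yT)) => ->.
Qed.

Lemma hangs_vertex D Y y1 y2 q y : stable Y -> [disjoint Y & D] ->
  y1 \in Y -> y2 \in Y -> y1 != y2 -> link D y1 y2 q -> y \in Y :\ y1 :\ y2 ->
  hangs D y1 y2 q y y [set y].
Proof.
move=> stY dYD y1Y y2Y y12 lk; rewrite !inE => /and3P[yy2 yy1 yY].
split=> //.
- by rewrite ![_ == y]eq_sym.
- by split; [rewrite inE | apply: subsetUl | apply: conn1].
- by rewrite inE.
move=> u v; rewrite inE => /eqP->; rewrite inE mem_rcons inE => /or3P[/eqP->|/eqP->|vq].
- by split=> //; rewrite (negPf (stY y y1 yY y1Y)).
- by split=> //; rewrite (negPf (stY y y2 yY y2Y)).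
split=> //; apply: contraFneq (disjointFr dYD yY) => ->; exact: lk.2.
Qed.

Lemma link_ipath D y1 y2 q : link D y1 y2 q -> ipath q.
Proof. by case; rewrite -cats1 -cat1s => /ipath_cat[_ /ipath_cat[]]. Qed.

(** Without claws every further terminal that sees the link sees exactly two consecutive vertices of
    it, so it is a tooth with a trivial leg. The [2] accounts for the ends of the link. *)
Lemma crowded_tri D Y c : 2 < c -> stable Y -> [disjoint Y & D] ->
  (forall S, S \subset Y -> #|S| = 3 -> ~ claw D S) -> crowded D Y c ->
  exists T q, [/\ T \subset Y, c - 2 <= #|T| & tri_comb D D T q].
Proof.
move=> c2 stY dYD noclaw /(crowded_link (ltnW (ltnW c2)) stY dYD)[q [cq]].
have leg1 a : leg D a [set a].
  by split; [rewrite inE | apply: subsetUl | apply: conn1].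
have nD y v : y \in Y -> v \in D -> y != v.
  by move=> yY vD; apply: contraFneq (disjointFr dYD yY) => ->.
have far1 y y' : y \in Y -> y' \in Y -> y != y' -> far [set y] [set y'].
  by move=> yY y'Y yy' u v; rewrite !inE => /eqP-> /eqP->; split=> //; apply: stY.
case=> [[x xD qE]|[y1 [y2 [y1Y y2Y y12 lk]]]].
  subst q; have /card_gt2P[z1 [z2 [z3 [[h1 h2 h3] [n12 n23 n31]]]]] := leq_trans c2 cq.
  have TY z : z \in coll Y [:: x] -> z \in Y /\ adj x z.
    by case/attP=> zY [v]; rewrite !inE => /eqP->; rewrite adjC.
  have [z1Y xz1] := TY _ h1; have [z2Y xz2] := TY _ h2; have [z3Y xz3] := TY _ h3.
  have d3 : [/\ z1 != z2, z1 != z3 & z2 != z3] by rewrite [z1 == z3]eq_sym.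
  case: (no3 noclaw z1Y z2Y z3Y d3).
  have [_ n13 _] := d3.
  apply: (@claw_intro _ D z1 z2 z3 x _ _ _ d3 (leg1 z1) (leg1 z2) (leg1 z3)) => //;
    try by apply: far1.
  - by rewrite inE eq_sym nD.
  - by rewrite inE eq_sym nD.
  - by rewrite inE eq_sym nD.
  - by exists z1; rewrite ?inE.
  - by exists z2; rewrite ?inE.
  - by exists z3; rewrite ?inE.
set T := coll Y q :\ y1 :\ y2.
have TY y : y \in T -> y \in Y :\ y1 :\ y2 /\ has (adj y) q.
  rewrite !in_setD1 => /and3P[-> -> /attP[-> [v]]]; rewrite inE => vq yv.
  by split=> //; apply/hasP; exists v.
have ipq := link_ipath lk.
have hg y : y \in T -> hangs D y1 y2 q y y [set y].
  by move=> /TY[yT _]; apply: (hangs_vertex stY).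
have no y : y \in T -> ~ claw D [set y1; y2; y].
  by move=> yT; have [d3 _ _ _ _] := hg y yT; apply: (no3 noclaw) => //;
     have [] := TY y yT; rewrite !inE => /and3P[].
have ex y : exists ab : G * G, y \in T -> exists u v,
    [/\ q = u ++ [:: ab.1, ab.2 & v], adj y ab.1 && adj y ab.2, ~~ has (adj y) u & ~~ has (adj y) v].
  have [yT|yT] := boolP (y \in T); last by exists (y, y).
  have [_ hq] := TY y yT.
  case: (nbr_cases ipq hq) => [[u [a [v [qE ya nu nv]]]]|[u [a [b [v [qE yab nu nv]]]]]|].
  - by case: (no y yT); apply: hang_single (hg y yT) qE ya nu nv.
  - by exists (a, b) => _; exists u, v.
  - case=> x [x' [xq x'q xx' axx' /andP[yx yx']]]; case: (no y yT).
    by apply: (hang_mid (hg y yT) xq x'q xx' axx' yx yx'); left.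
have [f Hf] := fin_all_exists ex.
have uq := ipath_uniq ipq.
exists T, q; split.
- by apply: subset_trans (subsetDl _ _) (subset_trans (subsetDl _ _) (att_sub _ _)).
- rewrite leq_subLR; apply: leq_trans cq _.
  rewrite (cardsD1 y1 (coll Y q)) (cardsD1 y2 (coll Y q :\ y1)) addnA leq_add2r.
  by case: (_ \in _); case: (_ \in _).
exists (fun y => [set y]), id, (fun y => (f y).1), (fun y => (f y).2).
have TY' y : y \in T -> y \in Y by move=> /TY[]; rewrite !inE => /and3P[].
split=> //.
- by split=> //; exact: lk.2.
- by move=> y y' /TY' yY /TY' y'Y; apply: far1.
- move=> y yT; have [u [v [qE /andP[ya yb] nu nv]]] := Hf y yT.
  have aq : (f y).1 \in q by rewrite qE mem_cat mem_head orbT.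
  have bq : (f y).2 \in q by rewrite qE mem_cat !inE eqxx !orbT.
  split=> //; first by rewrite inE.
    move: uq; rewrite {1}qE cat_uniq /= => /and4P[_ /norP[au /norP[bu _]]].
    rewrite inE => /norP[ab _] _.
    by rewrite qE !index_cat (negPf au) (negPf bu) /= eqxx (negPf ab) eqxx addn0 addn1.
  move=> x w; rewrite inE => /eqP-> wq; split; first by apply: nD; [apply: TY' | apply: lk.2].
  rewrite eqxx /=; apply/idP/orP => [yw|[]/eqP->//].
  move: wq; rewrite qE mem_cat !inE => /or4P[wu|/eqP->|/eqP->|wv]; [| by left | by right |].
    by case/hasP: nu; exists w.
  by case/hasP: nv; exists w.
(* Two terminals with the same first neighbour would give a claw centred there, its third leg
   running along the link to [y1]. *)
move=> y y' yT y'T E; apply/eqP; apply: contraT => yy'.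
have [u [v [qE /andP[ya yb] nu nv]]] := Hf y yT.
have [u' [v' [qE' /andP[ya' yb'] nu' nv']]] := Hf y' y'T.
have uu' : u = u'.
  have iE w s1 s2 : uniq q -> q = s1 ++ w :: s2 -> s1 = take (index w q) q.
    move=> uq' qw; rewrite qw index_cat /= eqxx addn0 take_size_cat //.
    by move: uq'; rewrite qw cat_uniq /= => /and3P[_ /norP[/negPf-> _] _].
  by rewrite (iE _ _ _ uq qE) (iE _ _ _ uq qE') E.
have yY := TY' y yT; have y'Y := TY' y' y'T.
have [[_ n1 _] _ _ _ _] := hg y yT; have [[_ n1' _] _ _ _ _] := hg y' y'T.
have d3 : [/\ y1 != y, y1 != y' & y != y'] by [].
have aq : (f y).1 \in q by rewrite qE mem_cat mem_head orbT.
case: (no3 noclaw y1Y yY y'Y d3).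
have lk' := lk; rewrite qE in lk'.
have fu z : z \in Y -> y1 != z -> ~~ has (adj z) u -> far [set w in y1 :: u] [set z].
  move=> zY y1z nz w w'; rewrite !inE => wu /eqP->; case/orP: wu => [/eqP->|wu].
    by split=> //; apply: stY.
  rewrite eq_sym nD //; last by apply: lk.2; rewrite qE mem_cat wu.
  by split=> //; apply: contra nz => wz; apply/hasP; exists w; rewrite // adjC.
have aD := lk.2 _ aq.
have := ipath_uniq lk'.1; rewrite /= rcons_cat cat_uniq mem_cat /= => /and4P[/norP[_ ay1] _ /norP[au _] _].
apply: (@claw_intro _ D y1 y y' (f y).1 [set w in y1 :: u] _ _ d3 (link_prefix lk') (leg1 y) (leg1 y')) => //.
- exact: fu.
- by apply: fu => //; rewrite uu'.
- exact: far1.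
- rewrite !inE negb_or au andbT; apply: contraNneq ay1 => <-; exact: mem_head.
- by rewrite inE eq_sym nD.
- by rewrite inE eq_sym nD.
- exists (last y1 u); first by rewrite inE mem_last.
  have := lk'.1; rewrite rcons_cat -cat_cons lastI cat_rcons => /ipath_consecutive.
  by rewrite adjC.
- by exists y; rewrite ?inE // adjC.
- by exists y'; rewrite ?inE // adjC // E.
Qed.

End OneSide.

(** * Threaded paths *)

Section Threads.

Variable G : sgraph.
Implicit Types (a b d x y z r : G) (s p q m u w : seq G).
Implicit Types (A B C D E K L N S T W X Y Z : {set G}).

Lemma theta_intro3 a b B1 B2 B3 : a != b -> ~~ adj a b ->
  [/\ a \in B1, b \in B1 & conn B1] -> [/\ a \in B2, b \in B2 & conn B2] ->
  [/\ a \in B3, b \in B3 & conn B3] ->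
  far (B1 :\: [set a; b]) (B2 :\: [set a; b]) ->
  far (B1 :\: [set a; b]) (B3 :\: [set a; b]) ->
  far (B2 :\: [set a; b]) (B3 :\: [set a; b]) -> has_theta G.
Proof.
move=> ab aab h1 h2 h3 f12 f13 f23.
apply: (theta_intro (B := fun i : 'I_3 => nth set0 [:: B1; B2; B3] i) ab aab).
  by case=> [[|[|[|]]]].
by case=> [[|[|[|//]]]] ? [[|[|[|//]]]] ? //= _; try exact: far_sym.
Qed.

(** The ends are [a] and [b]; the three paths run through [y], through [m], and around through the
    link on the other side. *)
Lemma two_nbrs_theta D1 D2 Y y1 y2 y u a m b w s : ~ has_theta G -> sides D1 D2 Y ->
  y1 \in Y -> y2 \in Y -> y \in Y -> [/\ y1 != y2, y1 != y & y2 != y] ->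
  link D1 y1 y2 (u ++ a :: m ++ b :: w) -> link D2 y1 y2 s -> m != [::] ->
  adj y a -> adj y b -> ~~ has (adj y) (u ++ m ++ w) -> ~~ has (adj y) s -> False.
Proof.
move=> noth [f n1 n2 st] y1Y y2Y yY [y12 y1y y2y] lk lk2 m0 ya yb nq ns.
have yD1 v : v \in D1 -> y != v by apply: contraTneq => <-; apply: n1.
have yD2 v : v \in D2 -> y != v by apply: contraTneq => <-; apply: n2.
have lka : link D1 y1 y2 (u ++ [:: a] ++ m ++ b :: w) by [].
have lkb : link D1 y1 y2 ((u ++ a :: m) ++ [:: b] ++ w) by rewrite -catA.
have lkm : link D1 y1 y2 (rcons u a ++ m ++ b :: w) by rewrite cat_rcons.
have fa := link_far lka isT; have fb := link_far lkb isT; have fm := link_far lkm m0.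
have inq v : v \in u ++ a :: m ++ b :: w -> v \in D1 by move=> /(lk.2).
have [ab aab] : a != b /\ ~~ adj a b.
  by apply: fm; rewrite !(inE, mem_rcons) eqxx ?orbT.
have hasN t v : ~~ has (adj y) t -> v \in t -> ~~ adj y v.
  by move=> nt vt; apply: contra nt => yv; apply/hasP; exists v.
move: nq; rewrite !has_cat !negb_or => /and3P[nu nm nw].
apply: noth.
apply: (@theta_intro3 a b (a |: (y |: [set b])) [set v in a :: rcons m b]
  (([set v in y1 :: rcons u a] :|: [set v in y1 :: rcons s y2]) :|:
    [set v in rcons (b :: w) y2])) => //.
- rewrite !inE !eqxx !orbT; split=> //.
  apply: (conn_add (u := y)); rewrite ?inE ?eqxx // 1?adjC //.
  by apply: (conn_add (u := b)); rewrite ?inE //; apply: conn1.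
- rewrite !(inE, mem_rcons) !eqxx !orbT; split=> //; apply: ipath_conn.
  have E : y1 :: rcons (u ++ a :: m ++ b :: w) y2 =
      (y1 :: u) ++ (a :: rcons m b) ++ rcons w y2.
    by rewrite rcons_cat /= rcons_cat /= cat_rcons.
  by have := lk.1; rewrite E => /ipath_cat[_ /ipath_cat[]].
- rewrite !(inE, mem_rcons) !eqxx !orbT; split=> //.
  have := (link_suffix (s1 := u ++ a :: m) lkb) => -[_ _ cb].
  have [_ _ ca] := link_prefix (s1 := rcons u a) lkm.
  have cs : conn [set v in y1 :: rcons s y2] by apply: ipath_conn; case: lk2.
  have c1 := @connU _ _ _ y1 y1 ca cs; have := @connU _ _ _ y2 y2 (c1 _ _ _) cb; apply;
    rewrite ?eqxx // !(inE, mem_rcons) eqxx ?orbT //.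
- move=> x v; rewrite !(inE, mem_rcons) !negb_or.
  case/andP=> /andP[xa xb]; rewrite (negPf xa) (negPf xb) orFb orbF => /eqP->.
  case/andP=> /andP[va vb]; rewrite (negPf va) (negPf vb) /= => vm.
  split; last exact: hasN vm.
  by apply: yD1; apply: inq; rewrite !(mem_cat, inE) vm !orbT.
- move=> x v; rewrite !(inE, mem_rcons) !negb_or.
  case/andP=> /andP[xa xb]; rewrite (negPf xa) (negPf xb) orFb orbF => /eqP->.
  case/andP=> /andP[va vb]; rewrite (negPf va) (negPf vb) /=.
  have e1 : y != y1 /\ ~~ adj y y1 by rewrite eq_sym; split=> //; apply: st.
  have e2 : y != y2 /\ ~~ adj y y2 by rewrite eq_sym; split=> //; apply: st.
  case/orP=> [/orP[/orP[/eqP->//|vu]|/or3P[/eqP->//|/eqP->//|vs]]|/orP[/eqP->//|vw]].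
  + split; last exact: hasN vu.
    by apply: yD1; apply: inq; rewrite !(mem_cat, inE) vu.
  + by split; [apply/yD2/(lk2.2) | apply: hasN vs].
  + split; last exact: hasN vw.
    by apply: yD1; apply: inq; rewrite !(mem_cat, inE) vw !orbT.
move=> x v; rewrite !(inE, mem_rcons) !negb_or.
case/andP=> /andP[xa xb]; rewrite (negPf xa) (negPf xb) /= => xm.
have xa' : x \in [set v in rcons (m ++ b :: w) y2] by rewrite !(inE, mem_rcons, mem_cat) xm !orbT.
have xb' : x \in [set v in y1 :: u ++ a :: m] by rewrite !(inE, mem_rcons, mem_cat) xm !orbT.
case/andP=> /andP[va vb]; rewrite (negPf va) (negPf vb) /=.
have e1 z : z \in [set v in y1 :: u] -> x != z /\ ~~ adj x z.
  by move=> zu; rewrite eq_sym adjC; apply: fa.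
have e2 z : z \in [set v in rcons w y2] -> x != z /\ ~~ adj x z by apply: fb.
case/orP=> [/orP[/orP[/eqP->|vu]|/or3P[/eqP->|/eqP->|vs]]|/orP[/eqP->|vw]].
- by apply: e1; rewrite !inE eqxx.
- by apply: e1; rewrite !inE vu orbT.
- by apply: e1; rewrite !inE eqxx.
- by apply: e2; rewrite !(inE, mem_rcons) eqxx.
- by apply: f; [apply: inq; rewrite !(mem_cat, inE) xm !orbT | apply: lk2.2].
- by apply: e2; rewrite !(inE, mem_rcons) eqxx.
- by apply: e2; rewrite !(inE, mem_rcons) vw orbT.
Qed.

(** The three neighbours in order, the consecutive pair first; [m] may be empty, and then all three
    are consecutive. The other orientation is obtained by reversing the path. *)
Definition edge_first_at q y u a b m d w :=
  [/\ q = u ++ [:: a, b & m ++ d :: w], adj y a, adj y b, adj y d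
    & ~~ has (adj y) (u ++ m ++ w)].

Definition edge_first q y := exists u a b m d w, edge_first_at q y u a b m d w.

(** Closing [q] by a link through [D2] gives a hole, in which a terminal with three neighbours on
    [q] has only these, two of them adjacent. Exactly two neighbours are impossible: consecutive
    ones give a triangle, nonadjacent ones a theta. *)
Lemma claw_nbrs D1 D2 Y y1 y2 y q : ~ has_theta G -> sides D1 D2 Y ->
  conn D2 -> attached Y D2 -> (forall y, y \in Y -> ~ Hub y) ->
  (forall S, S \subset Y -> #|S| = 3 -> ~ tri D1 S) ->
  y1 \in Y -> y2 \in Y -> y1 != y2 -> link D1 y1 y2 q -> y \in Y :\ y1 :\ y2 ->
  has (adj y) q ->
  [\/ exists2 a, a \in q /\ adj y a & forall v, v \in q -> adj y v -> v = a,
      edge_first q y | edge_first (rev q) y].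
Proof.
move=> noth sd cD2 aD2 nhub notri y1Y y2Y y12 lk yT hq.
have [f n1 n2 st] := sd.
have dYD : [disjoint Y & D1].
  by apply/pred0P=> v /=; apply/negP=> /andP[/n1 vn vD]; rewrite vD in vn.
have hg := hangs_vertex st dYD y1Y y2Y y12 lk yT.
have [d3 _ _ _ _] := hg; move: yT; rewrite !inE => /and3P[_ _ yY].
have ipq := link_ipath lk; have uq := ipath_uniq ipq.
have [s lk2] : exists s, link D2 y1 y2 s.
  have [x1 x1D y1x] := aD2 y1 y1Y; have [x2 x2D y2x] := aD2 y2 y2Y.
  have c2 : conn (y2 |: D2) := conn_add cD2 x2D y2x.
  have c1 : conn (y1 |: (y2 |: D2)) by apply: (conn_add c2 _ y1x); rewrite inE x1D orbT.
  have [|s ? _] := link_of_conn c1 (setU11 _ _) _ y12 (subxx _); last by exists s.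
  by rewrite !inE eqxx orbT.
have hH := hole_links sd y1Y y2Y y12 lk lk2; set H := _ :|: _ in hH.
have qH v : v \in q -> adj y v -> v \in nbrs_in H y.
  by move=> vq yv; rewrite !(inE, mem_rcons) vq yv !orbT.
have cardN l : uniq l -> {subset l <= q} -> all (adj y) l -> size l <= #|nbrs_in H y|.
  move=> ul lq /allP al; rewrite -(card_uniqP ul); apply/subset_leq_card/subsetP=> v vl.
  by apply: qH; [apply: lq | apply: al].
have nhy := nonhub_nbrs (nhub y yY) hH.
have [u [a [v [qE ya nu]]]] := split_first hq.
have aq : a \in q by rewrite qE mem_cat mem_head orbT.
have [/split_first[m [b [w [vE yb nm]]]]|nv] := boolP (has (adj y) v); last first.
  constructor 1; exists a => // z; rewrite qE mem_cat inE => /or3P[zu|/eqP->//|zv] yz.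
    by case/hasP: nu; exists z.
  by case/hasP: nv; exists z.
subst v.
have bq : b \in q by rewrite qE !(mem_cat, inE) eqxx !orbT.
have ab0 : m != [::] -> a != b /\ ~~ adj a b.
  move=> m0; have := @ipath_far _ (rcons u a) m (b :: w); rewrite cat_rcons -qE => /(_ ipq m0 a b).
  by rewrite !inE mem_rcons mem_head eqxx => /(_ isT isT).
have midab : m != [::] -> mid D1 y1 y2 y.
  by move=> /ab0[ab aab]; exists q; split=> //; exists a, b; rewrite ya yb.
have [/split_first[m' [d [w' [wE yd nm']]]]|nw] := boolP (has (adj y) w); last first.
  have [m0|m0] := eqVneq m [::].
    subst m; case: (no3 notri y1Y y2Y yY d3).
    by apply: (hang_pair hg qE ya yb nu nw).
  case: (two_nbrs_theta (u := u) (a := a) (m := m) (b := b) (w := w) noth sd y1Y y2Y yY d3 _ lk2 m0 ya yb) => //.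
  - by rewrite -qE.
  - by rewrite !has_cat (negPf nu) (negPf nm).
  (* A neighbour on the link through [D2] would make [y] a hub. *)
  apply/hasP=> -[z zs yz].
  exact: (hub_mid sd y1Y y2Y y12 (nhub y yY) (midab m0) lk2 zs yz).
subst w.
have dq : d \in q by rewrite qE !(mem_cat, inE) eqxx !orbT.
have qE' : q = (u ++ a :: m) ++ b :: m' ++ d :: w' by rewrite -catA.
have ad0 : a != d /\ ~~ adj a d.
  have := @ipath_far _ (rcons u a) (m ++ b :: m') (d :: w'); rewrite cat_rcons -!catA -qE.
  move=> /(_ ipq _ a d); rewrite !inE mem_rcons mem_head eqxx; apply=> //.
  by case: (m).
have bd0 : m' != [::] -> b != d /\ ~~ adj b d.
  move=> m0; have := @ipath_far _ (rcons (u ++ a :: m) b) m' (d :: w').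
  rewrite cat_rcons -qE' => /(_ ipq m0 b d).
  by rewrite !inE mem_rcons mem_head eqxx => /(_ isT isT).
have uabd : uniq [:: a; b; d].
  have := uq; rewrite qE cat_uniq /= => /and4P[_ _ + _].
  rewrite !(mem_cat, inE) !negb_or => /and5P[_ ab _ ad _].
  have := uq; rewrite qE' cat_uniq /= => /and4P[_ _ + _].
  rewrite !(mem_cat, inE) !negb_or => /and3P[_ bd _].
  by rewrite /= ?inE ?negb_or ?ab ?ad ?bd.
have sabd : {subset [:: a; b; d] <= q} by move=> z; rewrite !inE => /or3P[]/eqP->.
have aabd : all (adj y) [:: a; b; d] by rewrite /= ya yb yd.
have [N3 [x [x' [xN x'N xx']]]] := nhy (cardN _ uabd sabd aabd).
have NE : nbrs_in H y =i [:: a; b; d].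
  apply/fsym; apply/subset_cardP; first by rewrite N3 (card_uniqP uabd).
  by apply/subsetP=> z zl; apply: qH; [apply: sabd | apply: (allP aabd)].
have nw' : ~~ has (adj y) w'.
  apply/negP=> /hasP[z zw yz]; have zq : z \in q by rewrite qE !(mem_cat, inE) zw !orbT.
  have := qH z zq yz; rewrite NE !inE => /or3P[]/eqP zE; subst z; move: uq.
  - by rewrite qE cat_uniq /= !(mem_cat, inE) zw !orbT /= !andbF.
  - by rewrite qE' cat_uniq /= !(mem_cat, inE) zw !orbT /= !andbF.
  have -> : q = (u ++ a :: m ++ b :: m') ++ d :: w' by rewrite qE -!catA /= -catA.
  by rewrite cat_uniq /= zw !andbF.
have [m0|m0] := eqVneq m [::].
  subst m; constructor 2; exists u, a, b, m', d, w'; split=> //.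
  by rewrite !has_cat (negPf nu) (negPf nm').
have [m'0|m'0] := eqVneq m' [::].
  subst m'; constructor 3; exists (rev w'), d, b, (rev m), a, (rev u); split=> //.
    rewrite qE rev_cat rev_cons rev_cat rev_cons rev_cons -!cats1 -!catA /=.
    by [].
  by rewrite !has_cat !has_rev (negPf nu) (negPf nm) (negPf nw').
have [ab aab] := ab0 m0; have [bd abd] := bd0 m'0; have [ad aad] := ad0.
move: xN x'N xx'; rewrite !NE !inE => /or3P[]/eqP-> /or3P[]/eqP->;
  rewrite ?adjxx ?(negPf aab) ?(negPf abd) ?(negPf aad) //;
  by rewrite adjC ?(negPf aab) ?(negPf abd) ?(negPf aad).
Qed.

(** The triangle is [a], [b], [y]: the leg of [y1] runs up to [a], that of [y'] from its first
    neighbour in [m] back to [b], and [y] is a trivial leg. On the claw side this excludes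
    interleaved neighbourhoods. *)
Lemma edge_first_gap D Y y1 y2 q y y' u a b m d w : stable Y -> [disjoint Y & D] ->
  y1 \in Y -> y2 \in Y -> y1 != y2 -> link D y1 y2 q ->
  y \in Y :\ y1 :\ y2 -> y' \in Y :\ y1 :\ y2 -> y != y' ->
  edge_first_at q y u a b m d w -> ~~ has (adj y') (u ++ [:: a; b]) -> has (adj y') m ->
  tri D [set y1; y'; y].
Proof.
move=> stY dYD y1Y y2Y y12 lk yT y'T yy' [qE ya yb yd nq] ny' /split_first[m1 [x [m2 [mE y'x nm1]]]].
have [[_ y1y _] _ lgy _ hgy] := hangs_vertex stY dYD y1Y y2Y y12 lk yT.
have [[_ y1y' _] _ lgy' _ hgy'] := hangs_vertex stY dYD y1Y y2Y y12 lk y'T.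
move: yT y'T; rewrite !inE => /and3P[_ _ yY] /and3P[_ _ y'Y].
have y1n v : v \in q -> y1 != v by move=> /(lk.2) vD; apply: contraFneq (disjointFr dYD y1Y) => ->.
have d3 : [/\ y1 != y', y1 != y & y' != y] by rewrite [y' == y]eq_sym.
pose q2 := b :: rcons m1 x.
have qE2 : q = rcons u a ++ q2 ++ (m2 ++ d :: w).
  by rewrite /q2 /= cat_rcons cat_rcons qE mE -catA.
have lk' := lk; rewrite qE2 in lk'.
have [ip1 ip2 j12] : [/\ ipath (y1 :: rcons u a), ipath q2 & joins (y1 :: rcons u a) q2].
  have := lk'.1; rewrite rcons_cat -cat_cons rcons_cat => /ipath_cat[i1 /ipath_cat[i2 _ _] j].
  split=> // v v' h1 h2; have [|ne ->] := j v v' h1; first by rewrite mem_cat h2.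
  by split=> //; case: (q2) h2.
have q2q v : v \in q2 -> v \in q by move=> h; rewrite qE2 !mem_cat h orbT.
have q1q v : v \in rcons u a -> v \in q by move=> h; rewrite qE2 !mem_cat h.
have xq2 : x \in q2 by rewrite inE mem_rcons mem_head orbT.
move: nq; rewrite !has_cat !negb_or => /and3P[nu nm nw].
have yq2 v : v \in q2 -> adj y v = (v == b).
  rewrite !inE mem_rcons inE => vq; apply/idP/eqP => [|->//]; case/or3P: vq => [/eqP->//|/eqP->|vm] yv.
    by case/hasP: nm; exists x; rewrite // mE mem_cat mem_head orbT.
  by case/hasP: nm; exists v; rewrite // mE mem_cat vm.
have nb v z : v \in Y -> z \in q -> v != z.
  by move=> vY /(lk.2) zD; apply: contraFneq (disjointFr dYD vY) => ->.
have far' v : v \in y1 :: rcons u a -> ~~ adj y' v.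
  rewrite inE mem_rcons inE => /or3P[/eqP->|/eqP->|vu]; first exact: stY.
    by apply: contra ny' => y'a; apply/hasP; exists a; rewrite // mem_cat mem_head orbT.
  by apply: contra ny' => y'v; apply/hasP; exists v; rewrite // mem_cat vu.
apply: (@tri_intro _ D y1 y' y a b y [set v in y1 :: rcons u a] (y' |: [set v in q2]) [set y] d3
  (link_prefix lk')) => //.
- split; first exact: setU11.
    apply: setUS; apply/subsetP=> v; rewrite inE => /q2q; exact: lk.2.
  by apply: (conn_add (u := x)) => //; [apply: ipath_conn | rewrite inE].
- by rewrite inE in_cons mem_rcons mem_head orbT.
- by rewrite !inE eqxx orbT.
- by rewrite inE.
- move=> v z; rewrite inE => vA; rewrite in_setU1 => /orP[/eqP->|].
    rewrite adjC (negPf (far' v vA)); split.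
      move: vA; rewrite inE => /orP[/eqP->//|vA]; rewrite eq_sym.
      exact: nb (q1q v vA).
    by apply/esym/negbTE; rewrite negb_and; apply/orP; right; apply: nb; rewrite // q2q // mem_head.
  rewrite inE => zq; have [ne ->] := j12 v z vA zq; split=> //.
  by rewrite /= last_rcons.
- move=> v z; rewrite inE => vA; rewrite inE => /eqP->; rewrite eqxx andbT.
  move: vA; rewrite inE mem_rcons inE => /or3P[/eqP->|/eqP->|vu].
  + split=> //; rewrite (negPf (stY y1 y y1Y yY)); apply/esym/negbTE.
    by apply: y1n; rewrite q1q // mem_rcons mem_head.
  + by rewrite eq_sym nb ?eqxx 1?adjC // q1q // mem_rcons mem_head.
  have vq : v \in q by rewrite q1q // mem_rcons inE vu orbT.
  rewrite eq_sym nb //; split=> //; rewrite adjC.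
  have -> : adj y v = false by apply/negbTE; apply: contra nu => yv; apply/hasP; exists v.
  apply/esym/negbTE; have := ipath_uniq ip1; rewrite /= rcons_uniq => /and3P[_ au _].
  by apply: contraNneq au => <-.
move=> v z /setU1P vA /set1P->; rewrite eqxx andbT.
case: vA => [->|].
  split; first by rewrite eq_sym.
  rewrite (negPf (stY y' y y'Y yY)); apply/esym/negbTE.
  by apply: nb; rewrite // q2q // mem_head.
by rewrite inE => vq; rewrite eq_sym nb ?q2q // adjC yq2.
Qed.

Lemma split_suffix (P : pred G) s q u a v : s ++ q = u ++ a :: v -> P a -> ~~ has P s ->
  exists u', u = s ++ u' /\ q = u' ++ a :: v.
Proof.
elim: s u => [|x s IH] u /=; first by move=> -> _ _; exists u.
case: u => [|x' u] /= [-> E] Pa /norP[nx ns]; first by rewrite Pa in nx.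
by have [u' [-> ->]] := IH u E Pa ns; exists u'.
Qed.

Lemma edge_first_suffix s q y : edge_first (s ++ q) y -> ~~ has (adj y) s -> edge_first q y.
Proof.
move=> [u [a [b [m [d [w [qE ya yb yd nq]]]]]]] ns.
have [u' [uE qE']] := split_suffix qE ya ns.
exists u', a, b, m, d, w; split=> //.
by move: nq; rewrite uE -catA has_cat negb_or => /andP[].
Qed.

Definition before q y y' := forall v v', v \in q -> v' \in q -> adj y v -> adj y' v' ->
  index v q < index v' q.

(** A rerouting of [q] through all of [T]. Keeping the first vertex of [q] allows pieces to be
    joined; the order is claimed only for terminals whose neighbourhoods are separated along [q]. *)
Definition threads q T q' :=
  [/\ ipath q', {subset q' <= [set v in q] :|: T}, {subset T <= q'},
      forall v, head v q' = head v q
    & forall y y', y \in T -> y' \in T -> y != y' -> before q y y' -> index y q' < index y' q'].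

Lemma index_prefix s q v v' : uniq (s ++ q) -> v \in s -> v' \in q ->
  index v (s ++ q) < index v' (s ++ q).
Proof.
rewrite cat_uniq => /and3P[_ /hasPn ns _] vs v'q.
rewrite !index_cat vs (negPf (ns v' v'q)).
by apply: leq_trans (leq_addr _ _); rewrite index_mem.
Qed.

Lemma index_suffix s q v v' : uniq (s ++ q) -> v \in q -> v' \in q ->
  (index v (s ++ q) < index v' (s ++ q)) = (index v q < index v' q).
Proof.
rewrite cat_uniq => /and3P[_ /hasPn ns _] vq v'q.
by rewrite !index_cat (negPf (ns v vq)) (negPf (ns v' v'q)) ltn_add2l.
Qed.

End Threads.

(** * Threading a path through its terminals *)

Section Selection.

Variable G : sgraph.
Implicit Types (a b d x y z r : G) (s p q m u w : seq G).
Implicit Types (A B C D E K L N S T W X Y Z : {set G}).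

(** Take [y] with the earliest first neighbour and discard the at most [3 * J] terminals that see
    [a], [b] or [d]. The others see nothing up to [d]: nothing in [u] by the choice of [y], nothing
    in [m] by the gap hypothesis. The rest of the path, starting at [d], is handled by induction,
    and [y] is threaded by going from [a] over [y] to [d]. *)
Lemma select_threads J n q T : 0 < J -> stable T -> ipath q ->
  (forall v, v \in q -> v \notin T) -> (forall y, y \in T -> edge_first q y) ->
  (forall y y' u a b m d w, y \in T -> y' \in T -> y != y' ->
     edge_first_at q y u a b m d w -> ~~ has (adj y') (u ++ [:: a; b]) -> ~~ has (adj y') m) ->
  (forall v, v \in q -> #|att T [set v]| <= J) -> 3 * J * n <= #|T| ->
  exists T', [/\ T' \subset T, n <= #|T'|,
    forall y y', y \in T' -> y' \in T' -> y != y' -> before q y y' \/ before q y' y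
  & forall T'', T'' \subset T' -> exists q', threads q T'' q'].
Proof.
move=> J0; elim: n q T => [|n IHn] q T stT ip nT le gap bnd cT.
  exists set0; rewrite sub0set cards0; split=> //; first by move=> y y'; rewrite inE.
  move=> T''; rewrite subset0 => /eqP->; exists q; split=> //.
  - by move=> v vq; rewrite !inE vq.
  - by move=> v; rewrite inE.
  - by move=> y y'; rewrite inE.
have [y0 y0T] : exists y, y \in T.
  by apply/set0Pn; rewrite -card_gt0; apply: leq_trans cT; rewrite !muln_gt0 J0.
case: (arg_minnP (fun y => find (adj y) q) y0T) => y yT0 miny {y0 y0T}.
have {yT0} yT : y \in T by [].
have [u [a [b [m [d [w at_y]]]]]] := le y yT; have [qE ya yb yd ny] := at_y.
move: ny; rewrite !has_cat !negb_or => /and3P[nyu nym nyw].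
pose T2 := T :\: (att T [set a] :|: att T [set b] :|: att T [set d]).
have T2T : T2 \subset T := subsetDl _ _.
have qE3 : q = (u ++ [:: a, b & m]) ++ d :: w by rewrite -catA.
have aq : a \in q by rewrite qE mem_cat mem_head orbT.
have bq : b \in q by rewrite qE !(mem_cat, inE) eqxx !orbT.
have dq : d \in q by rewrite qE !(mem_cat, inE) eqxx !orbT.
have uq := ipath_uniq ip.
have nadj z v : z \in T2 -> v \in [:: a; b; d] -> ~~ adj z v.
  move=> /setDP[zT]; rewrite !in_setU !negb_or => /andP[/andP[za zb] zd].
  have h x : z \notin att T [set x] -> ~~ adj z x.
    by apply: contra => zx; apply/attP; split=> //; exists x; rewrite ?inE.
  by rewrite !inE => /or3P[]/eqP->; apply: h.
have n2 z : z \in T2 -> ~~ has (adj z) (u ++ [:: a, b & m]).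
  move=> zT2; have zT := subsetP T2T z zT2.
  have zy : y != z by apply: contraTneq ya => ->; apply: (nadj z a zT2); rewrite inE eqxx.
  have nu : ~~ has (adj z) u.
    have := miny z zT; rewrite qE !find_cat (negPf nyu) /= ya addn0.
    case: ifP => // hu; rewrite leqNgt => /negP[]; by rewrite -has_find.
  have nab : ~~ has (adj z) [:: a; b] by rewrite /= !negb_or !nadj // !inE eqxx ?orbT.
  have := gap y z u a b m d w yT zT zy at_y; rewrite has_cat (negPf nu) => /(_ nab) nm.
  rewrite has_cat (negPf nu) /= !negb_or nm andbT /=.
  by rewrite !nadj // !inE eqxx ?orbT.
have inw z v : z \in T2 -> v \in q -> adj z v -> v \in w.
  move=> zT2; rewrite qE3 mem_cat inE => /or3P[vP|/eqP->|//] zv.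
    by case/hasP: (n2 z zT2); exists v.
  by have := nadj z d zT2; rewrite !inE eqxx !orbT zv => /(_ isT).
have ipP : [/\ ipath (u ++ [:: a, b & m]), ipath (d :: w) & joins (u ++ [:: a, b & m]) (d :: w)].
  by apply/ipath_cat; rewrite -qE3.
have [ip1 ip2 j12] := ipP.
have dwq v : v \in d :: w -> v \in q by move=> vw; rewrite qE3 mem_cat vw orbT.
have Pq v : v \in u ++ [:: a, b & m] -> v \in q by move=> vw; rewrite qE3 mem_cat vw.
have cT2 : 3 * J * n <= #|T2|.
  have cU : #|att T [set a] :|: att T [set b] :|: att T [set d]| <= 3 * J.
    apply: leq_trans (leq_card_setU _ _) _.
    apply: leq_trans (leq_add (leq_card_setU _ _) (leqnn _)) _.
    by rewrite !mulSn addn0 addnA !leq_add // bnd.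
  have := cT; rewrite mulnS -(cardsID (att T [set a] :|: att T [set b] :|: att T [set d]) T).
  have := subset_leq_card (subsetIr T (att T [set a] :|: att T [set b] :|: att T [set d])).
  rewrite -/T2 => h1 h2; rewrite -(leq_add2l (3 * J)); apply: leq_trans h2 _.
  by rewrite leq_add2r; apply: leq_trans h1 cU.
have [||v vw|z zT2|z z' u' a' b' m' d' w' zT2 z'T2 zz' atz nz'|v vw||T' [sT' nT' sep thr]] := IHn (d :: w) T2.
- by move=> z z' zT2 z'T2; apply: stT; apply: (subsetP T2T).
- by [].
- by apply: contra (nT v (dwq v vw)); apply: (subsetP T2T).
- by apply: (@edge_first_suffix G (u ++ [:: a, b & m])); rewrite -?qE3; [apply/le/(subsetP T2T) | apply: n2].
- apply: (gap z z' ((u ++ [:: a, b & m]) ++ u') a' b' m' d' w') => //; try exact: (subsetP T2T).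
    have [E za zb zd nz] := atz; split=> //; first by rewrite qE3 E -!catA.
    by rewrite -!catA catA has_cat negb_or n2 // catA.
  by rewrite -catA has_cat negb_or n2.
- apply: leq_trans (bnd v (dwq v vw)); apply/subset_leq_card/subsetP=> z /attP[zT2 ex].
  by apply/attP; split=> //; apply: (subsetP T2T).
- exact: cT2.
have T'T2 z : z \in T' -> z \in T2 by apply: (subsetP sT').
have yT2 : y \notin T2.
  have yA : y \in att T [set a] by apply/attP; split=> //; exists a; rewrite ?inE.
  by apply/negP=> /setDP[_]; rewrite !in_setU yA.
have yT' : y \notin T' by apply: contra yT2; apply: T'T2.
have yq : y \notin q by apply/negP=> yq; have /negP := nT y yq; apply.
have ybef z : z \in T' -> before q y z.
  move=> zT' v v' vq v'q yv zv'; have v'w := inw z v' (T'T2 z zT') v'q zv'.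
  have qE4 : q = (u ++ [:: a, b & m ++ [:: d]]) ++ w by rewrite qE -catA /= -catA.
  rewrite qE4; apply: index_prefix; rewrite -?qE4 //.
  move: vq; rewrite qE4 mem_cat => /orP[//|vw]; by case/hasP: nyw; exists v.
have hasnbr z : z \in T2 -> exists2 v, v \in q & adj z v.
  move=> zT2; have [u' [a' [b' [m' [d' [w' [E za _ _ _]]]]]]] := le z (subsetP T2T z zT2).
  by exists a'; rewrite // E mem_cat mem_head orbT.
exists (y |: T'); split.
- by rewrite subUset sub1set yT (subset_trans sT' T2T).
- by rewrite cardsU1 yT'.
- move=> z z'; rewrite !in_setU1 => /orP[/eqP->|zT] /orP[/eqP->|z'T] zz'.
  + by rewrite eqxx in zz'.
  + by left; apply: ybef.
  + by right; apply: ybef.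
  have lift x x' : x \in T' -> x' \in T' -> before (d :: w) x x' -> before q x x'.
    move=> xT x'T bf v v' vq v'q xv x'v'.
    have vw : v \in d :: w by rewrite inE (inw x v (T'T2 x xT) vq xv) orbT.
    have v'w : v' \in d :: w by rewrite inE (inw x' v' (T'T2 x' x'T) v'q x'v') orbT.
    by rewrite qE3 index_suffix -?qE3 //; apply: bf.
  by case: (sep z z' zT z'T zz') => bf; [left|right]; apply: lift.
move=> T'' sT''.
have [|q' [ipq' sq' sTq' hd ord]] := thr (T'' :\ y).
  by apply/subsetP=> z /setD1P[zy /(subsetP sT'')]; rewrite in_setU1 (negPf zy).
have T''T' z : z \in T'' -> z != y -> z \in T'.
  by move=> /(subsetP sT''); rewrite in_setU1 => /orP[/eqP->|//]; rewrite eqxx.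
have q'0 : q' != [::].
  by case: (q') hd => // /(_ a) /= E; move: uq; rewrite qE cat_uniq /= -E !(inE, mem_cat) eqxx !orbT /= !andbF.
have q'in v : v \in q' -> v \in d :: w \/ v \in T'' :\ y.
  by move=> /sq'; rewrite inE inE => /orP[]; [left|right].
have hd' v : head v q' = d by rewrite hd.
have restr x x' : before q x x' -> before (d :: w) x x'.
  move=> bf v v' vw v'w xv x'v'; have := bf v v' (dwq v vw) (dwq v' v'w) xv x'v'.
  by rewrite qE3 index_suffix -?qE3.
have nPT v z : v \in u ++ [:: a, b & m] -> z \in T'' :\ y -> v != z /\ ~~ adj v z.
  move=> vP /setD1P[zy zT'']; have zT2 := T'T2 z (T''T' z zT'' zy).
  split; first by apply: contraNneq (nT v (Pq v vP)) => ->; apply: (subsetP T2T).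
  by rewrite adjC; apply: contra (n2 z zT2) => zv; apply/hasP; exists v.
have dT z : z \in T'' :\ y -> (z == d) = false.
  move=> /setD1P[zy zT'']; apply/negbTE; apply: contraTneq (subsetP T2T z (T'T2 z (T''T' z zT'' zy))) => ->.
  exact: nT.
have order s : uniq (s ++ q') -> (y \in T'' -> y \in s) -> forall z z', z \in T'' -> z' \in T'' ->
    z != z' -> before q z z' -> index z (s ++ q') < index z' (s ++ q').
  move=> us ys z z' zT z'T zz' bf.
  have [z'y|z'y] := eqVneq z' y.
    have zT' : z \in T' by apply: T''T'; rewrite // -z'y.
    have [v vq zv] := hasnbr z (T'T2 z zT').
    rewrite z'y in bf; have := bf v a vq aq zv ya; have := ybef z zT' a v aq vq ya zv.
    by move=> /ltnW; rewrite leqNgt => /negPf->.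
  have z'q : z' \in q' by apply: sTq'; rewrite !inE z'y.
  have [zy|zy] := eqVneq z y; first by apply: index_prefix => //; rewrite zy; apply: ys; rewrite -zy.
  have zq : z \in q' by apply: sTq'; rewrite !inE zy.
  rewrite index_suffix //; apply: ord => //; rewrite ?inE ?zy ?z'y //.
  exact: restr.
(* If [y] is not among the terminals to be threaded, the path keeps its original stretch up to
   [d]. *)
have [yT''|yT''] := boolP (y \in T''); last first.
  exists ((u ++ [:: a, b & m]) ++ q').
  have ipn : ipath ((u ++ [:: a, b & m]) ++ q').
    apply/ipath_cat; split=> // v v' vP /q'in[v'w|v'T].
      have [ne ->] := j12 v v' vP v'w; split=> //.
      by rewrite (head_indep v v (mem_head d w)) hd'.
    by have [ne /negPf->] := nPT v v' vP v'T; rewrite hd' dT // andbF.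
  split=> //.
  - move=> v; rewrite mem_cat inE inE => /orP[/Pq->//|/q'in[/dwq->//|/setD1P[_ ->]]].
    by rewrite orbT.
  - move=> z zT; rewrite mem_cat sTq' ?orbT // !inE zT andbT.
    by apply: contraNneq yT'' => <-.
  - by move=> v; rewrite qE; case: (u).
  - by apply: order; [apply: ipath_uniq | rewrite (negPf yT'')].
have ua : ipath (u ++ [:: a]) by move: ip1; rewrite -cat_rcons -cats1 => /ipath_cat[].
have fua : far [set v in u ++ [:: a]] [set v in d :: w].
  by apply: (@ipath_far _ _ (b :: m)); rewrite // -!catA /= -qE.
have ipn : ipath ((u ++ [:: a; y]) ++ q').
  apply/ipath_cat; split=> //.
    rewrite -[[:: a; y]]/([:: a] ++ [:: y]) catA; apply/ipath_cat; split=> //.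
    move=> v v'; rewrite inE => vu /eqP->; split.
      by apply: contraNneq yq => <-; apply: Pq; move: vu; rewrite !mem_cat !inE => /orP[->//|->]; rewrite orbT.
    rewrite /= eqxx andbT last_cat /=; move: vu; rewrite mem_cat inE => /orP[vu|/eqP->].
      rewrite adjC; have -> : adj y v = false.
        by apply/negbTE; apply: contra nyu => yv; apply/hasP; exists v.
      apply/esym/negbTE; move: uq; rewrite qE cat_uniq /= => /and4P[_ /norP[au _] _ _].
      by apply: contraNneq au => <-.
    by rewrite eqxx adjC ya.
  move=> v v'; rewrite -[[:: a; y]]/([:: a] ++ [:: y]) catA mem_cat [v \in [:: y]]inE => vs v'q.
  rewrite last_cat /= hd'; case/orP: vs => [vu|/eqP->].
    have vP : v \in u ++ [:: a, b & m].
      by move: vu; rewrite !mem_cat !inE => /orP[->//|->]; rewrite orbT.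
    have -> : (v == y) = false by apply/negbTE; apply: contraNneq yq => <-; apply: Pq.
    case: (q'in v' v'q) => [v'w|v'T]; last by have [ne /negPf->] := nPT v v' vP v'T.
    by have [||ne /negPf->] := fua v v'; rewrite ?inE.
  rewrite eqxx /=; case: (q'in v' v'q) => [v'w|v'T].
    split; first by apply: contraNneq yq => ->; apply: dwq.
    move: v'w; rewrite inE => /orP[/eqP->|v'w]; first by rewrite eqxx.
    have -> : adj y v' = false.
      by apply/negbTE; apply: contra nyw => yv; apply/hasP; exists v'.
    apply/esym/negbTE; move: (ipath_uniq ip2) => /= /andP[dw _].
    by apply: contraNneq dw => <-.
  rewrite dT //; case/setD1P: v'T => v'y v'T; rewrite eq_sym; split=> //.
  apply/negbTE/stT => //; apply: (subsetP T2T); apply: T'T2; exact: T''T'.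
exists ((u ++ [:: a; y]) ++ q'); split=> //.
- move=> v; rewrite !mem_cat !inE => /orP[/or3P[vu|/eqP->|/eqP->]|/q'in[/dwq->//|/setD1P[_ ->]]].
  + by rewrite Pq // mem_cat vu.
  + by rewrite aq.
  + by rewrite yT'' orbT.
  + by rewrite orbT.
- move=> z zT; have [->|zy] := eqVneq z y; first by rewrite !mem_cat !inE eqxx !orbT.
  by rewrite mem_cat sTq' ?orbT // !inE zy.
- by move=> v; rewrite qE; case: (u).
by apply: order; [apply: ipath_uniq | rewrite !mem_cat !inE eqxx !orbT].
Qed.

End Selection.

(** * Crowded paths on the claw side *)

Section Crowded.

Variable G : sgraph.
Implicit Types (a b d x y z r : G) (s p q m u w : seq G).
Implicit Types (A B C D E K L N S T W X Y Z : {set G}).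

(** Threading is required for every subset, because the teeth are selected only later. *)
Definition thread_comb D T q :=
  [/\ ipath q /\ {subset q <= D}, forall y, y \in T -> edge_first q y,
      forall y y', y \in T -> y' \in T -> y != y' -> before q y y' \/ before q y' y
    & forall T', T' \subset T -> exists q', threads q T' q'].

(** The [2] is for the ends of the link and the factor [3] for the three shapes given by
    [claw_nbrs]. In the largest class, [n] terminals suffice for a comb of single neighbours, and
    [3 * n * n] for threading [n] of them when no vertex of the link sees more than [n]. *)
Lemma crowded_claw D1 D2 Y n c : ~ has_theta G -> sides D1 D2 Y ->
  conn D2 -> attached Y D2 -> (forall y, y \in Y -> ~ Hub y) ->
  (forall S, S \subset Y -> #|S| = 3 -> ~ tri D1 S) -> 0 < n ->
  3 * (3 * n * n + n) + 2 <= c -> crowded D1 Y c ->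
  exists T q, [/\ T \subset Y, n <= #|T| & claw_comb D1 D1 T q \/ thread_comb D1 T q].
Proof.
move=> noth sd cD2 aD2 nhub notri n0 cn crw.
have [f n1 n2 st] := sd.
have dYD : [disjoint Y & D1].
  by apply/pred0P=> v /=; apply/negP=> /andP[/n1 vn vD]; rewrite vD in vn.
have c0 : 0 < c by apply: leq_trans cn; rewrite addn2.
have nc : n <= c.
  apply: leq_trans cn; apply: leq_trans (leq_addr _ _).
  by rewrite mulnDr; apply: leq_trans (leq_addl _ _); rewrite leq_pmull.
have [q [cq]] := crowded_link c0 st dYD crw.
have att1 x : coll Y [:: x] = att Y [set x].
  by congr att; apply/setP=> v; rewrite !inE.
case=> [[x xD qE]|[y1 [y2 [y1Y y2Y y12 lk]]]].
  exists (att Y [set x]), [:: x]; split; first exact: att_sub.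
    by rewrite -att1 -qE (leq_trans nc).
  by left; apply: vertex_star.
case: (classic (exists2 x, x \in q & n < #|att Y [set x]|)) => [[x xq nx]|no].
  exists (att Y [set x]), [:: x]; split; [exact: att_sub | exact: ltnW |].
  by left; apply: vertex_star => //; apply: lk.2.
have bnd T v : T \subset Y -> v \in q -> #|att T [set v]| <= n.
  move=> sT vq; rewrite leqNgt; apply/negP=> h; apply: no; exists v => //.
  apply: leq_trans h _; apply/subset_leq_card/subsetP=> z /attP[zT ex].
  by apply/attP; split=> //; apply: (subsetP sT).
have ipq := link_ipath lk.
set T := coll Y q :\ y1 :\ y2.
have TY y : y \in T -> y \in Y :\ y1 :\ y2 /\ has (adj y) q.
  rewrite !in_setD1 => /and3P[-> -> /attP[-> [v]]]; rewrite inE => vq yv.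
  by split=> //; apply/hasP; exists v.
have TY' y : y \in T -> y \in Y by move=> /TY[]; rewrite !inE => /and3P[].
have cT : 3 * (3 * n * n + n) <= #|T|.
  rewrite -(leq_add2r 2); apply: leq_trans cn (leq_trans cq _).
  rewrite (cardsD1 y1 (coll Y q)) (cardsD1 y2 (coll Y q :\ y1)) addnA addnC leq_add2l.
  by case: (_ \in _); case: (_ \in _).
have ex y : exists k : 'I_3, y \in T ->
    (nat_of_ord k = 0 -> exists2 a, a \in q /\ adj y a & forall v, v \in q -> adj y v -> v = a) /\
    (nat_of_ord k = 1 -> edge_first q y) /\ (nat_of_ord k = 2 -> edge_first (rev q) y).
  have [yT|yT] := boolP (y \in T); last by exists ord0.
  have [yY hq] := TY y yT.
  by case: (claw_nbrs noth sd cD2 aD2 nhub notri y1Y y2Y y12 lk yY hq) => h;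
    [exists (inord 0) | exists (inord 1) | exists (inord 2)] => _; rewrite inordK.
have [k Hk] := fin_all_exists ex.
have [y yT|i _ ci] := @pigeonhole_cover G 'I_3 T setT (fun i => [set y in T | k y == i]) ord0 (in_setT _).
  by exists (k y); rewrite ?in_setT // in_set yT eqxx.
rewrite cardsT card_ord in ci; set Ti := [set y in T | k y == i] in ci.
have TiT y : y \in Ti -> y \in T /\ k y = i by rewrite in_set => /andP[-> /eqP].
have {}ci : 3 * n * n + n <= #|Ti| by rewrite -(@leq_pmul2l 3) //; apply: leq_trans cT ci.
have sTi : Ti \subset Y by apply/subsetP=> y /TiT[/TY'].
have thr q' y1' y2' : y1' \in Y -> y2' \in Y -> y1' != y2' -> link D1 y1' y2' q' ->
    (forall y, y \in T -> y \in Y :\ y1' :\ y2') -> {subset q' <= q} ->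
    (forall y, y \in Ti -> edge_first q' y) -> exists T q,
    [/\ T \subset Y, n <= #|T| & claw_comb D1 D1 T q \/ thread_comb D1 T q].
  move=> y1'Y y2'Y y12' lk' TY12 sq' le.
  have [|v vq|y y' u a b m d w yT y'T yy' aty ny|v vq||T' [sT' nT' sep thr]] :=
    @select_threads G n n q' Ti n0 _ (link_ipath lk') _ le.
  - by move=> y y' yT y'T; apply: st; apply: (subsetP sTi).
  - apply/negP=> /(subsetP sTi) vY; have := disjointFr dYD vY.
    by rewrite (lk'.2 v vq).
  - have [yT0 _] := TiT y yT; have [y'T0 _] := TiT y' y'T.
    apply/negP=> nm.
    have tr := edge_first_gap st dYD y1'Y y2'Y y12' lk' (TY12 y yT0) (TY12 y' y'T0) yy' aty ny nm.
    apply: (no3 notri y1'Y (TY' y' y'T0) (TY' y yT0)) tr.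
    have := TY12 y yT0; have := TY12 y' y'T0; rewrite !inE => /and3P[_ h1 _] /and3P[_ h2 _].
    by rewrite ![y1' == _]eq_sym [y' == y]eq_sym.
  - by apply: bnd => //; apply: sq'.
  - by apply: leq_trans ci; apply: leq_addr.
  exists T', q'; split=> //; first exact: subset_trans sT' sTi.
  right; split=> //; first by split; [exact: link_ipath lk' | exact: lk'.2].
  by move=> y /(subsetP sT'); apply: le.
case: i @Ti TiT ci sTi thr => [[|[|[|//]]] lti] Ti TiT ci sTi thr.
- have ex1 y : exists a, y \in Ti -> [/\ a \in q, adj y a & forall v, v \in q -> adj y v -> v = a].
    have [yT|yT] := boolP (y \in Ti); last by exists y.
    have [yT0 ky] := TiT y yT; have [h _] := Hk y yT0.
    by have [|a [aq ya] uqa] := h; [rewrite ky | exists a].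
  have [g Hg] := fin_all_exists ex1.
  exists Ti, q; split=> //; first by apply: leq_trans ci; apply: leq_addl.
  left; exists (fun y => [set y]), g; split.
  + by split=> //; exact: lk.2.
  + by move=> y yT; split; [rewrite inE | apply: subsetUl | apply: conn1].
  + move=> y y' yT y'T yy' u v; rewrite !inE => /eqP-> /eqP->; split=> //.
    by apply: st; apply: (subsetP sTi).
  move=> y yT; have [aq ya uqa] := Hg y yT; split=> //; first by exists y; rewrite ?inE.
  move=> u v; rewrite inE => /eqP-> vq; split; last exact: uqa.
  apply: contraTneq (lk.2 v vq) => <-; apply: n1; exact: (subsetP sTi).
- apply: (thr q y1 y2 y1Y y2Y y12 lk) => //.
    by move=> y /TY[].
  by move=> y /TiT[yT ky]; have [_ [h _]] := Hk y yT; apply: h; rewrite ky.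
apply: (thr (rev q) y2 y1 y2Y y1Y _ (link_rev lk)).
- by rewrite eq_sym.
- by move=> y /TY[]; rewrite !inE => /and3P[-> -> ->].
- by move=> v; rewrite mem_rev.
by move=> y /TiT[yT ky]; have [_ [_ h]] := Hk y yT; apply: h; rewrite ky.
Qed.

End Crowded.

(** * Gluing two combs *)

Section Segments.

Variable G : sgraph.
Implicit Types (a b d v x y z r : G) (s p q : seq G).

(** Positions [i] and [j] are both included. *)
Definition seg s i j := drop i (take j.+1 s).

Lemma seg_split s i j : i <= j.+1 -> s = take i s ++ seg s i j ++ drop j.+1 s.
Proof.
move=> ij; rewrite catA /seg.
by rewrite -{1}(take_takel s ij) cat_take_drop cat_take_drop.
Qed.

Lemma seg_ipath s i j : i <= j.+1 -> ipath s -> ipath (seg s i j).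
Proof. by move=> ij; rewrite {1}(seg_split s ij) => /ipath_cat[_ /ipath_cat[]]. Qed.

Lemma mem_seg s i j v : uniq s -> i <= j.+1 -> v \in s ->
  (v \in seg s i j) = (i <= index v s <= j).
Proof.
move=> us ij vs; have e : take j.+1 s = take i s ++ seg s i j.
  by rewrite /seg -{1}(take_takel s ij) cat_take_drop.
have := take_uniq j.+1 us; rewrite e cat_uniq => /and3P[_ /hasPn nd _].
have := in_take j.+1 vs; rewrite e mem_cat in_take // ltnS.
have [vg|vg] := boolP (v \in seg s i j).
  by have := nd v vg; rewrite in_take // -leqNgt orbT => -> <-.
by rewrite orbF => <-; rewrite andbC; case: ltnP.
Qed.

Lemma seg_sub s i j : {subset seg s i j <= s}.
Proof. by move=> v /mem_drop/mem_take. Qed.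

Lemma index_seg s i j v : uniq s -> i <= j.+1 -> v \in seg s i j ->
  index v s = i + index v (seg s i j).
Proof.
move=> us ij vg; have vs := seg_sub vg.
have i_s : i <= size s.
  have := vg; rewrite mem_seg // => /andP[h _]; apply: leq_trans h _.
  exact: index_size.
rewrite {1}(seg_split s ij) index_cat index_cat vg size_takel //.
have := us; rewrite {1}(seg_split s ij) cat_uniq => /and3P[_ /hasPn h _].
by have /negPf-> : v \notin take i s by apply: h; rewrite mem_cat vg.
Qed.

Lemma head_seg s i j x0 : i <= j -> j < size s -> head x0 (seg s i j) = nth x0 s i.
Proof.
move=> ij js; rewrite -nth0 /seg nth_drop addn0 nth_take //.
Qed.

Lemma last_seg s i j x0 : i <= j -> j < size s -> last x0 (seg s i j) = nth x0 s j.
Proof.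
move=> ij js; have sz : size (seg s i j) = (j - i).+1.
  by rewrite size_drop size_takel // subSn.
by rewrite -nth_last sz /= nth_drop nth_take ?subnKC.
Qed.

End Segments.

(** * Assembling the generalized pyramid *)

Section Pyramid.

Variable G : sgraph.
Implicit Types (s p q : seq G).
Implicit Types (S T : {set G}).

Lemma sort_by (f : G -> nat) T : {in T &, injective f} ->
  exists ys : seq G, [/\ size ys = #|T|, {subset ys <= T}
    & forall y0 i j, i < j < size ys -> f (nth y0 ys i) < f (nth y0 ys j)].
Proof.
move=> injf; pose le u v := f u <= f v; exists (sort le (enum T)).
have sz : size (sort le (enum T)) = #|T| by rewrite size_sort cardE.
have sub : {subset sort le (enum T) <= T} by move=> y; rewrite mem_sort mem_enum.
split=> // y0 i j /andP[ij js].
have srt : sorted le (sort le (enum T)) by apply: sort_sorted => u v; apply: leq_total.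
have trl : transitive le by move=> v u w; apply: leq_trans.
have rfl : reflexive le by move=> u; apply: leqnn.
have is_ := ltn_trans ij js.
have h := sorted_leq_nth trl rfl y0 srt i j is_ js (ltnW ij).
rewrite ltn_neqAle [_ <= _]h andbT; apply: contraTneq ij.
move/injf; rewrite !sub ?mem_nth // => /(_ isT isT)/eqP.
by rewrite nth_uniq ?sort_uniq ?enum_uniq // => /eqP->; rewrite ltnn.
Qed.

(** [s1] is the path of single attachments, [s2] that of the triangles. The first and last of the
    [t.+2] teeth are spent on the hole: [P] is the stretch of [s2] between them, and [Q] follows one
    leg, the matching stretch of [s1], and the other leg. The remaining [t] legs become the paths
    between [P] and [Q]. *)
Lemma pyramid_of_combs T s1 s2 (R : G -> {set G}) (a x x' z : G -> G) t :
  #|T| = t.+2 -> ipath s1 -> ipath s2 -> far [set v in s1] [set v in s2] ->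
  (forall y, y \in T -> [/\ conn (R y), a y \in R y,
     [/\ x y \in s2, x' y \in s2 & index (x' y) s2 = (index (x y) s2).+1],
     forall u v, u \in R y -> v \in s2 ->
       u != v /\ adj u v = (u == a y) && ((v == x y) || (v == x' y))
   & [/\ z y \in s1, exists2 u, u \in R y & adj u (z y)
       & forall u v, u \in R y -> v \in s1 -> u != v /\ (adj u v -> v = z y)]]) ->
  (forall y y', y \in T -> y' \in T -> y != y' -> far (R y) (R y')) ->
  {in T &, injective x} ->
  (forall y y', y \in T -> y' \in T -> index (x y) s2 < index (x y') s2 ->
     (index (x y) s2).+1 < index (x y') s2) ->
  (forall y y', y \in T -> y' \in T -> index (x y) s2 < index (x y') s2 ->
     index (z y) s1 <= index (z y') s1) ->
  has_generalized_pyramid G t.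
Proof.
move=> cT ip1 ip2 f12 HT farR injx gap mono.
have u1 := ipath_uniq ip1; have u2 := ipath_uniq ip2.
pose e y := index (x y) s2; pose h y := index (z y) s1.
have inje : {in T &, injective e}.
  move=> y y' yT y'T; have [_ _ [xy _ _] _ _] := HT y yT; have [_ _ [xy' _ _] _ _] := HT y' y'T.
  by move=> /(congr1 (nth (x y) s2)); rewrite !nth_index // => /injx; apply.
have [ys [sz sub inc]] := sort_by inje.
rewrite cT in sz.
(* Each leg is thinned to an induced path ending at its corner [a y], whose first vertex [b y] is
   the only one that sees [z y]. *)
have ex y : exists bs : G * seq G, y \in T -> [/\ ipath (bs.1 :: bs.2),
    {subset bs.1 :: bs.2 <= R y}, adj bs.1 (z y),
    forall v, v \in bs.2 -> ~~ adj v (z y) & last bs.1 bs.2 = a y].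
  have [yT|yT] := boolP (y \in T); last by exists (y, [::]).
  have [cR aR _ _ [_ [u uR uz] _]] := HT y yT.
  have uN : u \in [set v | adj v (z y)] by rewrite inE.
  have [b [s [ips sb bN sN las]]] := conn_ipath_to cR aR uR uN.
  exists (b, s) => _; split=> //; first by move: bN; rewrite inE.
  by move=> v /sN; rewrite inE.
have [bs Hbs] := fin_all_exists ex.
pose b y := (bs y).1; pose r y := b y :: (bs y).2.
have Hr y : y \in T -> [/\ ipath (r y), {subset r y <= R y}, last (b y) (r y) = a y,
    a y \in r y & forall v, v \in r y -> adj v (z y) = (v == b y)].
  move=> yT; have [ipr sr bz nz las] := Hbs y yT; split=> //.
    by rewrite -las /r; apply: mem_last.
  move=> v; rewrite inE => /orP[/eqP->|vs]; first by rewrite bz eqxx.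
  rewrite (negPf (nz v vs)); apply/esym/negbTE.
  have := ipath_uniq ipr => /= /andP[bn _]; apply: contraNneq bn => vb.
  by rewrite -[X in X \in _]/(b y) -vb.
have br y : b y \in r y by rewrite mem_head.
have r2 y u v : y \in T -> u \in r y -> v \in s2 ->
    u != v /\ adj u v = (u == a y) && ((v == x y) || (v == x' y)).
  by move=> yT ur; have [_ _ _ H _] := HT y yT; apply: H; have [_ sr _ _ _] := Hr y yT; apply: sr.
have r1 y u v : y \in T -> u \in r y -> v \in s1 ->
    u != v /\ adj u v = (u == b y) && (v == z y).
  move=> yT ur vs; have [_ sr _ _ hz] := Hr y yT; have [_ _ _ _ [_ _ H]] := HT y yT.
  have [ne hv] := H u v (sr u ur) vs; split=> //.
  apply/idP/andP => [uv|[/eqP-> /eqP->]]; last by rewrite hz ?eqxx.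
  by have vz := hv uv; rewrite vz hz // in uv; rewrite uv vz.
have rr y y' u v : y \in T -> y' \in T -> y != y' -> u \in r y -> v \in r y' -> u != v /\ ~~ adj u v.
  move=> yT y'T yy' ur vr; have [_ sr _ _ _] := Hr y yT; have [_ sr' _ _ _] := Hr y' y'T.
  by apply: (farR y y'); rewrite ?sr ?sr'.
have y00 : 0 < size ys by rewrite sz.
case: ys sz sub inc y00 => // yf ys' sz sub inc _; set ys := yf :: ys' in sz sub inc.
pose Y i := nth yf ys i.
have YT i : i < t.+2 -> Y i \in T by move=> it; apply: sub; apply: mem_nth; rewrite sz.
have Yinc i j : i < j -> j < t.+2 -> e (Y i) < e (Y j).
  by move=> ij jt; apply: inc; rewrite sz ij.
have Ygap i j : i < j -> j < t.+2 -> (e (Y i)).+1 < e (Y j).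
  move=> ij jt; apply: gap; [apply: YT; exact: ltn_trans ij jt | exact: YT | exact: Yinc].
have Yh i j : i <= j -> j < t.+2 -> h (Y i) <= h (Y j).
  rewrite leq_eqVlt => /orP[/eqP->//|ij] jt.
  apply: mono; [apply: YT; exact: ltn_trans ij jt | exact: YT | exact: Yinc].
have Yneq i j : i < t.+2 -> j < t.+2 -> i != j -> Y i != Y j.
  move=> it jt; apply: contraNneq => E; case: (ltngtP i j) => // ij.
    by have := Yinc i j ij jt; rewrite E ltnn.
  by have := Yinc j i ij it; rewrite E ltnn.
have t0 : 0 < t.+2 by []; have t1 : t.+1 < t.+2 by [].
pose f := Y 0; pose l := Y t.+1.
have fT : f \in T := YT 0 t0; have lT : l \in T := YT t.+1 t1.
have fl : f != l by apply: Yneq.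
have efl : (e f).+1 < e l by apply: Ygap.
have hfl : h f <= h l by apply: Yh.
have [_ _ [xf x'f ixf] _ [zf _ _]] := HT f fT.
have [_ _ [xl x'l ixl] _ [zl _ _]] := HT l lT.
have els : e l < size s2 by rewrite index_mem.
have hls : h l < size s1 by rewrite index_mem.
(* The stretch runs from [x' f] to [x l], leaving out [x f] and [x' l], so that each of the two
   corners sees exactly one vertex of it. *)
pose p := seg s2 (e f).+1 (e l); pose g := seg s1 (h f) (h l).
have ij2 : (e f).+1 <= (e l).+1 by apply: leqW; apply: ltnW.
have ij1 : h f <= (h l).+1 by apply: leqW.
have ipp : ipath p by apply: seg_ipath.
have ipg : ipath g by apply: seg_ipath.
have ps : {subset p <= s2} by apply: seg_sub.
have gs : {subset g <= s1} by apply: seg_sub.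
have hp v : head v p = x' f.
  by rewrite head_seg // ?(ltnW efl) // -ixf nth_index.
have lp v : last v p = x l by rewrite last_seg // ?(ltnW efl) // nth_index.
have hg v : head v g = z f by rewrite head_seg // nth_index.
have lg v : last v g = z l by rewrite last_seg // nth_index.
have memp v : v \in s2 -> (v \in p) = ((e f).+1 <= index v s2 <= e l) by apply: mem_seg.
have xlp : x l \in p by rewrite memp // -/(e l) leqnn ltnW.
have memg v : v \in s1 -> (v \in g) = (h f <= index v s1 <= h l) by apply: mem_seg.
have fg : far [set v in g] [set v in p].
  by move=> u v; rewrite !inE => /gs ug /ps vp; apply: f12; rewrite inE.
pose q := rev (r f) ++ g ++ r l.
have zg i : i < t.+2 -> z (Y i) \in g.
  move=> it; have [_ _ _ _ [zs _ _]] := HT _ (YT i it).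
  by rewrite memg //; apply/andP; split; apply: Yh => //; rewrite -ltnS.
have memq v : v \in q = [|| v \in r f, v \in g | v \in r l] by rewrite !mem_cat mem_rev.
have lrev v : last v (rev (r f)) = b f by rewrite /r rev_cons last_rcons.
have hrev v : head v (rev (r f)) = a f.
  have [_ _ las _ _] := Hr f fT; rewrite -las /r.
  by case/lastP: (bs f).2 => // s w; rewrite -rcons_cons rev_rcons last_rcons.
have ipq : ipath q.
  have [ipf _ _ _ _] := Hr f fT; have [ipl _ _ _ _] := Hr l lT.
  have j1 : joins g (r l).
    move=> u v ug vr; have [ne E] := r1 l v u lT vr (gs u ug).
    by rewrite eq_sym adjC E andbC lg.
  apply/ipath_cat; split; [exact: ipath_rev | by apply/ipath_cat |].
  move=> u v; rewrite mem_rev mem_cat => ur vgr.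
  have -> : head u (g ++ r l) = z f.
    by have := zg 0 t0; have := hg u; rewrite /=; case: (g).
  rewrite lrev; case/orP: vgr => [vg|vr]; first by apply: (r1 f) => //; apply: gs.
  have [ne /negPf->] := rr f l u v fT lT fl ur vr; split=> //.
  have [nv _] := r1 l v (z f) lT vr zf.
  by rewrite (negPf nv) andbF.
have zfp v y : y \in T -> v \in r y -> v \notin g.
  move=> yT vr; apply/negP=> /gs vs; have [] := r1 y v v yT vr vs; by rewrite eqxx.
have hole : is_hole (verts p :|: verts q).
  exists (p ++ rev q); last first.
    by apply/setP=> v; rewrite /verts in_setU !in_set (mem_cat v p) (mem_rev q).
  apply: hole_of_paths => //.
  - exact: ipath_rev.
  - by move: xlp; case: (p).
  - by rewrite size_rev /q !size_cat size_rev /r /= addSn.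
  - have s_p : 2 <= size p.
      by rewrite /p /seg size_drop size_takel // subSS ltn_subRL addn1.
    have s_g : 1 <= size g by have := zg 0 t0; case: (g).
    rewrite size_rev /q !size_cat size_rev /r /=.
    by move: s_p s_g; clear; lia.
  move=> u v up; rewrite mem_rev => vq.
  have us := ps u up.
  have -> : head u (rev q) = a l.
    have [_ _ las _ _] := Hr l lT.
    rewrite /q !rev_cat -las /r /=; case/lastP: (bs l).2 => [|s w] //=.
    by rewrite -rcons_cons rev_rcons last_rcons.
  have -> : last u (rev q) = a f.
    by rewrite /q rev_cat last_cat revK /= ; have [_ _ <- _ _] := Hr f fT.
  rewrite lp hp.
  have ipe : (e f).+1 <= index u s2 <= e l by rewrite -memp.
  move: vq; rewrite memq => /or3P[vr|vg|vr].
  - have [ne E] := r2 f v u fT vr us; rewrite eq_sym adjC E; split=> //.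
    have -> : (u == x f) = false.
      by apply/negP=> /eqP uE; move: ipe; rewrite uE ltnn.
    have -> : (v == a l) = false.
      have [_ _ _ al _] := Hr l lT; have [ne' _] := rr f l v (a l) fT lT fl vr al.
      exact: negbTE.
    by rewrite /= andbF andbC.
  - have [] := fg v u; rewrite ?inE // eq_sym adjC => -> /negPf->; split=> //.
    have nva y : y \in T -> (v == a y) = false.
      move=> yT; apply/negbTE; have [_ _ _ al _] := Hr y yT.
      by apply: contraTneq vg => ->; apply: (zfp _ y).
    by rewrite !nva // !andbF.
  have [ne E] := r2 l v u lT vr us; rewrite eq_sym adjC E; split=> //.
  have -> : (u == x' l) = false.
    by apply/negP=> /eqP uE; move: ipe; rewrite uE ixl ltnn andbF.
  have -> : (v == a f) = false.
    have lf : l != f by rewrite eq_sym.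
    have [_ _ _ al _] := Hr f fT; have [ne' _] := rr l f v (a f) lT fT lf vr al.
    exact: negbTE.
  by rewrite !orbF andbF orbF andbC.
(* Teeth [0] and [t.+1] are used up by the hole, hence the shift. *)
pose M (i : 'I_t) := Y i.+1.
have Mlt (i : 'I_t) : i.+1 < t.+1 by rewrite ltnS.
have MT i : M i \in T by apply: YT; apply: ltnW; apply: Mlt.
have Mf i : f != M i by apply: Yneq => //; apply: ltnW; apply: Mlt.
have Ml i : l != M i.
  by apply: Yneq => //; [apply: ltnW; apply: Mlt | rewrite gtn_eqF // Mlt].
have MM (i j : 'I_t) : i != j -> M i != M j.
  by move=> ij; apply: Yneq; [apply/ltnW/Mlt | apply/ltnW/Mlt | rewrite eqSS].
have ef i : (e f).+1 < e (M i) by apply: Ygap => //; apply/ltnW/Mlt.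
have el i : (e (M i)).+1 < e l by apply: Ygap.
have xp i : x (M i) \in p.
  have [_ _ [xs _ _] _ _] := HT _ (MT i).
  rewrite memp //; apply/andP; split; first exact/ltnW/ef.
  exact/ltnW/ltnW/el.
have x'p i : x' (M i) \in p.
  have [_ _ [_ xs ix] _ _] := HT _ (MT i).
  rewrite memp // ix; apply/andP; split; first exact/ltnW/ltnW/ef.
  exact/ltnW/el.
have idx v v' : v \in p -> v' \in p -> (index v p <= index v' p) = (index v s2 <= index v' s2).
  by move=> vp v'p; rewrite !(@index_seg _ s2 (e f).+1 (e l)) // leq_add2l.
have rq i u v : u \in r (M i) -> v \in q -> u != v /\ adj u v = (u == b (M i)) && (v == z (M i)).
  move=> ur; rewrite memq.
  have nz y w : y \in T -> w \in r y -> (w == z (M i)) = false.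
    move=> yT wr; apply/negbTE; have := zfp w y yT wr.
    by apply: contraNneq => ->; apply: zg; apply/ltnW/Mlt.
  case/or3P=> [vr|vg|vr]; last 1 first.
  - have [|ne /negPf->] := rr (M i) l u v (MT i) lT _ ur vr; first by rewrite eq_sym.
    by rewrite (nz l) // andbF.
  - have [|ne /negPf->] := rr (M i) f u v (MT i) fT _ ur vr; first by rewrite eq_sym.
    by rewrite (nz f) // andbF.
  by apply: r1 => //; apply: gs.
have rp i u v : u \in r (M i) -> v \in p -> u != v /\
    adj u v = (u == a (M i)) && ((v == x (M i)) || (v == x' (M i))).
  by move=> ur /ps vs; apply: r2.
(* The legs were chosen to start at [b], whereas the definition lists [a] first; hence the
   reversal. *)
exists p, q, (fun i => rev (r (M i))), (fun i => a (M i)), (fun i => b (M i)),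
  (fun i => x (M i)), (fun i => x' (M i)), (fun i => z (M i)).
have ne_of s : 0 < size s -> s != [::] by case: s.
have p0 : p != [::] by move: xlp; case: (p).
split.
- split.
  + exact: ipath_is_path.
  + by apply: ipath_is_path => //; rewrite /q /r rev_cons; case: (rev _).
  + move=> i; have [ipr _ las _ _] := Hr _ (MT i); split.
    * by apply: ipath_is_path; [rewrite /r rev_cons; case: (rev _) | apply: ipath_rev].
    * rewrite -las /r; case/lastP: (bs (M i)).2 => // s w.
      by rewrite -rcons_cons rev_rcons last_rcons.
    * by rewrite /r rev_cons last_rcons.
- split.
  + apply/pred0P=> v /=; apply/negP=> /andP[vp]; rewrite memq => /or3P[vr|vg|vr].
    * by have [] := r2 f v v fT vr (ps v vp); rewrite eqxx.
    * by have [] := fg v v; rewrite ?inE ?eqxx.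
    * by have [] := r2 l v v lT vr (ps v vp); rewrite eqxx.
  + move=> i; split; apply/pred0P=> v /=; apply/negP=> /andP[]; rewrite mem_rev => vr vq.
      by have [] := rp i v v vr vq; rewrite eqxx.
    by have [] := rq i v v vr vq; rewrite eqxx.
  + move=> i j ij; apply/pred0P=> v /=; apply/negP=> /andP[]; rewrite !mem_rev => vi vj.
    by have [] := rr _ _ v v (MT i) (MT j) (MM i j ij) vi vj; rewrite eqxx.
- exact: hole.
- split.
  + move=> i; apply/setP=> v; have [_ _ _ ar _] := Hr _ (MT i).
    rewrite /nbrs_in /verts !inE; have [vp|vp] := boolP (v \in p).
      by have [_ ->] := rp i _ v ar vp; rewrite eqxx.
    apply/esym/negbTE; rewrite negb_or.
    by apply/andP; split; apply: contraNneq vp => ->.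
  + move=> i; have [_ _ [xs xs' ix] _ _] := HT _ (MT i).
    have nh v : v \in s2 -> (e f).+1 < index v s2 -> forall v0, v != head v0 p.
      move=> vs hv v0; rewrite hp; apply: contraTneq hv => ->; by rewrite ixf ltnn.
    have nl v : v \in s2 -> index v s2 < e l -> forall v0, v != last v0 p.
      move=> vs hv v0; rewrite lp; apply: contraTneq hv => ->; by rewrite ltnn.
    have e1 := ef i; have e2 := el i.
    split.
    * by rewrite inE xp nh // nl // ltnW.
    * by rewrite inE x'p nh ?nl // ix // ltnW.
    * by rewrite (ipath_adj ip2) // ix eqxx.
  + move=> i; apply/setP=> v; rewrite /nbrs_in /verts !inE.
    have [vq|vq] := boolP (v \in q).
      by have [_ ->] := rq i _ v (br _) vq; rewrite eqxx.
    apply/esym/negbTE; apply: contraNneq vq => ->.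
    by rewrite memq zg ?orbT //; apply/ltnW/Mlt.
  + move=> i u v; rewrite /verts !inE mem_rev negb_or => /andP[/andP[ua ub] ur].
    case/orP=> [vp|vq].
      by have [_ ->] := rp i u v ur vp; rewrite (negPf ua).
    by have [_ ->] := rq i u v ur vq; rewrite (negPf ub).
  + move=> i j ij u v; rewrite /verts !inE !mem_rev => ur vr.
    by have [] := rr _ _ u v (MT i) (MT j) (MM i j ij) ur vr.
have ltM (i j : 'I_t) : i < j -> (e (M i)).+1 < e (M j).
  by move=> ij; apply: Ygap; [rewrite ltnS | apply/ltnW/Mlt].
split.
- by move=> i; have [_ _ [_ _ ix] _ _] := HT _ (MT i); rewrite idx // ix.
- move=> i j ij; have [_ _ [_ _ ix] _ _] := HT _ (MT i).
  by rewrite idx // ix ltnW // ltM.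
- move=> i j ji; have [_ _ [_ _ ix] _ _] := HT _ (MT i).
  apply/eqP=> E; have := ltM i j; rewrite ji ltnSn => /(_ isT).
  by rewrite /e -E ix ltnn.
- move=> i j ij; rewrite /q.
  have zq (k : 'I_t) : index (z (M k)) (rev (r f) ++ g ++ r l) = size (rev (r f)) + index (z (M k)) g.
    have zk : z (M k) \in g by apply: zg; apply/ltnW/Mlt.
    rewrite index_cat mem_rev index_cat zk.
    by have /negPf-> : z (M k) \notin r f by apply: contraTN zk; apply: zfp.
  have zk (k : 'I_t) : z (M k) \in g by apply: zg; apply/ltnW/Mlt.
  rewrite !zq leq_add2l -(leq_add2l (h f)) -!(@index_seg _ s1 (h f) (h l)) //.
  by apply: Yh; [rewrite ltnS | apply/ltnW/Mlt].
Qed.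

End Pyramid.

(** Ramsey's theorem for pairs, coloured by whether [g] follows the order of [f]; on a pair of the
    other colour it strictly decreases. *)
Lemma monotone_subset (n : nat) : exists N, forall (V : finType) (T : {set V}) (f g : V -> nat),
  {in T &, injective f} -> N <= #|T| -> exists2 T' : {set V}, T' \subset T & #|T'| = n /\
    ((forall u v, u \in T' -> v \in T' -> f u < f v -> g u <= g v) \/
     (forall u v, u \in T' -> v \in T' -> f u < f v -> g v <= g u)).
Proof.
have [N HN] := ramsey 2 n n; exists N => V T f g injf NT.
pose P (S : {set V}) := forall u v, u \in S -> v \in S -> f u < f v -> g u <= g v.
have [T' sT' H] := HN V T P NT; exists T' => //.
have pairP u v : u \in T' -> v \in T' -> f u < f v -> [set u; v] \subset T' /\ #|[set u; v]| = 2.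
  move=> uT vT fuv; split; first by apply/subsetP=> w; rewrite !inE => /orP[]/eqP->.
  by rewrite cards2; case: eqP => // E; rewrite E ltnn in fuv.
case: H => [] [cT H]; split=> //; [left|right] => u v uT vT fuv;
  have [sS cS] := pairP u v uT vT fuv; have HS := H _ sS cS.
  by apply: HS; rewrite ?inE ?eqxx ?orbT.
rewrite leqNgt; apply/negP=> guv; apply: HS => u' v'.
rewrite !inE => /orP[]/eqP-> /orP[]/eqP->; rewrite ?ltnn //; first by rewrite (ltnW guv).
by rewrite ltnNge (ltnW fuv).
Qed.

(** * Two combs on the same terminals *)

Section Final.

Variable G : sgraph.
Implicit Types (u v w y z : G) (s p q : seq G) (A C D S T Y : {set G}).

Lemma index_rev_le s v v' : uniq s -> v \in s -> v' \in s ->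
  index v' s <= index v s -> index v (rev s) <= index v' (rev s).
Proof.
move=> us vs v's le.
have e w : w \in s -> index w (rev s) = size s - (index w s).+1.
  move=> ws; have iw : index w s < size s by rewrite index_mem.
  have h : size s - (index w s).+1 < size s by rewrite ltn_subrL (leq_ltn_trans _ iw).
  have -> : index w (rev s) = index (nth w (rev s) (size s - (index w s).+1)) (rev s).
    by rewrite nth_rev // subnSK // subKn ?nth_index // ltnW.
  by rewrite index_uniq ?size_rev ?rev_uniq.
by rewrite !e // leq_sub2l.
Qed.

(** Distinct positions of equal parity differ by at least two, so that the triangle edges of
    different teeth will share no vertex. *)
Lemma same_parity_subset (n : nat) (T : {set G}) (f : G -> nat) : 2 * n <= #|T| ->
  exists T' : {set G}, [/\ T' \subset T, n <= #|T'| &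
    forall u v, u \in T' -> v \in T' -> f u < f v -> (f u).+1 < f v].
Proof.
move=> nT; pose E := [set y | odd (f y)].
have par T' b : (forall y, y \in T' -> odd (f y) = b) ->
    forall u v, u \in T' -> v \in T' -> f u < f v -> (f u).+1 < f v.
  move=> H u v uT vT; rewrite leq_eqVlt => /orP[/eqP E0|//].
  by have := H v vT; rewrite -E0 /= (H u uT); case: (b).
have c := cardsID E T.
have [le|lt] := leqP n #|T :&: E|.
  exists (T :&: E); split=> //; first exact: subsetIl.
  by apply: (par _ true) => y; rewrite !inE => /andP[_ ->].
exists (T :\: E); split; first exact: subsetDl.
  by rewrite -(leq_add2l #|T :&: E|) c; apply: leq_trans nT; rewrite mul2n -addnn leq_add2r ltnW.
by apply: (par _ false) => y; rewrite !inE => /andP[/negbTE].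
Qed.

Section Assembly.

Variables (D1 D2 Y : {set G}) (t : nat).
Hypothesis sd : sides D1 D2 Y.
Hypothesis nhub : forall y, y \in Y -> ~ Hub y.
Hypothesis nopyr : ~ has_generalized_pyramid G t.

Variables (T1 : {set G}) (s2 : seq G) (L : G -> {set G}) (a x x' : G -> G).
Hypothesis T1Y : T1 \subset Y.
Hypothesis tt : tri_teeth D2 D2 T1 s2 L a x x'.

Let e y := index (x y) s2.

Lemma teeth_pos_inj : {in T1 &, injective e}.
Proof.
have [_ _ _ aL ix] := tt => y y' yT y'T.
have [_ [xq _] _ _] := aL y yT; have [_ [xq' _] _ _] := aL y' y'T.
by move=> /(congr1 (nth (x y) s2)); rewrite !nth_index // => /ix; apply.
Qed.

Lemma legs_D y u : y \in T1 -> u \in L y -> u = y \/ u \in D2.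
Proof.
move=> yT uL; have [_ lL _ _ _] := tt; have [_ sL _] := lL y yT.
by have := subsetP sL u uL; rewrite !inE => /orP[/eqP->|]; [left|right].
Qed.

(** The two legs of each terminal are merged there into one connected set leading from [q] to
    [s2]. *)
Lemma claw_comb_False q T (L1 : G -> {set G}) (z : G -> G) : T \subset T1 -> #|T| = t.+2 ->
  ipath q -> {subset q <= D1} -> legs D1 T1 L1 ->
  (forall y y', y \in T1 -> y' \in T1 -> y != y' -> far (L1 y) (L1 y')) ->
  (forall y, y \in T1 -> [/\ z y \in q, exists2 u, u \in L1 y & adj u (z y)
     & forall u v, u \in L1 y -> v \in q -> u != v /\ (adj u v -> v = z y)]) ->
  (forall u v, u \in T -> v \in T -> e u < e v -> (e u).+1 < e v) ->
  (forall u v, u \in T -> v \in T -> e u < e v -> index (z u) q <= index (z v) q) ->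
  False.
Proof.
move=> sT cT ipq sq lL1 fL1 zL1 gap mono; apply: nopyr.
have [[ip2 sq2] lL fL aL ix] := tt; have [f n1 n2 st] := sd.
have TT y : y \in T -> y \in T1 by apply: (subsetP sT).
have TY y : y \in T -> y \in Y by move=> /TT; apply: (subsetP T1Y).
have D1L y u : y \in T1 -> u \in L1 y -> u = y \/ u \in D1.
  move=> yT uL; have [_ sL _] := lL1 y yT.
  by have := subsetP sL u uL; rewrite !inE => /orP[/eqP->|]; [left|right].
apply: (@pyramid_of_combs G T q s2 (fun y => L1 y :|: L y) a x x' z t cT ipq ip2) => //.
- by move=> u v; rewrite !inE => /sq uD /sq2 vD; apply: f.
- move=> y yT; have yT1 := TT y yT; have [aLy [xq xq'] ixy hL] := aL y yT1.
  have [yL _ cL] := lL y yT1; have [yL1 _ cL1] := lL1 y yT1.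
  have [zq [w wL wz] hz] := zL1 y yT1.
  split=> //.
  + by apply: (connU cL1 cL yL1 yL); rewrite eqxx.
  + by rewrite inE aLy orbT.
  + move=> u v; rewrite inE => /orP[uL1|uL] vq; last exact: hL.
    have [uy|uD1] := D1L y u yT1 uL1; first by apply: hL; rewrite // uy.
    have [ne /negPf->] := f u v uD1 (sq2 v vq); split=> //; apply/esym/negbTE.
    rewrite negb_and; apply/orP; left; apply: contraTneq uD1 => ->.
    have [->|aD2] := legs_D yT1 aLy; first by apply: n1; apply: TY.
    by apply/negP=> aD1; have [] := f _ _ aD1 aD2; rewrite eqxx.
  split=> //; first by exists w; rewrite // inE wL.
  move=> u v; rewrite inE => /orP[uL1|uL] vq; first exact: hz.
  have [uy|uD2] := legs_D yT1 uL; first by apply: hz; rewrite // uy.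
  by have [ne /negPf] := f v u (sq v vq) uD2; rewrite eq_sym adjC => ->.
- move=> y y' yT y'T yy'; have yT1 := TT y yT; have y'T1 := TT y' y'T.
  have [yL _ cL] := lL y yT1; have [yL1 _ cL1] := lL1 y yT1.
  have [y'L _ _] := lL y' y'T1; have [y'L1 _ _] := lL1 y' y'T1.
  move=> u v; rewrite !inE => /orP[uL|uL] /orP[vL|vL].
  + exact: (fL1 y y').
  + have [uy|uD] := D1L y u yT1 uL; first by apply: (fL y y'); rewrite // uy.
    have [vy|vD] := legs_D y'T1 vL; first by apply: (fL1 y y'); rewrite // vy.
    exact: f.
  + have [uy|uD] := legs_D yT1 uL; first by apply: (fL1 y y'); rewrite // uy.
    have [vy|vD] := D1L y' v y'T1 vL; first by apply: (fL y y'); rewrite // vy.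
    by have [] := f v u vD uD; rewrite eq_sym adjC.
  + exact: (fL y y').
- by move=> y y' /TT yT /TT y'T; apply: ix.
Qed.

(** The legs of [y1] and [y2] and the stretch of [s2] between their triangles form the link; it
    contains [x y] because the tooth of [y] lies in between. This is what excludes trivial legs in
    the threaded case. *)
Lemma tri_link y y1 y2 : y1 \in T1 -> y \in T1 -> y2 \in T1 -> e y1 < e y -> e y < e y2 ->
  exists2 s, link D2 y1 y2 s & x y \in s.
Proof.
move=> y1T yT y2T lt1 lt2; have [[ip2 sq2] lL fL aL ix] := tt.
have y12 : y1 != y2 by apply: contraTneq (ltn_trans lt1 lt2) => ->; rewrite ltnn.
have [y1L _ c1] := lL y1 y1T; have [y2L _ c2] := lL y2 y2T.
have [a1L [x1q x1q'] ix1 h1] := aL y1 y1T; have [a2L [x2q x2q'] ix2 h2] := aL y2 y2T.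
have [_ [xq _] _ _] := aL y yT.
have [sA [ipA subA lasA]] := conn_ipath c1 y1L a1L.
have [sB [ipB subB lasB]] := conn_ipath c2 a2L y2L.
have u2 := ipath_uniq ip2.
have els : e y2 < size s2 by rewrite index_mem.
have lt12 : (e y1).+1 <= e y2 by apply: ltn_trans lt2.
have ij : (e y1).+1 <= (e y2).+1 by apply: leqW.
pose g := seg s2 (e y1).+1 (e y2).
have ipg : ipath g by apply: seg_ipath.
have hg v : head v g = x' y1 by rewrite head_seg // -ix1 nth_index.
have lg v : last v g = x y2 by rewrite last_seg // nth_index.
have memg v : v \in s2 -> (v \in g) = ((e y1).+1 <= index v s2 <= e y2) by apply: mem_seg.
have gs : {subset g <= s2} by apply: seg_sub.
have g0 : g != [::].
  have : x y \in g by rewrite memg // -/(e y) lt1 ltnW.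
  by case: (g).
have jA : joins (y1 :: sA) g.
  move=> u v uA vg; have [ne ->] := h1 u v (subA u uA) (gs v vg); split=> //.
  rewrite /= lasA hg.
  have -> // : (v == x y1) = false.
  by apply/negP=> /eqP vE; have := vg; rewrite memg ?gs // vE ltnn.
have jB : joins g (a y2 :: sB).
  move=> u v ug vB; have [] := h2 v u (subB v vB) (gs u ug).
  rewrite eq_sym adjC => ne ->; split=> //; rewrite lg /=.
  have -> : (u == x' y2) = false.
    by apply/negP=> /eqP uE; have := ug; rewrite memg ?gs // uE ix2 ltnn andbF.
  by rewrite orbF andbC.
have fAB : far [set v in y1 :: sA] [set v in a y2 :: sB].
  by move=> u v; rewrite !inE -!in_cons => /subA uA /subB vB; apply: (fL y1 y2).
have ip : ipath ((y1 :: sA) ++ g ++ (a y2 :: sB)).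
  apply/ipath_cat; split=> //; first by apply/ipath_cat.
  move=> u v uA; rewrite mem_cat => vgB.
  have hE : head u (g ++ a y2 :: sB) = head u g by case: (g) g0.
  rewrite hE; have [vg|vB] := boolP (v \in g); first exact: jA.
  rewrite (negPf vB) /= in vgB.
  have [||ne /negPf->] := fAB u v; rewrite ?inE //.
  split=> //; have -> : (v == head u g) = false; last by rewrite andbF.
  apply/negbTE; apply: contraNneq vB => ->; case: (g) g0 => // ? ? _; exact: mem_head.
have [sC E] : exists sC, a y2 :: sB = rcons sC y2.
  case/lastP: sB lasB {ipB subB jB fAB ip} => [|sB w]; first by move=> /= ->; exists [::].
  by rewrite last_rcons => ->; exists (a y2 :: sB).
have U := ipath_uniq ip; rewrite E in U ip.
have Efull : (y1 :: sA) ++ g ++ rcons sC y2 = y1 :: rcons (sA ++ g ++ sC) y2.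
  by rewrite !rcons_cat.
rewrite Efull in ip U.
exists (sA ++ g ++ sC); last by rewrite !mem_cat memg // -/(e y) lt1 ltnW // orbT.
split=> // v; rewrite !mem_cat.
move: U; rewrite /= rcons_uniq mem_rcons inE negb_or => /and3P[/andP[_ n1'] n2' _].
have vy1 : v \in sA ++ g ++ sC -> v != y1 by move=> h; apply: contraNneq n1' => <-.
have vy2 : v \in sA ++ g ++ sC -> v != y2 by move=> h; apply: contraNneq n2' => <-.
move=> /or3P[vA|vg|vC].
- have vA' : v \in y1 :: sA by rewrite inE vA orbT.
  have [vE|//] := legs_D y1T (subA v vA').
  by have := vy1; rewrite mem_cat vA vE eqxx => /(_ isT).
- by apply: sq2; apply: gs.
have vB : v \in a y2 :: sB by rewrite E mem_rcons inE vC orbT.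
have [vE|//] := legs_D y2T (subB v vB).
by have := vy2; rewrite !mem_cat vC !orbT vE eqxx => /(_ isT).
Qed.

End Assembly.

End Final.

(** * The threaded case *)

Section ThreadCase.

Variable G : sgraph.
Implicit Types (u v w y z : G) (s p q : seq G) (A C D S T Y : {set G}).

Lemma index_lt_split p1 p2 g v : uniq (p1 ++ g :: p2) -> v \in p1 ++ g :: p2 ->
  (index v (p1 ++ g :: p2) < index g (p1 ++ g :: p2) -> v \in p1) /\
  (index g (p1 ++ g :: p2) < index v (p1 ++ g :: p2) -> v \in p2).
Proof.
rewrite cat_uniq mem_cat inE => /and3P[_ /norP[ng _] _] vin.
rewrite !index_cat (negPf ng) /= eqxx addn0.
have [v1|v1] := boolP (v \in p1).
  by split=> //; rewrite ltnNge index_size.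
rewrite (negPf v1) orFb in vin; split; first by rewrite ltnNge leq_addr.
by case: eqP vin => [->|_]; rewrite ?eqxx ?addn0 ?ltnn //; case: eqP => [->|//].
Qed.

Lemma first_nbr q y : uniq q -> has (adj y) q ->
  exists2 v, v \in q /\ adj y v & index v q = find (adj y) q.
Proof.
move=> uq hq; exists (nth y q (find (adj y) q)).
  by rewrite mem_nth -?has_find // nth_find.
by rewrite index_uniq -?has_find.
Qed.

Lemma edge_first_has q y : edge_first q y -> has (adj y) q.
Proof.
by move=> [u [a [b [m [d [w [-> ya _ _ _]]]]]]]; rewrite has_cat /= ya orbT.
Qed.

Lemma edge_first_nonadjacent q y : ipath q -> edge_first q y -> exists v v',
  [/\ v \in q, v' \in q, v != v', ~~ adj v v' & adj y v && adj y v'].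
Proof.
move=> ip [u [a [b [m [d [w [qE ya _ yd _]]]]]]]; exists a, d.
have := @ipath_far _ (rcons u a) (b :: m) (d :: w); rewrite cat_rcons /= -qE => /(_ ip isT a d).
rewrite !inE mem_rcons mem_head eqxx => /(_ isT isT)[ne na].
by rewrite ya yd; split=> //; rewrite qE !(mem_cat, inE) eqxx ?orbT.
Qed.

Lemma before_of_find q y y' : uniq q -> edge_first q y -> edge_first q y' ->
  before q y y' \/ before q y' y -> find (adj y) q <= find (adj y') q -> before q y y'.
Proof.
move=> uq le le' [//|bf] h.
have [v [vq yv] iv] := first_nbr uq (edge_first_has le).
have [v' [v'q yv'] iv'] := first_nbr uq (edge_first_has le').
by have := bf v' v v'q vq yv' yv; rewrite iv iv' ltnNge h.
Qed.

(** The link leaves [y1] at its last neighbour and enters [y2] at its first one after that; all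
    neighbours of [y] lie strictly between, and two of them are nonadjacent. *)
Lemma thread_mid D Y q y1 y y2 : stable Y -> [disjoint Y & D] ->
  y1 \in Y -> y2 \in Y -> y1 != y2 -> ipath q -> {subset q <= D} ->
  edge_first q y1 -> edge_first q y -> edge_first q y2 -> before q y1 y -> before q y y2 -> mid D y1 y2 y.
Proof.
move=> stY dYD y1Y y2Y y12 ip sq le1 le le2 b1 b2.
have uq := ipath_uniq ip.
have nD z v : z \in Y -> v \in q -> z != v.
  by move=> zY /sq vD; apply: contraFneq (disjointFr dYD zY) => ->.
have [r [h [s1 [qE yh nr]]]] : exists r h s1, [/\ q = s1 ++ h :: r, adj y1 h & ~~ has (adj y1) r].
  have hr : has (adj y1) (rev q) by rewrite has_rev; apply: edge_first_has.
  have [u [a [v [rqE ya nu]]]] := split_first hr.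
  exists (rev u), a, (rev v); rewrite has_rev; split=> //.
  by rewrite -[q]revK rqE rev_cat rev_cons cat_rcons.
have hq : h \in q by rewrite qE mem_cat mem_head orbT.
have after v : v \in q -> index h q < index v q -> v \in r.
  by move=> vq; rewrite qE in vq uq *; case: (index_lt_split uq vq).
have yr v : v \in q -> adj y v -> v \in r.
  by move=> vq yv; apply: after => //; apply: b1.
have [vy [vyq yvy] _] := first_nbr uq (edge_first_has le).
have y2r v : v \in q -> adj y2 v -> v \in r.
  move=> vq y2v; apply: after => //; apply: ltn_trans (b2 vy v vyq vq yvy y2v).
  exact: b1.
have [v2 [v2q y2v2] _] := first_nbr uq (edge_first_has le2).
have h2 : has (adj y2) r by apply/hasP; exists v2 => //; apply: y2r.
have [s3 [g [s4 [rE y2g n3]]]] := split_first h2.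
have qE' : q = (s1 ++ h :: s3) ++ g :: s4 by rewrite qE rE -catA.
have gq : g \in q by rewrite qE' mem_cat mem_head orbT.
have hr : h \notin r by move: uq; rewrite qE cat_uniq /= => /and4P[].
have y3 v : v \in q -> adj y v -> v \in s3.
  move=> vq yv; have vr := yr v vq yv.
  have lt := b2 v g vq gq yv y2g; have vq' := vq.
  rewrite qE' in uq vq' lt; have [hh _] := index_lt_split uq vq'.
  move: (hh lt); rewrite mem_cat inE => /or3P[vs1|/eqP vh|//].
    have := uq; rewrite -qE' qE cat_uniq => /and3P[_ /hasPn /(_ v)].
    by rewrite inE vr orbT vs1 => /(_ isT).
  by rewrite -vh vr in hr.
have ipi : ipath (h :: rcons s3 g).
  have E : q = s1 ++ (h :: rcons s3 g) ++ s4 by rewrite qE rE /= cat_rcons.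
  by move: ip; rewrite E => /ipath_cat[_ /ipath_cat[]].
have sub : {subset h :: rcons s3 g <= q}.
  move=> v; rewrite qE rE inE mem_rcons inE !(mem_cat, inE).
  by case/or3P=> ->; rewrite ?orbT.
have subr : {subset rcons s3 g <= r}.
  by move=> v; rewrite rE mem_rcons inE mem_cat inE => /orP[]->; rewrite ?orbT.
exists (h :: rcons s3 g); split; last first.
  have [v [v' [vq v'q vv' avv' yvv']]] := edge_first_nonadjacent ip le.
  have [yv yv'] := andP yvv'.
  by exists v, v'; rewrite !inE !mem_rcons !inE !y3 // !orbT.
split; last by move=> v /sub/sq.
apply/ipath_cons; split.
  rewrite -cats1; apply/ipath_cat; split=> // v v' vs; rewrite inE => /eqP->.
  rewrite eq_sym nD ?sub //; split=> //=.
  rewrite eqxx andbT last_rcons adjC; move: vs; rewrite inE mem_rcons inE => /or3P[/eqP->|/eqP->|v3].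
  - have -> : adj y2 h = false.
      by apply/negbTE; apply: contra hr; apply: y2r.
    by apply/esym/negbTE; apply: contraNneq hr => ->; apply: subr; rewrite mem_rcons mem_head.
  - by rewrite y2g eqxx.
  have -> : adj y2 v = false by apply/negbTE; apply: contra n3 => yv; apply/hasP; exists v.
  apply/esym/negbTE; have := ipath_uniq ipi => /= /andP[_]; rewrite rcons_uniq => /andP[g3 _].
  by apply: contraNneq g3 => <-.
move=> v v'; rewrite inE => /eqP->; rewrite mem_rcons inE => /orP[/eqP->|vs].
  split=> //; rewrite (negPf (stY y1 y2 y1Y y2Y)) /= eqxx /=.
  by apply/esym/negbTE; rewrite eq_sym eq_sym; apply: nD.
rewrite nD ?sub //; split=> //; rewrite /= eqxx /=.
move: vs; rewrite inE => /orP[/eqP->|v'r]; first by rewrite yh eqxx.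
have -> : adj y1 v' = false.
  by apply/negbTE; apply: contra nr => yv; apply/hasP; exists v' => //; apply: subr.
by apply/esym/negbTE; apply: contraNneq hr => <-; apply: subr.
Qed.

Section Assembly.

Variables (D1 D2 Y : {set G}) (t : nat).
Hypothesis sd : sides D1 D2 Y.
Hypothesis nhub : forall y, y \in Y -> ~ Hub y.
Hypothesis nopyr : ~ has_generalized_pyramid G t.

Variables (T1 : {set G}) (s2 : seq G) (L : G -> {set G}) (a x x' : G -> G).
Hypothesis T1Y : T1 \subset Y.
Hypothesis tt : tri_teeth D2 D2 T1 s2 L a x x'.

Let e y := index (x y) s2.

(* A leg of length 0 would make its terminal a hub, by the path along [q]. *)
Lemma thread_leg_nontrivial q y y1 y2 : thread_comb D1 T1 q ->
  y \in T1 -> y1 \in T1 -> y2 \in T1 -> e y1 < e y -> e y < e y2 ->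
  before q y1 y /\ before q y y2 \/ before q y2 y /\ before q y y1 -> a y != y.
Proof.
move=> [[ipq sq] le sep thr] yT y1T y2T lt1 lt2 bf; apply/eqP=> ay.
have [_ n1 n2 st] := sd.
have dYD : [disjoint Y & D1].
  by apply/pred0P=> v /=; apply/negP=> /andP[/n1 vn vD]; rewrite vD in vn.
have y12 : y1 != y2 by apply: contraTneq (ltn_trans lt1 lt2) => ->; rewrite ltnn.
have TY y0 : y0 \in T1 -> y0 \in Y by apply: (subsetP T1Y).
have [s lk xs] := tri_link tt y1T yT y2T lt1 lt2.
have md : mid D1 y1 y2 y.
  case: bf => -[b1 b2].
    by apply: (thread_mid st dYD (TY _ y1T) (TY _ y2T) y12 ipq sq (le _ y1T) (le _ yT) (le _ y2T)).
  apply: mid_sym; rewrite eq_sym in y12.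
  by apply: (thread_mid st dYD (TY _ y2T) (TY _ y1T) y12 ipq sq (le _ y2T) (le _ yT) (le _ y1T)).
have [[_ _] _ _ aL _] := tt; have [aLy [xq _] _ h] := aL y yT.
apply: (hub_mid sd (TY _ y1T) (TY _ y2T) y12 (nhub (TY _ yT)) md lk xs).
by have [_] := h (a y) (x y) aLy xq; rewrite ay !eqxx => ->.
Qed.

(** Each terminal lies on the threaded path and is itself the attachment [z], so its leg is cut down
    to the component of [a y] left when [y] is removed. This needs [a y] different from [y], which
    is available for teeth with others on both sides: two of the [t.+4] terminals are spent for
    this, and two more close the hole. *)
Lemma thread_comb_False q T : thread_comb D1 T1 q -> T \subset T1 -> #|T| = t.+4 ->
  (forall u v, u \in T -> v \in T -> e u < e v -> (e u).+1 < e v) ->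
  (forall u v, u \in T -> v \in T -> e u < e v -> before q u v) \/
  (forall u v, u \in T -> v \in T -> e u < e v -> before q v u) -> False.
Proof.
move=> tc sT cT gap bf.
have [[ipq sq] le sep thr] := tc.
have [[ip2 sq2] lL fL aL ix] := tt; have [f n1 n2 st] := sd.
have TT y : y \in T -> y \in T1 by apply: (subsetP sT).
have TY y : y \in T -> y \in Y by move=> /TT; apply: (subsetP T1Y).
have injT y y' : y \in T -> y' \in T -> y != y' -> e y != e y'.
  move=> yT y'T; apply: contraNneq => E; apply/eqP.
  by apply: (teeth_pos_inj tt) => //; apply: TT.
have [y0 y0T] : exists y, y \in T by apply/set0Pn; rewrite -card_gt0 cT.
case: (arg_minnP e y0T) => yf yfT0 minf; have {yfT0} fT : yf \in T by [].
case: (arg_maxnP e y0T) => yl ylT0 maxl; have {ylT0} lT : yl \in T by [].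
have fl : yf != yl.
  apply/eqP=> E; have : #|T| <= 1; last by rewrite cT.
  have h w : w \in T -> e w = e yf.
    by move=> wT; apply/eqP; rewrite eqn_leq [e yf <= _]minf // andbT E; apply: maxl.
  apply/card_le1_eqP=> u v uT vT; apply/eqP; apply: contraT => uv.
  by have := injT v u vT uT uv; rewrite !h // eqxx.
pose T' := T :\ yf :\ yl.
have T'T y : y \in T' -> y \in T by rewrite !inE => /and3P[].
have cT' : #|T'| = t.+2.
  by have := cT; rewrite (cardsD1 yf) fT (cardsD1 yl) !inE eq_sym fl lT => -[].
have nontriv y : y \in T' -> a y != y.
  move=> yT'; have yT := T'T y yT'; move: yT'; rewrite !inE => /and3P[yl' yf' _].
  have lt1 : e yf < e y by rewrite ltn_neqAle minf // andbT; apply: injT; rewrite // eq_sym.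
  have lt2 : e y < e yl by rewrite ltn_neqAle [_ <= _]maxl // andbT; apply: injT.
  apply: (thread_leg_nontrivial tc (TT _ yT) (TT _ fT) (TT _ lT) lt1 lt2).
  by case: bf => bf; [left|right]; split; apply: bf.
have sT'1 : T' \subset T1 by apply/subsetP=> y /T'T/TT.
have [q' [ipq' sq' sTq' _ ord]] := thr T' sT'1.
have ex y : exists R, y \in T' -> [/\ conn R, a y \in R, R \subset L y, y \notin R
    & exists2 u, u \in R & adj u y].
  have [yT'|] := boolP (y \in T'); last by exists set0.
  have yT1 := subsetP sT'1 y yT'; have ay := nontriv y yT'.
  have [yL sL cL] := lL y yT1; have [aLy _ _ _] := aL y yT1.
  have [|R [sR aR cR clR]] := @comp_ex G (L y :\ y) (a y); first by rewrite !inE ay.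
  have sRL : R \subset L y by apply: subset_trans sR (subsetDl _ _).
  have yR : y \notin R by apply/negP=> /(subsetP sR); rewrite !inE eqxx.
  exists R => _; split=> //.
  have [|u [v [uR vL vR uv]]] := conn_edge cL sRL _ yL yR; first by apply/set0Pn; exists (a y).
  exists u => //; have [<-//|vy] := eqVneq v y.
  by rewrite (clR u v uR) ?inE ?vy in vR.
have [R HR] := fin_all_exists ex.
have uq' := ipath_uniq ipq'.
have q'in v : v \in q' -> v \in q \/ v \in T'.
  by move=> /sq'; rewrite inE inE => /orP[]; [left|right].
have RD y u : y \in T' -> u \in R y -> u \in D2.
  move=> yT' uR; have [_ _ sR yR _] := HR y yT'.
  have [uy|//] := legs_D tt (subsetP sT'1 y yT') (subsetP sR u uR).
  by move: yR; rewrite -{1}uy uR.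
(* As [a y] is not [y], the terminal sees nothing of [s2]; hence the threaded path stays far from
   [s2]. *)
have T's2 y v : y \in T' -> v \in s2 -> y != v /\ ~~ adj y v.
  move=> yT' vs; have yT1 := subsetP sT'1 y yT'; have [yL _ _] := lL y yT1.
  have [_ _ _ h] := aL y yT1; have [ne ->] := h y v yL vs; split=> //.
  by rewrite eq_sym (negPf (nontriv y yT')).
have far_q'2 : far [set v in q'] [set v in s2].
  move=> u v; rewrite !inE => /q'in[uq|uT] vs; last exact: T's2.
  by apply: f; [apply: sq | apply: sq2].
have main s1 : ipath s1 -> s1 =i q' ->
    (forall y y', y \in T' -> y' \in T' -> e y < e y' -> index y s1 <= index y' s1) -> False.
  move=> ip1 s1q mono; apply: nopyr.
  apply: (@pyramid_of_combs G T' s1 s2 R a x x' id t cT' ip1 ip2) => //.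
  - by move=> u v; rewrite !inE s1q => uq vs; apply: far_q'2; rewrite inE.
  - move=> y yT'; have yT1 := subsetP sT'1 y yT'.
    have [cR aR sR yR eR] := HR y yT'; have [aLy [xq xq'] ixy h] := aL y yT1.
    split=> //; first by move=> u v uR; apply: h; apply: (subsetP sR).
    split=> //; first by rewrite s1q sTq'.
    move=> u v uR; rewrite s1q => /q'in[vq|vT'].
      have [ne /negPf na] := f v u (sq v vq) (RD y u yT' uR).
      by rewrite eq_sym ne adjC na.
    have [vy|vy] := eqVneq v y.
      by rewrite vy; split=> //; apply: contraNneq yR => yu; rewrite -{1}yu.
    have vT1 := subsetP sT'1 v vT'; have [vL _ _] := lL v vT1; rewrite eq_sym in vy.
    by have [-> /negPf->] := fL y v yT1 vT1 vy u v (subsetP sR u uR) vL.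
  - move=> y y' yT' y'T' yy'; have [_ _ sR _ _] := HR y yT'; have [_ _ sR' _ _] := HR y' y'T'.
    by apply: far_sub sR sR' (fL y y' _ _ yy'); apply: (subsetP sT'1).
  - by move=> y y' yT' y'T'; apply: ix; apply: (subsetP sT'1).
  - by move=> y y' /T'T yT /T'T y'T; apply: gap.
have neq y y' : e y < e y' -> y != y' by apply: contraTneq => ->; rewrite ltnn.
(* If the two orders are opposite, the threaded path is reversed. *)
case: bf => bf.
  apply: (main q' ipq') => // y y' yT' y'T' lt; apply: ltnW.
  by apply: ord => //; [apply: neq | apply: bf => //; apply: T'T].
apply: (main (rev q')); [exact: ipath_rev | by move=> v; rewrite mem_rev |].
move=> y y' yT' y'T' lt; apply: index_rev_le; rewrite ?sTq' //.
apply: ltnW; apply: ord => //; first by rewrite eq_sym neq.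
by apply: bf => //; apply: T'T.
Qed.

End Assembly.

End ThreadCase.

(** * The bound when triangles are excluded on one side and claws on the other *)

(** The triangle comb is found on [D2] and its terminals are then fed to the claw side, so that one
    set of terminals carries both combs. *)
Lemma bounded_sides t : exists N, forall (G : sgraph) (D1 D2 Y : {set G}),
  class_Ctt t G -> sides D1 D2 Y -> conn D1 -> conn D2 ->
  attached Y D1 -> attached Y D2 -> (forall y, y \in Y -> ~ Hub y) ->
  (forall S : {set G}, S \subset Y -> #|S| = 3 -> ~ tri D1 S) ->
  (forall S : {set G}, S \subset Y -> #|S| = 3 -> ~ claw D2 S) -> #|Y| < N.
Proof.
have [n1 Hn1] := monotone_subset t.+4.
(* The factor [2] is for equal parity and the successor for positivity; [c1] is the bound of
   [crowded_claw] for [J1], and [m] terminals start the growth on the claw side. [J2] is also at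
   least [t] and greater than [1], as [tri_side] requires, and [c2] allows for the two terminals
   lost in [crowded_tri]. *)
pose J1 := (2 * n1).+1; pose c1 := 3 * (3 * J1 * J1 + J1) + 2.
pose m := (weight J1 c1 J1 + c1).+1.
pose J2 := m + t + 2; pose c2 := J2 + 2.
exists (weight J2 c2 J2 + c2).+1 => G D1 D2 Y [[[noC4 noth nopr noew] nocl] nopyr] sd.
move=> cD1 cD2 aD1 aD2 nhub notri noclaw; rewrite ltnS leqNgt; apply/negP=> bigY.
have [f nD1 nD2 st] := sd.
have dYD1 : [disjoint Y & D1].
  by apply/pred0P=> v /=; apply/negP=> /andP[/nD1 vn vD]; rewrite vD in vn.
have dYD2 : [disjoint Y & D2].
  by apply/pred0P=> v /=; apply/negP=> /andP[/nD2 vn vD]; rewrite vD in vn.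
have nocl' (A : {set G}) : clique A -> #|A| <> t by move=> cA tA; apply: nocl; exists A.
have [T2 [s2 [sT2 cT2 tc2]]] : exists (T : {set G}) (q : seq G),
    [/\ T \subset Y, J2 <= #|T| & tri_comb D2 D2 T q].
  have [||//|crw] := tri_side nocl' _ _ cD2 aD2 dYD2 st noclaw bigY.
  - by rewrite /J2 addn2.
  - by rewrite /J2 -addnA addnCA leq_addr.
  have c22 : 2 < c2 by rewrite /c2 /J2 !addn2.
  have [T [q [sT cT tT]]] := crowded_tri c22 st dYD2 noclaw crw.
  by exists T, q; split=> //; rewrite /c2 addnK in cT.
have sub3 (P : {set G} -> Prop) (T : {set G}) : T \subset Y ->
    (forall S : {set G}, S \subset Y -> #|S| = 3 -> ~ P S) ->
    forall S : {set G}, S \subset T -> #|S| = 3 -> ~ P S.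
  by move=> sT H S sS; apply: H; apply: subset_trans sS sT.
have T2Y y : y \in T2 -> y \in Y by apply: (subsetP sT2).
have st2 : stable T2 by move=> u v /T2Y uY /T2Y; apply: st.
have aT2 (D : {set G}) : attached Y D -> attached T2 D by move=> aD y /T2Y; apply: aD.
have dT2 : [disjoint T2 & D1] by apply: disjointWl dYD1.
have mT2 : weight J1 c1 J1 + c1 < #|T2|.
  by apply: leq_trans cT2; rewrite /J2 -addnA leq_addr.
have [T1 [s1 [sT1 cT1 tc1]]] : exists (T : {set G}) (q : seq G),
    [/\ T \subset T2, J1 <= #|T| & claw_comb D1 D1 T q \/ thread_comb D1 T q].
  have [[T [q [sT cT tT]]]|crw] := claw_side noC4 (ltn0Sn _) cD1 (aT2 _ aD1) dT2 st2
      (sub3 _ _ sT2 notri) mT2.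
    by exists T, q; split=> //; left.
  have sd2 : sides D1 D2 T2 by split=> // y /T2Y; [apply: nD1 | apply: nD2].
  exact: (crowded_claw noth sd2 cD2 (aT2 _ aD2) (fun y yT => nhub y (T2Y y yT))
    (sub3 _ _ sT2 notri) (ltn0Sn _) (leqnn _) crw).
have sT1Y := subset_trans sT1 sT2.
have [L [a [x [x' tt]]]] := tri_comb_sub sT1 tc2.
pose e y := index (x y) s2.
have inje : {in T1 &, injective e} by apply: teeth_pos_inj tt.
have [T0 [sT0 cT0 gap]] := @same_parity_subset G n1 T1 e (ltnW cT1).
have inj0 : {in T0 &, injective e}.
  by move=> u v uT vT; apply: inje; apply: (subsetP sT0).
have gap' (T : {set G}) : T \subset T0 ->
    forall u v, u \in T -> v \in T -> e u < e v -> (e u).+1 < e v.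
  by move=> sT u v uT vT; apply: gap; apply: (subsetP sT).
case: tc1 => [[L1 [z [[ip1 sq1] lL1 fL1 zL1]]]|tc1].
  have [T sT [cT mono]] := Hn1 G T0 e (fun y => index (z y) s1) inj0 cT0.
  (* Here [t.+2] teeth suffice; the other two serve the threaded case. *)
  have le2 : t.+2 <= #|T| by rewrite cT; apply: leqW; apply: leqW.
  have [T' sT' cT'] := subset_of_card le2.
  have sT'0 := subset_trans sT' sT; have sT'1 := subset_trans sT'0 sT0.
  have TT y : y \in T' -> y \in T by apply: (subsetP sT').
  have T1in y : y \in T' -> y \in T1 by apply: (subsetP sT'1).
  case: mono => mono.
    apply: (claw_comb_False sd nopyr sT1Y tt sT'1 cT' ip1 sq1 lL1 fL1 zL1 (gap' _ sT'0)).
    by move=> u v uT vT; apply: mono; apply: TT.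
  apply: (claw_comb_False (z := z) sd nopyr sT1Y tt sT'1 cT' (ipath_rev ip1) _ lL1 fL1 _ (gap' _ sT'0)).
  - by move=> v; rewrite mem_rev; apply: sq1.
  - move=> y yT; have [zq ez hz] := zL1 y yT; rewrite mem_rev; split=> //.
    by move=> u v uL; rewrite mem_rev; apply: hz.
  move=> u v uT vT lt; apply: index_rev_le; first exact: ipath_uniq.
  - by have [] := zL1 u (T1in u uT).
  - by have [] := zL1 v (T1in v vT).
  by apply: mono; rewrite ?TT.
have [[ip1 sq1] le sep _] := tc1.
(* Terminals are compared by their first neighbours on [s1]; as their neighbourhoods are separated,
   this decides which one is [before] the other. *)
have [T sT [cT mono]] := Hn1 G T0 e (fun y => find (adj y) s1) inj0 cT0.
have sTT := subset_trans sT sT0; have T1in y : y \in T -> y \in T1 by apply: (subsetP sTT).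
have neq u v : e u < e v -> u != v by apply: contraTneq => ->; rewrite ltnn.
apply: (thread_comb_False sd nhub nopyr sT1Y tt tc1 sTT cT (gap' _ sT)).
case: mono => mono; [left|right] => u v uT vT lt.
  apply: before_of_find; [exact: ipath_uniq | exact/le/T1in | exact/le/T1in | | exact: mono].
  by apply: sep; [exact: T1in | exact: T1in | exact: neq].
apply: before_of_find; [exact: ipath_uniq | exact/le/T1in | exact/le/T1in | | exact: mono].
by apply: sep; [exact: T1in | exact: T1in | rewrite eq_sym neq].
Qed.

(** * Minimal separators *)

Section Separator.

Variables (G : sgraph) (S : {set G}).
Implicit Types u v w : G.

Definition component u := [set w | (w \notin S) && same_component S u w].

Lemma component_refl u : u \notin S -> u \in component u.
Proof. by move=> uS; rewrite inE uS /same_component connect0. Qed.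

Lemma component_closed u v w : v \in component u -> w \notin S -> adj v w -> w \in component u.
Proof.
rewrite !inE => /andP[vS uv] wS vw; rewrite wS /=.
by apply: connect_trans uv (connect1 _); rewrite /= vS wS.
Qed.

Lemma same_component_sym (X : {set G}) u v : same_component X u v = same_component X v u.
Proof.
by apply: sym_connect_sym => a b /=; rewrite adjC; case: (a \in X); case: (b \in X).
Qed.

Lemma component_conn u : conn (component u).
Proof.
move=> B sB /set0Pn[b bB] clB; apply/eqP; rewrite eqEsubset sB.
apply/subsetP=> w; rewrite inE => /andP[wS uw].
have := subsetP sB b bB; rewrite inE => /andP[bS ub].
have /connectP[p pth ->] : same_component S b w.
  by apply: connect_trans uw; rewrite -/(same_component S b u) same_component_sym.
elim: p b bB bS {ub} pth => //= v p IH b bB bS /andP[/and3P[_ vS bv] pth].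
apply: IH pth => //; apply: (clB b v bB _ bv).
by apply: component_closed bv => //; apply: (subsetP sB).
Qed.

(** If [s] saw nothing of the component of [u], that component would stay closed after [s] is
    returned to the graph, and [u] would still be separated from [v]. *)
Lemma component_attached u v s : u \notin S -> s \in S -> v \notin component u -> v \notin S ->
  same_component (S :\ s) u v -> exists2 x, x \in component u & adj s x.
Proof.
move=> uS sS vC vS /connectP[p pth vE]; apply: NNPP => no.
suff last_in b q : b \in component u -> path [rel a b | [&& a \notin S :\ s, b \notin S :\ s & adj a b]] b q ->
    last b q \in component u.
  by have := last_in u p (component_refl uS) pth; rewrite -vE (negPf vC).
elim: q b => //= w q IH b bC /andP[/and3P[_ wS bw] pthq].
apply: IH pthq; apply: (component_closed bC _ bw); apply/negP=> wS'.
have ws : w = s by apply/eqP; move: wS; rewrite !inE wS' andbT negbK.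
by apply: no; exists b; rewrite // -ws adjC.
Qed.

End Separator.

Lemma minimal_separator_sides (G : sgraph) (S : {set G}) : minimal_separator S ->
  exists D1 D2 : {set G}, [/\ conn D1, conn D2, far D1 D2,
    forall y, y \in S -> y \notin D1 /\ y \notin D2 & attached S D1 /\ attached S D2].
Proof.
move=> [u [v [uS vS nuv minS]]].
have nin w z : z \in S -> z \notin component S w by move=> zS; rewrite inE zS.
have vu : v \notin component S u by rewrite inE vS.
have uv : u \notin component S v by rewrite inE uS same_component_sym.
exists (component S u), (component S v); split; try exact: component_conn.
- move=> a b aC bC; have far0 : b \notin component S u.
    apply: contra nuv => bC'; move: bC bC'; rewrite !inE => /andP[_ vb] /andP[_ ub].
    by apply: connect_trans ub _; rewrite -/(same_component S b v) same_component_sym.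
  split; first by apply: contraNneq far0 => <-.
  apply: contra far0; apply: component_closed aC _.
  by move: bC; rewrite inE => /andP[].
- by move=> y yS; rewrite !nin.
split=> s sS; have same := minS (S :\ s) (properD1 sS).
  exact: component_attached same.
by apply: (component_attached (v := u)) => //; rewrite same_component_sym.
Qed.

Theorem theorem6p2 (t : nat) :
  exists tau : nat,
    forall (G : sgraph) (S Y : {set G}),
      class_Ctt t G ->
      minimal_separator S ->
      Y \subset S ->
      (forall y : G, y \in Y -> ~ Hub y) ->
      stable Y ->
      #|Y| <= tau.
Proof.
(* Triples are coloured by whether they have a claw in [D1]. Both colours lead to the same bound
   [N], with the sides exchanged. *)
have [N HN] := bounded_sides t; have [tau Htau] := ramsey 3 N N.
exists tau => G S Y cG /minimal_separator_sides[D1 [D2 [cD1 cD2 f nS [aS1 aS2]]]] sYS nhub st.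
rewrite leqNgt; apply/negP=> /ltnW/(Htau G Y (claw D1))[Z sZY H].
have [[[_ noth nopr _] _] _] := cG.
have ZS z : z \in Z -> z \in S by move=> /(subsetP sZY)/(subsetP sYS).
have sd : sides D1 D2 Z.
  split=> //; try by move=> y /ZS/nS[].
  by move=> u v /(subsetP sZY) uY /(subsetP sZY); apply: st.
have aZ (D : {set G}) : attached S D -> attached Z D by move=> aD y /ZS; apply: aD.
have nhZ z : z \in Z -> ~ Hub z by move=> /(subsetP sZY); apply: nhub.
have [_ _ _ stZ] := sd.
have cot (D T : {set G}) : conn D -> (forall y, y \in S -> y \notin D) -> attached S D ->
    T \subset Z -> #|T| = 3 -> claw D T \/ tri D T.
  move=> cD nD aD sT cT; apply: claw_or_tri => //.
  - by move=> u v /(subsetP sT) uZ /(subsetP sT); apply: stZ.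
  - apply/pred0P=> v /=; apply/negP=> /andP[/(subsetP sT)/ZS/nD vn vD].
    by rewrite vD in vn.
  by move=> y /(subsetP sT); apply: aZ.
have cot1 (T : {set G}) := @cot D1 T cD1 (fun y yS => (nS y yS).1) aS1.
have cot2 (T : {set G}) := @cot D2 T cD2 (fun y yS => (nS y yS).2) aS2.
(* A claw in [D1] excludes one in [D2], so every triple has a triangle in [D2], which excludes one
   in [D1]. In the other colour every triple has a triangle in [D1], which excludes one in [D2]. *)
case: H => [] [cZ H].
  have noclaw2 (T : {set G}) : T \subset Z -> #|T| = 3 -> ~ claw D2 T.
    by move=> sT cT; apply: (not_both_claw noth sd sT cT nhZ (H T sT cT)).
  have notri1 (T : {set G}) : T \subset Z -> #|T| = 3 -> ~ tri D1 T.
    move=> sT cT t1; case: (cot2 T sT cT) => [/noclaw2|t2]; first exact.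
    exact: (not_both_tri nopr sd sT cT nhZ t1 t2).
  by have := HN G D1 D2 Z cG sd cD1 cD2 (aZ _ aS1) (aZ _ aS2) nhZ notri1 noclaw2; rewrite cZ ltnn.
have notri2 (T : {set G}) : T \subset Z -> #|T| = 3 -> ~ tri D2 T.
  move=> sT cT t2; case: (cot1 T sT cT) => [/H|t1]; first exact.
  exact: (not_both_tri nopr sd sT cT nhZ t1 t2).
have := HN G D2 D1 Z cG (sides_sym sd) cD2 cD1 (aZ _ aS2) (aZ _ aS1) nhZ notri2 H.
by rewrite cZ ltnn.
Qed.
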